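(* Let $\xi(x)=\sum_{p\ge 2}\alpha_p x^p$ be a mixture with $\alpha_2>0$. Then there exists $\beta_\xi\in\left(0,\frac{1}{\sqrt{2\alpha_2}}\right]$ such that for every $\beta$ with $0<\beta<\beta_\xi$, $$\left|F_N-N\frac{\beta^2}{2}\xi(1)-\sum_{k=1}^\infty\frac{2\mu_kC_{N,k}-\mu_k^2}{4k}\right|\ \longrightarrow\ 0\quad\text{in probability (under }\mathbb{P}_N),\text{ as }N\to\infty.$$ Moreover, if $\xi(x)=\alpha_2x^2$, then this holds with $\beta_\xi=\frac{1}{\sqrt{2\alpha_2}}$.
   Context: A mixture is a non-zero power series $\xi(x)=\sum_{p\ge2}\alpha_p x^p$ (sum over integers $p\ge2$) with $\alpha_p\ge0$ for all $p$ and radius of convergence greater than one. For $N\ge1$, under a probability $\mathbb{P}_N$ with expectation $\mathbb{E}_N$, let $J=(J_{ij})_{i,j=1,\ldots,N}$ be a GOE random matrix: $J_{ii}\sim\mathcal{N}(0,2)$ for all $i$, $J_{ij}=J_{ji}\sim\mathcal{N}(0,1)$ for $i\ne j$, and the $J_{ij}$, $i\le j$, are independent. Set $$H_N^2(\sigma)=\frac{1}{\sqrt{2N}}\sum_{i,j=1}^NJ_{ij}\sigma_i\sigma_j$$ (the superscript $2$ is an index, not a square). Let $\tilde H_N$ be a centered Gaussian process on the sphere $\{\sigma\in\mathbb{R}^N:|\sigma|=\sqrt N\}$, independent of $J$, also defined under $\mathbb{P}_N$, with covariance $\mathbb{E}_N[\tilde H_N(\sigma)\tilde H_N(\sigma')]=N\tilde\xi\left(\frac{\sigma\cdot\sigma'}{N}\right)$,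 where $\tilde\xi(x)=\xi(x)-\alpha_2x^2$. The Hamiltonian is $$H_N(\sigma)=\sqrt{\alpha_2}\,H_N^2(\sigma)+\tilde H_N(\sigma),$$ which is a centered Gaussian process with covariance $N\xi(\sigma\cdot\sigma'/N)$. Let $E$ denote expectation with respect to the uniform probability measure on $\sigma\in\{\pm1\}^N$, and for $\beta\ge0$ let $$Z_N=E[\exp(\beta H_N(\sigma))],\qquad F_N=\log Z_N.$$ The centered weighted cycle counts are $$C_{N,k}=\frac{1}{N^{k/2}}\sum_{i_0,\ldots,i_{k-1}\in\{1,\ldots,N\}\text{ distinct}}J_{i_0i_1}J_{i_1i_2}\cdots J_{i_{k-1}i_0}-(N-1)1_{\{k=2\}},\qquad k=1,2,\ldots$$ (for $k=1$ the summand is $J_{i_0i_0}$; $C_{N,k}=0$ for $k>N$), and $\mu_k=\left(\sqrt{2\alpha_2}\,\beta\right)^k$, $k=1,2,\ldots$. *)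

(* Defs.v *)
From HB Require Import structures.
From mathcomp Require Import all_boot all_order all_algebra.
From mathcomp Require Import all_classical all_reals all_analysis.
Set Implicit Arguments.
Unset Strict Implicit.
Unset Printing Implicit Defensive.
Import Order.TTheory GRing.Theory Num.Theory.
Import numFieldNormedType.Exports.
Local Open Scope classical_set_scope.
Local Open Scope ring_scope.

Section mixture.
Variable R : realType.
Implicit Types (alpha : nat -> R) (x : R).

Definition convergence_radius alpha : \bar R :=
  ereal_sup [set `|x|%:E | x in [set x : R | cvgn (pseries alpha x)]].

(* [alpha] is the full coefficient sequence of the power series, so the
   absence of terms of degree 0 and 1 is part of the definition. *)
Record mixture alpha : Prop := Mixture {
  mixture_coef0 : alpha 0%N = 0;
  mixture_coef1 : alpha 1%N = 0;
  mixture_ge0 : forall p, 0 <= alpha p;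
  mixture_neq0 : exists p, alpha p != 0;
  mixture_radius : (1%:E < convergence_radius alpha)%E }.

Definition xi alpha x : R := limn (pseries alpha x).

Definition xi_tilde alpha x : R := xi alpha x - alpha 2%N * x ^+ 2.

End mixture.

Section gaussian.
Variable R : realType.

(* [normal_prob m 0] is by convention a uniform law, whence the case split. *)
Definition gaussian_law (m v : R) (B : set R) : \bar R :=
  if v == 0 then \d_m B else normal_prob m (Num.sqrt v) B.

Context {d : measure_display} {T : measurableType d} (P : probability T R).

Definition has_gaussian_law (X : T -> R) (m v : R) : Prop :=
  forall B : set R, measurable B -> pushforward P X B = gaussian_law m v B.

Definition gaussian_process (I : Type) (X : I -> {RV P >-> R}) : Prop :=
  forall (n : nat) (t : 'I_n -> I) (a : 'I_n -> R),
    exists m v : R, 0 <= v /\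
      has_gaussian_law (fun w => \sum_(i < n) a i * X (t i) w) m v.

Definition centered_gaussian_process (I : Type) (X : I -> {RV P >-> R})
    (K : I -> I -> R) : Prop :=
  [/\ gaussian_process X,
      forall s, ('E_P[X s] = 0)%E &
      forall s t, ('E_P[X s \* X t] = (K s t)%:E)%E].

Definition mutually_independent (I : finType) (D : {set I})
    (X : I -> {RV P >-> R}) : Prop :=
  forall (F : {set I}) (B : I -> set R), F \subset D ->
    (forall i, measurable (B i)) ->
    P (\bigcap_(i in [set` F]) X i @^-1` B i) =
      (\prod_(i in F) P (X i @^-1` B i))%E.

Definition sigma_generated (I : Type) (X : I -> {RV P >-> R}) : set (set T) :=
  <<s \bigcup_i preimage_set_system setT (X i) measurable >>.

Definition independent_families (I I' : Type) (X : I -> {RV P >-> R})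
    (Y : I' -> {RV P >-> R}) : Prop :=
  forall A B, sigma_generated X A -> sigma_generated Y B ->
    P (A `&` B) = (P A * P B)%E.

Record GOE (N : nat) (J : 'I_N -> 'I_N -> {RV P >-> R}) : Prop := IsGOE {
  GOE_diag : forall i, has_gaussian_law (J i i) 0 2;
  GOE_offdiag : forall i j, i != j -> has_gaussian_law (J i j) 0 1;
  GOE_sym : forall i j w, J i j w = J j i w;
  GOE_indep : mutually_independent [set ij : 'I_N * 'I_N | (ij.1 <= ij.2)%N]
                (fun ij => J ij.1 ij.2) }.

End gaussian.

Section sphere.
Variables (R : realType) (N : nat).

Definition dotp (s t : 'rV[R]_N) : R := \sum_(i < N) s 0 i * t 0 i.

(* The library norm on ['rV[R]_N] is the sup norm. *)
Definition enorm (s : 'rV[R]_N) : R := Num.sqrt (dotp s s).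

Definition sphere : set 'rV[R]_N := [set s | enorm s = Num.sqrt N%:R].

Definition signs (e : {ffun 'I_N -> bool}) : 'rV[R]_N :=
  \row_(i < N) (-1) ^+ e i.

Lemma signs_sphere e : sphere (signs e).
Proof.
rewrite /sphere /= /enorm /dotp; congr Num.sqrt.
under eq_bigr do rewrite mxE -signr_addb addbb.
by rewrite sumr_const card_ord.
Qed.

Definition cube_point (e : {ffun 'I_N -> bool}) : set_type sphere :=
  SigSub (mem_set (signs_sphere e)).

End sphere.

Section model.
Variables (R : realType) (alpha : nat -> R).
Context {d : measure_display} {T : measurableType d} (P : probability T R).
Variables (N : nat) (J : 'I_N -> 'I_N -> {RV P >-> R})
  (Ht : set_type (@sphere R N) -> {RV P >-> R}).

Record spin_model : Prop := SpinModel {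
  model_GOE : GOE J;
  model_process : centered_gaussian_process Ht
    (fun s t => N%:R * xi_tilde alpha (dotp (val s) (val t) / N%:R));
  model_indep :
    independent_families (fun ij : 'I_N * 'I_N => J ij.1 ij.2) Ht }.

Definition hamiltonian2 (s : 'rV[R]_N) (w : T) : R :=
  (Num.sqrt (2 * N%:R))^-1 *
    \sum_(i < N) \sum_(j < N) J i j w * s 0 i * s 0 j.

Definition hamiltonian (s : set_type (@sphere R N)) (w : T) : R :=
  Num.sqrt (alpha 2%N) * hamiltonian2 (val s) w + Ht s w.

Definition partition_function (beta : R) (w : T) : R :=
  (2 ^+ N)^-1 *
    \sum_(e : {ffun 'I_N -> bool}) expR (beta * hamiltonian (cube_point R e) w).

Definition free_energy (beta : R) (w : T) : R := ln (partition_function beta w).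

(* [ordS] is the cyclic successor on ['I_k]. *)
Definition cycle_count (k : nat) (w : T) : R :=
  (Num.sqrt N%:R ^+ k)^-1 *
    \sum_(i : {ffun 'I_k -> 'I_N} | injectiveb i)
      \prod_(l < k) J (i l) (i (ordS l)) w
  - (N%:R - 1) *+ (k == 2%N).

End model.

Definition mu (R : realType) (alpha : nat -> R) (beta : R) (k : nat) : R :=
  (Num.sqrt (2 * alpha 2%N) * beta) ^+ k.

Definition cvg_in_probability0 (R : realType) (d : nat -> measure_display)
    (T : forall N, measurableType (d N)) (P : forall N, probability (T N) R)
    (X : forall N, T N -> R) : Prop :=
  forall e : R, 0 < e ->
    (fun N => P N [set w | e < `|X N w|]) @ \oo --> (0 : \bar R).

Definition free_energy_expansion (R : realType) (alpha : nat -> R)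
    (beta_max : R) : Prop :=
  forall (d : nat -> measure_display) (T : forall N, measurableType (d N))
    (P : forall N, probability (T N) R)
    (J : forall N, 'I_N -> 'I_N -> {RV (P N) >-> R})
    (Ht : forall N, set_type (@sphere R N) -> {RV (P N) >-> R}),
  (forall N, (0 < N)%N -> spin_model alpha (J N) (Ht N)) ->
  forall beta : R, 0 < beta -> beta < beta_max ->
  cvg_in_probability0 P (fun N w =>
    free_energy alpha (J N) (Ht N) beta w
    - N%:R * (beta ^+ 2 / 2) * xi alpha 1
    - limn (fun n => \sum_(1 <= k < n)
        (2 * mu alpha beta k * cycle_count (J N) k w - mu alpha beta k ^+ 2)
        / (4 * k%:R))).

(* Main.v *)
(* Put [b = sqrt (2 alpha_2) beta < 1]. The diagonal of [J] contributes exactly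
   the term [k = 1] of the expansion. For [0 <= s <= b] let [Y_s] be the
   off-diagonal quadratic partition function with [b] replaced by [s], divided
   by its mean, and let [Gamma_s] be the sum of the terms [2 <= k < n] of the
   expansion with [mu_k] replaced by [s ^ k]. Then
   [(Y exp (- Gamma))' = (Y' - Y Gamma') exp (- Gamma)] and [Y_0 = 1], so that
   [Y_b exp (- Gamma_b)] is close to [1] as soon as [Gamma] is tight, which
   follows from [E C_k ^ 2 <= 2 k], and [E (Y'_s - Y_s Gamma'_s) ^ 2] is small
   uniformly in [s] for large [n] and then large [N].

   After completing the square this second moment is an average, over pairs of
   spin configurations with overlap [R], of the mean of a product of two
   polynomials of the disorder under a Gaussian shift of size [1 / sqrt N].
   Hermite polynomials and a count of the vertices shared by two cycles that
   share edges show that this mean is, up to [O (1 / sqrt N)], a quadratic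
   polynomial in [N R ^ 2]. Its average is computed by integration by parts for
   sums of signs, and tends to [0] with [n].

   Terms of degree [p >= 3]: given independence of the two processes, the
   square of the difference made by the second one has mean
   [E_R (exp (b ^ 2 (N R ^ 2 - 1) / 2) (exp (N beta ^ 2 xi~ R) - 1))], and
   [|xi~ R| <= |R| ^ 3 xi~ 1], so this is [O (1 / sqrt N)] provided that
   [2 beta ^ 2 xi 1 < 1]; hence [beta_xi = 1 / sqrt (2 xi 1)]. If [xi~ = 0] no
   such condition is needed. *)
Require Import Defs.
From HB Require Import structures.
From mathcomp Require Import all_boot all_order all_algebra finmap.
From mathcomp Require Import all_classical all_reals all_analysis.
From mathcomp Require Import measurable_realfun.
From mathcomp Require Import ring lra zify.
Set Implicit Arguments.
Unset Strict Implicit.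
Unset Printing Implicit Defensive.
Import Order.TTheory GRing.Theory Num.Theory.
Import numFieldNormedType.Exports.
Import HBNNSimple.
Local Open Scope classical_set_scope.
Local Open Scope ring_scope.

(** * Means and independence *)

(** Averaging [Y exp (- Gamma)] directly is hopeless: a product of three or more independent normal
    variables has no exponential moments, and neither do the longer cycle counts. The differential
    equation trades the exponential for [Y' - Y Gamma'], which is linear in the counts, so second
    moments suffice; the factor [exp (- Gamma)] is used only after multiplication by a further
    exponential that keeps it bounded.

    Why the limiting second moment vanishes: under the weight [exp (s ^ 2 N R ^ 2 / 2)] the variable
    [sqrt N R] behaves like a centered normal one of variance [v = 1 / (1 - s ^ 2)]. As [n] grows,
    [s + odd_sum] tends to [s v] and [1 + diag_sum] to [v ^ 2]; the mean of the quadratic form is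
    then exactly a combination of the two geometric tails. Finiteness of [v] up to [s = b] is the
    condition [b < 1].

    The truncation [n] is fixed before [N] because the error constants grow with [n]. The discarded
    cycles are controlled by their second moments alone, uniformly in [N]. *)

Section weighted_integral.
Context d d' (T : measurableType d) (U : measurableType d') (R : realType).
Variables (mu : {measure set T -> \bar R}) (nu : {measure set U -> \bar R}).
Variables (X : T -> U) (W : T -> R).
Hypothesis mX : measurable_fun setT X.
Hypothesis mW : measurable_fun setT W.
Hypothesis W_ge0 : forall w, 0 <= W w.
Hypothesis nuE : forall A, measurable A ->
  (\int[mu]_w ((\1_A (X w) * W w)%:E) = nu A)%E.

(** From indicators to simple functions to monotone limits. The weight [W] is there for two uses: it
    can hold all the other factors of a product of independent variables, or it can be a density,
    with [X] the identity. *)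
Lemma ge0_integral_weighted (f : U -> R) :
  measurable_fun setT f -> (forall u, 0 <= f u) ->
  (\int[mu]_w (f (X w) * W w)%:E = \int[nu]_u (f u)%:E)%E.
Proof.
move=> mf f0.
have mf' : measurable_fun setT (fun x => (f x)%:E) by exact/measurable_EFinP.
pose f_ := nnsfun_approx measurableT mf'.
have cf x : (f_ n x)%:E @[n --> \oo] --> (f x)%:E.
  by apply: (cvg_nnsfun_approx measurableT mf') => // y _; rewrite lee_fin.
have mfX n : measurable_fun setT (fun w => f_ n (X w)).
  by apply: (measurableT_comp _ mX).
have -> : (\int[nu]_u (f u)%:E = lim (\int[nu]_u (f_ n u)%:E @[n --> \oo]))%E.
  rewrite -monotone_convergence//=.
  - by apply: eq_integral => ? _; apply/esym/cvg_lim => //=.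
  - by move=> n; exact/measurable_EFinP/measurable_funTS.
  - by move=> n ? _; rewrite lee_fin.
  - by move=> ? _ ? ? mn; rewrite lee_fin; exact/lefP/nd_nnsfun_approx.
have -> : (\int[mu]_w (f (X w) * W w)%:E =
    lim (\int[mu]_w (f_ n (X w) * W w)%:E @[n --> \oo]))%E.
  rewrite -monotone_convergence//=.
  - apply: eq_integral => w _; apply/esym/cvg_lim => //=.
    under eq_fun do rewrite EFinM.
    by rewrite EFinM; apply: cvgeZr.
  - by move=> n; apply/measurable_EFinP; exact: measurable_funM.
  - by move=> n w _; rewrite lee_fin mulr_ge0.
  - move=> w _ m n mn; rewrite lee_fin ler_wpM2r//.
    exact/lefP/nd_nnsfun_approx.
apply: congr_lim; apply/funext => n /=.
set g := f_ n.
set s : seq R := fset_set (range g).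
have gE x : (g x)%:E =
    (\sum_(i < size s) (s`_i * \1_(g @^-1` [set s`_i]) x)%:E)%E.
  by rewrite sumEFin fimfunE fsbig_finite//= (big_nth 0)/= big_mkord.
have s_ge0 (i : 'I_(size s)) : 0 <= s`_i.
  have : s`_i \in s by apply: mem_nth.
  by rewrite in_fset_set// inE => -[x _ <-].
have mg y : measurable (g @^-1` [set y]) by exact: measurable_sfunP.
have mind y : measurable_fun setT (fun w => \1_(g @^-1` [set y]) (X w) : R).
  apply: (measurableT_comp _ mX); exact: measurable_indic.
rewrite (eq_integral (fun w => \sum_(i < size s)
    (s`_i * (\1_(g @^-1` [set s`_i]) (X w) * W w))%:E)%E); last first.
  move=> w _; rewrite EFinM gE sumEFin -EFinM mulr_suml -sumEFin.
  by apply: eq_bigr => i _; rewrite mulrA.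
under [RHS]eq_integral do rewrite gE.
rewrite !ge0_integral_sum//; last 4 first.
- by move=> i; apply/measurable_EFinP; apply: measurable_funM.
- by move=> i u _; rewrite lee_fin mulr_ge0// indicE.
- move=> i; apply/measurable_EFinP.
  by apply: measurable_funM => //; apply: measurable_funM.
- by move=> i u _; rewrite lee_fin !mulr_ge0// indicE.
apply: eq_bigr => i _.
under eq_integral do rewrite EFinM.
rewrite ge0_integralZl//; last 3 first.
- by apply/measurable_EFinP; apply: measurable_funM.
- by move=> w _; rewrite lee_fin mulr_ge0// indicE.
- by rewrite lee_fin.
rewrite nuE//.
under [RHS]eq_integral do rewrite EFinM.
rewrite ge0_integralZl//; last 2 first.
- by apply/measurable_EFinP; exact: measurable_indic.
- by rewrite lee_fin.
by rewrite integral_indic// setIT.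
Qed.

End weighted_integral.

Section has_mean.
Context d (T : measurableType d) (R : realType) (P : probability T R).
Implicit Types (F G : T -> R) (u v : R).

(** Integrability is bundled with a real value, so that linearity can be used in [R] without side
    conditions on extended reals. *)
Definition has_mean F v : Prop :=
  P.-integrable setT (EFin \o F) /\ (\int[P]_w (F w)%:E = v%:E)%E.

Lemma has_mean_measurable F v : has_mean F v -> measurable_fun setT F.
Proof. by move=> [/measurable_int/measurable_EFinP]. Qed.

Lemma has_mean_ge0 F v : measurable_fun setT F -> (forall w, 0 <= F w) ->
  (\int[P]_w (F w)%:E = v%:E)%E -> has_mean F v.
Proof.
move=> mF F0 Fv; split => //; apply/integrableP; split.
  exact/measurable_EFinP.
under eq_integral do rewrite /= ger0_norm//.
by rewrite Fv ltry.
Qed.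

Lemma eq_has_mean F G v : F =1 G -> has_mean F v -> has_mean G v.
Proof. by move=> /funext ->. Qed.

Lemma has_mean_unique F u v : has_mean F u -> has_mean F v -> u = v.
Proof. by move=> [_ uE] [_]; rewrite uE => -[]. Qed.

Lemma has_mean_cst v : has_mean (fun=> v) v.
Proof.
split; first exact: finite_measure_integrable_cst.
by rewrite integral_cst//= probability_setT mule1.
Qed.

Lemma has_meanD F G u v : has_mean F u -> has_mean G v ->
  has_mean (fun w => F w + G w) (u + v).
Proof.
move=> [iF Fu] [iG Gv]; split; first exact: (integrableD measurableT iF iG).
by rewrite integralD_EFin// Fu Gv.
Qed.

Lemma has_meanZ c F u : has_mean F u -> has_mean (fun w => c * F w) (c * u).
Proof.
move=> [iF Fu]; split; first exact: (integrableZl _ c iF).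
by under eq_integral do rewrite EFinM; rewrite integralZl// Fu.
Qed.

Lemma has_meanB F G u v : has_mean F u -> has_mean G v ->
  has_mean (fun w => F w - G w) (u - v).
Proof.
move=> hF hG; rewrite -mulN1r; apply: eq_has_mean.
  move=> w; rewrite -(mulN1r (G w)); reflexivity.
by apply: has_meanD => //; apply: has_meanZ.
Qed.

Lemma has_mean_sum (I : Type) (r : seq I) (Q : pred I) (F : I -> T -> R)
    (v : I -> R) : (forall i, Q i -> has_mean (F i) (v i)) ->
  has_mean (fun w => \sum_(i <- r | Q i) F i w) (\sum_(i <- r | Q i) v i).
Proof.
move=> h; elim: r => [|i r ih].
  rewrite big_nil; apply: eq_has_mean (has_mean_cst 0) => w.
  by rewrite big_nil.
rewrite big_cons; case: ifPn => Qi; last first.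
  by apply: eq_has_mean ih => w; rewrite big_cons (negbTE Qi).
apply: eq_has_mean (has_meanD (h _ Qi) ih) => w.
by rewrite big_cons Qi.
Qed.

Lemma has_mean_le F G u v : (forall w, F w <= G w) ->
  has_mean F u -> has_mean G v -> u <= v.
Proof.
move=> FG [iF Fu] [iG Gv]; rewrite -lee_fin -Fu -Gv.
by apply: le_integral => // w _; rewrite lee_fin.
Qed.

Lemma has_mean_funrposneg F v : has_mean F v -> exists u u' : R,
  [/\ has_mean (F ^\+)%R u, has_mean (F ^\-)%R u' & v = u - u'].
Proof.
move=> [iF Fv].
have ip : P.-integrable setT (EFin \o (F ^\+)%R).
  by rewrite -funerpos; exact: integrable_funepos.
have im : P.-integrable setT (EFin \o (F ^\-)%R).
  by rewrite -funerneg; exact: integrable_funeneg.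
have fp := integrable_fin_num measurableT ip.
have fm := integrable_fin_num measurableT im.
exists (fine (\int[P]_w ((F ^\+)%R w)%:E)), (fine (\int[P]_w ((F ^\-)%R w)%:E)).
split.
- by split => //; rewrite fineK.
- by split => //; rewrite fineK.
- apply: EFin_inj; rewrite EFinB !fineK// -Fv integralE; congr (_ - _)%E.
  + by apply: eq_integral => w _; rewrite funerpos.
  + by apply: eq_integral => w _; rewrite funerneg.
Qed.

Lemma has_mean_markov F v (e : R) : has_mean F v -> (forall w, 0 <= F w) -> 0 < e ->
  (P [set w | (e < F w)%R] <= (v / e)%:E)%E.
Proof.
move=> hF F0 e0; have mF := has_mean_measurable hF.
have mE : measurable [set w | e < F w].
  have -> : [set w | e < F w] = F @^-1` `]e, +oo[.
    by apply/seteqP; split => w /=; rewrite in_itv/= andbT.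
  by rewrite -[X in measurable X]setTI; exact: mF.
rewrite EFinM lee_pdivlMr// -hF.2 muleC.
rewrite -integral_cst//.
rewrite [leLHS]integral_mkcond/=; apply: ge0_le_integral => //.
- by move=> w _; rewrite patchE; case: ifP => // _; rewrite lee_fin ltW.
- by apply/(measurable_restrict _ mE).
- exact/measurable_EFinP.
- move=> w _; rewrite patchE; case: ifP => [|_]; last by rewrite lee_fin.
  by rewrite inE /= lee_fin => /ltW.
Qed.

End has_mean.

Section product_formula.
Context d (T : measurableType d) (R : realType) (P : probability T R).
Variables (I : finType) (D : {set I}) (X : I -> {RV P >-> R}).
Hypothesis indepX : mutually_independent D X.

Let measurable_comp (f : R -> R) i :
  measurable_fun setT f -> measurable_fun setT (fun w => f (X i w)).
Proof. by move=> mf; apply: (measurableT_comp mf). Qed.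

Let measurable_prodX (f : I -> R -> R) (Q : pred I) :
  (forall i, measurable_fun setT (f i)) ->
  measurable_fun setT (fun w => \prod_(i in D | Q i) f i (X i w)).
Proof.
move=> mf; rewrite (_ : (fun w => _) =
  (fun w => \prod_(i <- index_enum I) if (i \in D) && Q i then f i (X i w) else 1)).
  apply: measurable_prod => i _; case: ((i \in D) && Q i) => //.
  exact: measurable_comp.
by apply/funext => w; rewrite big_mkcond.
Qed.

Let prod_indic (B : I -> set R) w :
  \prod_(i in D) \1_(B i) (X i w) = \1_(\bigcap_(i in [set` D]) X i @^-1` B i) w :> R.
Proof.
rewrite indicE; case: (boolP (w \in _)); rewrite ?inE ?notin_setE => h.
  by rewrite big1// => i iD; rewrite indicE mem_set//; exact: h.
have [i iD nB] : exists2 i, i \in D & ~ B i (X i w).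
  apply: contrapT => nex; apply: h => i /= iD.
  by apply: contrapT => nB; apply: nex; exists i.
by rewrite (bigD1 i)//= indicE memNset// mul0r.
Qed.

(** Induction on the set [s] of coordinates that already carry a general nonnegative function; all
    others still carry indicators. The empty case is the definition of independence. *)
Let ge0_product (s : seq I) (f : I -> R -> R) (m : I -> R) :
  uniq s -> (forall i, measurable_fun setT (f i)) ->
  (forall i x, 0 <= f i x) -> (forall i, has_mean P (fun w => f i (X i w)) (m i)) ->
  forall B : I -> set R, (forall i, measurable (B i)) ->
  has_mean P (fun w => \prod_(i in D) (if i \in s then f i else \1_(B i)) (X i w))
    (\prod_(i in D) if i \in s then m i else fine (P (X i @^-1` B i))).
Proof.
move=> + mf f0 hf; elim: s => [_ B mB|i0 s ih /=/andP[i0s us] B mB].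
  have mP : measurable (\bigcap_(i in [set` D]) X i @^-1` B i).
    apply: fin_bigcap_measurable => // i _.
    by rewrite -[X in measurable X]setTI; exact: measurable_funP.
  apply: (@eq_has_mean _ _ _ _ \1_(\bigcap_(i in [set` D]) X i @^-1` B i)).
    by move=> w; rewrite -prod_indic.
  apply: has_mean_ge0 => //.
  rewrite integral_indic// setIT; apply: (etrans (indepX (subxx D) mB)).
  rewrite -prodEFin; apply: eq_bigr => i _.
  rewrite fineK// fin_num_measure//.
  by rewrite -[X in measurable X]setTI; exact: measurable_funP.
have [i0D|i0D] := boolP (i0 \in D); last first.
  have E i : i \in D -> (i \in i0 :: s) = (i \in s).
    by move=> iD; rewrite inE; case: eqP => // e; rewrite -e iD in i0D.
  rewrite (eq_bigr (fun i => if i \in s then m i else fine (P (X i @^-1` B i)))).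
    apply: eq_has_mean (ih us B mB) => w.
    by apply: eq_bigr => i iD; rewrite E.
  by move=> i iD; rewrite E.
pose W w := \prod_(i in D | i != i0) (if i \in s then f i else \1_(B i)) (X i w).
pose c := \prod_(i in D | i != i0) if i \in s then m i else fine (P (X i @^-1` B i)).
have mfB i : measurable_fun setT (if i \in s then f i else \1_(B i)).
  by case: ifP => // _; exact: measurable_indic.
have fB0 i x : 0 <= (if i \in s then f i else \1_(B i)) x.
  by case: ifP => // _; rewrite indicE.
have W0 w : 0 <= W w by apply: prodr_ge0 => i _; exact: fB0.
have mW : measurable_fun setT W.
  exact: (measurable_prodX (fun i => i != i0) mfB).
have c0 : 0 <= c.
  apply: prodr_ge0 => i _; case: ifP => _; last exact: fine_ge0.
  by apply: (has_mean_le _ (has_mean_cst P 0) (hf i)).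
pose cn : {nonneg R} := NngNum c0.
(* As a function of the event put at [i0], the mean with all other factors fixed is [c] times the
   law of [X i0]. This is the induction hypothesis with the indicator of [A] at [i0]. *)
have nuE A : measurable A ->
    (\int[P]_w ((\1_A (X i0 w) * W w)%:E) = mscale cn (distribution P (X i0)) A)%E.
  move=> mA; pose B' i := if i == i0 then A else B i.
  have mB' i : measurable (B' i) by rewrite /B'; case: ifP.
  have [_] := ih us B' mB'.
  under eq_integral do rewrite (bigD1 i0)//= (negbTE i0s) /B' eqxx.
  rewrite (bigD1 i0)//= (negbTE i0s) {1}/B' eqxx => h.
  under eq_integral.
    move=> w _; rewrite /W (eq_bigr (fun i =>
       (if i \in s then f i else \1_(if i == i0 then A else B i)) (X i w))).
    over.
    by move=> i /andP[_ /negbTE ->].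
  rewrite h /mscale/= /distribution /pushforward /c muleC EFinM fineK; last first.
    rewrite fin_num_measure//.
    by rewrite -[X in measurable X]setTI; exact: measurable_funP.
  congr (_ * (_)%:E)%E; apply: eq_bigr => i /andP[_ /negbTE ii0].
  by rewrite /B' ii0.
rewrite (bigD1 i0)//= inE eqxx.
have cE : \prod_(i in D | i != i0)
    (if i \in i0 :: s then m i else fine (P (X i @^-1` B i))) = c.
  by apply: eq_bigr => i /andP[_ /negbTE ii0]; rewrite inE ii0.
rewrite cE.
apply: (@eq_has_mean _ _ _ _ (fun w => f i0 (X i0 w) * W w)).
  move=> w; rewrite [RHS](bigD1 i0)//= inE eqxx; congr (_ * _).
  by apply: eq_bigr => i /andP[_ /negbTE ii0]; rewrite inE ii0.
apply: has_mean_ge0.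
- by apply: measurable_funM => //; exact: measurable_comp.
- by move=> w; rewrite mulr_ge0.
have mX0 : measurable_fun setT (X i0) by [].
rewrite (ge0_integral_weighted mX0 mW W0 nuE (mf i0) (f0 i0)).
have mfE : measurable_fun setT (fun x : R => (f i0 x)%:E).
  exact/measurable_EFinP.
rewrite ge0_integral_mscale//=; last by move=> x _; rewrite lee_fin.
rewrite ge0_integral_distribution//=; last by move=> x; rewrite lee_fin.
by rewrite [X in (_ * X)%E](hf i0).2 mulrC.
Qed.

Lemma has_mean_prod (f : I -> R -> R) (m : I -> R) :
  (forall i, i \in D -> measurable_fun setT (f i)) ->
  (forall i, i \in D -> has_mean P (fun w => f i (X i w)) (m i)) ->
  has_mean P (fun w => \prod_(i in D) f i (X i w)) (\prod_(i in D) m i).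
Proof.
move=> mfD hfD.
(* Outside [D] the functions are replaced by the constant [1]. *)
wlog : f m mfD hfD / (forall i, measurable_fun setT (f i)) /\
    (forall i, has_mean P (fun w => f i (X i w)) (m i)).
  move=> H.
  pose f' i := if i \in D then f i else cst 1.
  pose m' i := if i \in D then m i else 1.
  have mf' i : measurable_fun setT (f' i).
    by rewrite /f'; case: ifP => // iD; exact: mfD.
  have hf' i : has_mean P (fun w => f' i (X i w)) (m' i).
    rewrite /f' /m'; case: ifP => [iD|_]; first exact: hfD.
    exact: has_mean_cst.
  have -> : \prod_(i in D) m i = \prod_(i in D) m' i.
    by apply: eq_bigr => i iD; rewrite /m' iD.
  apply: eq_has_mean (H f' m' (fun i _ => mf' i) (fun i _ => hf' i) (conj mf' hf')) => w.
  by apply: eq_bigr => i iD; rewrite /f' iD.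
move=> {mfD hfD} [mf hf].
(* Second induction: [s] lists the coordinates whose function may change sign, and one coordinate at
   a time is split into positive and negative parts. *)
suff H (s : seq I) : forall (f : I -> R -> R) (m : I -> R),
  (forall i, measurable_fun setT (f i)) ->
  (forall i, has_mean P (fun w => f i (X i w)) (m i)) ->
  (forall i, i \notin s -> forall x, 0 <= f i x) ->
  has_mean P (fun w => \prod_(i in D) f i (X i w)) (\prod_(i in D) m i).
  by apply: (H (enum I)) => // i; rewrite mem_enum.
elim: s => {f m mf hf} [f m mf hf f0|i0 s ih f m mf hf f0].
  have := @ge0_product (enum I) f m (enum_uniq I) mf (fun i => f0 i isT) hf
    (fun=> setT) (fun=> measurableT).
  under eq_bigr do rewrite mem_enum.
  by apply: eq_has_mean => w; apply: eq_bigr => i _; rewrite mem_enum.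
have [i0D|i0D] := boolP (i0 \in D); last first.
  pose f' i := if i == i0 then cst 1 else f i.
  pose m' i := if i == i0 then 1 else m i.
  have iD0 i : i \in D -> (i == i0) = false.
    by move=> iD; apply/negbTE; apply: contraNneq i0D => <-.
  have -> : \prod_(i in D) m i = \prod_(i in D) m' i.
    by apply: eq_bigr => i iD; rewrite /m' iD0.
  apply: (@eq_has_mean _ _ _ _ (fun w => \prod_(i in D) f' i (X i w))).
    by move=> w; apply: eq_bigr => i iD; rewrite /f' iD0.
  apply: ih.
  - by move=> i; rewrite /f'; case: ifP.
  - move=> i; rewrite /f' /m'; case: ifP => // _; exact: has_mean_cst.
  - move=> i si x; rewrite /f'; case: eqP => [//|/eqP ii0].
    by apply: f0; rewrite inE negb_or ii0.
have [u [u' [hp hm muu']]] := has_mean_funrposneg (hf i0).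
pose upd (g : R -> R) i := if i == i0 then g else f i.
pose updm (v : R) i := if i == i0 then v else m i.
have E (g : R -> R) v (mg : measurable_fun setT g) (g0 : forall x, 0 <= g x)
   (hg : has_mean P (fun w => g (X i0 w)) v) :
   has_mean P (fun w => g (X i0 w) * \prod_(i in D | i != i0) f i (X i w))
     (v * \prod_(i in D | i != i0) m i).
  have -> : v * \prod_(i in D | i != i0) m i = \prod_(i in D) updm v i.
    rewrite [RHS](bigD1 i0)//= {1}/updm eqxx; congr (_ * _).
    by apply: eq_bigr => i /andP[_ /negbTE ii0]; rewrite /updm ii0.
  apply: (@eq_has_mean _ _ _ _ (fun w => \prod_(i in D) upd g i (X i w))).
    move=> w; rewrite [LHS](bigD1 i0)//= {1}/upd eqxx; congr (_ * _).
    by apply: eq_bigr => i /andP[_ /negbTE ii0]; rewrite /upd ii0.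
  apply: ih.
  - by move=> i; rewrite /upd; case: ifP.
  - by move=> i; rewrite /upd /updm; case: eqP => // ->.
  - move=> i si x; rewrite /upd; case: eqP => [//|/eqP ii0].
    by apply: f0; rewrite inE negb_or ii0.
have mp : measurable_fun setT ((f i0)^\+)%R by exact: measurable_funrpos.
have mn : measurable_fun setT ((f i0)^\-)%R by exact: measurable_funrneg.
have := has_meanB (E _ _ mp (funrpos_ge0 _) hp) (E _ _ mn (funrneg_ge0 _) hm).
rewrite -mulrBl -muu' [in \prod_(i in D) m i](bigD1 i0)//=.
apply: eq_has_mean => w; rewrite -mulrBl [RHS](bigD1 i0)//=; congr (_ * _).
by rewrite -[in RHS](funrposBneg (f i0)).
Qed.

End product_formula.

Section gaussian_moments.
Context d (T : measurableType d) (R : realType) (P : probability T R).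

Lemma integral_distribution_normal (X : {RV P >-> R}) (m s : R) (f : R -> R) :
  (forall A : set R, measurable A -> distribution P X A = normal_prob m s A) ->
  measurable_fun setT f -> (forall x, 0 <= f x) ->
  (\int[distribution P X]_x (f x)%:E =
   \int[lebesgue_measure]_x (f x * normal_pdf m s x)%:E)%E.
Proof.
move=> lawX mf f0; apply/esym.
(* Here the map is the identity and the weight is the normal density. *)
apply: (@ge0_integral_weighted _ _ _ _ _ (@lebesgue_measure R)
   (distribution P X) id (normal_pdf m s)) => //.
- exact: measurable_normal_pdf.
- exact: normal_pdf_ge0.
move=> A mA; apply: etrans (esym (lawX A mA)).
rewrite /normal_prob [RHS]integral_mkcond.
apply: eq_integral => x _.
rewrite patchE indicE; case: ifPn => _; last by rewrite mul0r.
by rewrite mul1r.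
Qed.

Lemma gaussian_mgf (X : {RV P >-> R}) (v c : R) : 0 <= v ->
  has_gaussian_law P X 0 v ->
  has_mean P (fun w => expR (c * X w)) (expR (c ^+ 2 * v / 2)).
Proof.
move=> v0 lawX.
have mcX : measurable_fun setT (fun x : R => expR (c * x)).
  by apply: measurableT_comp => //; exact: measurable_funM.
apply: has_mean_ge0.
- exact: (measurableT_comp mcX).
- by move=> w; exact: expR_ge0.
transitivity (\int[distribution P X]_x (expR (c * x))%:E)%E.
  rewrite ge0_integral_distribution//; exact/measurable_EFinP.
have [v_eq0|v_neq0] := eqVneq v 0.
  rewrite (@eq_measure_integral _ _ _ _ (\d_(0 : R))); last first.
    by move=> A mA _; have := lawX A mA; rewrite /gaussian_law v_eq0 eqxx.
  rewrite integral_dirac//=; last exact/measurable_EFinP.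
  by rewrite diracT mul1e v_eq0 mulr0 mulr0 mul0r.
have s0 : Num.sqrt v != 0 by rewrite sqrtr_eq0 -ltNge lt_neqAle eq_sym v_neq0.
rewrite (@integral_distribution_normal X 0 (Num.sqrt v))//; last first.
  by move=> A mA; have := lawX A mA; rewrite /gaussian_law (negbTE v_neq0).
have sv : 0 < v by rewrite lt_neqAle eq_sym v_neq0.
(* Completing the square: the exponential moves the mean of the density from [0] to [c * v]. *)
have E x : expR (c * x) * normal_pdf 0 (Num.sqrt v) x =
    expR (c ^+ 2 * v / 2) * normal_pdf (c * v) (Num.sqrt v) x.
  rewrite /normal_pdf (negbTE s0) mulrCA [RHS]mulrCA; congr (_ * _).
  rewrite /normal_fun -!expRD sqr_sqrtr//; congr expR.
  by field.
under eq_integral do rewrite E.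
under eq_integral do rewrite EFinM.
rewrite ge0_integralZl//=; last 2 first.
- by apply: measurableT_comp => //; exact: measurable_normal_pdf.
- by move=> x _; rewrite lee_fin normal_pdf_ge0.
by rewrite integral_normal_pdf mule1.
Qed.

End gaussian_moments.

Lemma exprn_le_expR (R : realType) (x : R) n :
  0 <= x -> x ^+ n <= n`!%:R * expR x.
Proof.
move=> x0; rewrite -ler_pdivrMl ?ltr0n ?fact_gt0// mulrC.
have cv := is_cvg_series_exp_coeff x.
have nd : nondecreasing_seq (series (exp_coeff x)).
  apply/nondecreasing_seqP => k; rewrite seriesSr lerDl.
  by rewrite /exp_coeff /= divr_ge0// exprn_ge0.
apply: (le_trans _ (nondecreasing_cvgn_le nd cv n.+1)).
rewrite seriesSr lerDr /series/=.
by apply: sumr_ge0 => i _; rewrite divr_ge0// exprn_ge0.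
Qed.

(** * Moments of shifted normal variables *)

Section tilted_moments.
Context d (T : measurableType d) (R : realType) (P : probability T R).

(** All moments needed below are read off the moment generating function; the law serves only to
    establish it. *)
Definition normal_mgf (X : T -> R) : Prop :=
  measurable_fun setT X /\
  forall a, has_mean P (fun w => expR (a * X w)) (expR (a ^+ 2 / 2)).

(* [E (X ^+ r * expR (a * X)) = (moment_poly r).[a] * expR (a ^+ 2 / 2)] for a
   standard normal [X]: one differentiates [r] times in [a]. *)
Fixpoint moment_poly r : {poly R} :=
  if r is r'.+1 then (moment_poly r')^`() + 'X * moment_poly r' else 1.

Let expR_abs_le (c x : R) : 0 <= c -> expR (c * `|x|) <= expR (c * x) + expR ((- c) * x).
Proof.
move=> c0; have [x0|x0] := ger0P x.
  by rewrite lerDl expR_ge0.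
by rewrite mulrN mulNr lerDr expR_ge0.
Qed.

Lemma has_mean_tilted_moment X r a : normal_mgf X ->
  has_mean P (fun w => X w ^+ r * expR (a * X w))
    ((moment_poly r).[a] * expR (a ^+ 2 / 2)).
Proof.
move=> [mX hX]; elim: r a => [|r ih] a.
  rewrite hornerE mul1r; apply: eq_has_mean (hX a) => w.
  by rewrite expr0 mul1r.
pose f (x : R) w := X w ^+ r * expR (x * X w).
pose G (a : R) w := (r.+1)`!%:R *
  (expR ((`|a| + 2) * X w) + expR ((- (`|a| + 2)) * X w)).
have iG x : P.-integrable setT (EFin \o G x).
  apply: (_ : has_mean P (G x) _).1; apply: has_meanZ.
  by apply: has_meanD; exact: hX.
have dexp x w : is_derive x (1:R) (fun y => expR (y * X w)) (X w * expR (x * X w)).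
  have h : is_derive x (1:R) (fun y => y * X w) (X w).
    apply: is_derive_eq; rewrite scaler0 add0r; exact: mulr1.
  have := @is_derive1_comp _ expR (fun y : R => y * X w) x _ _ (is_derive_expR (x * X w)) h.
  by rewrite mulrC.
have derf x w : is_derive x (1:R) (f ^~ w) (X w ^+ r.+1 * expR (x * X w)).
  have := is_deriveZ (X w ^+ r) (dexp x w).
  by rewrite /GRing.scale/= exprSr mulrA.
have f1E x w : partial1of2 f x w = X w ^+ r.+1 * expR (x * X w).
  by rewrite partial1of2E; have /@derive_val := derf x w.
have bnd b x w : `]b - 1, b + 1[%classic x ->
    `|X w ^+ r.+1 * expR (x * X w)| <= G b w.
  move=> /=; rewrite in_itv/= => /andP[ax xa].
  rewrite normrM normrX (ger0_norm (expR_ge0 _)).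
  apply: (@le_trans _ _ ((r.+1)`!%:R * expR `|X w| * expR ((`|b| + 1) * `|X w|))).
    apply: ler_pM; rewrite ?exprn_ge0 ?expR_ge0//; first exact: exprn_le_expR.
    rewrite ler_expR; apply: (le_trans (ler_norm _)); rewrite normrM.
    rewrite ler_wpM2r//.
    have := ler_norm b; have := ler_norm (- b); rewrite normrN ler_norml; lra.
  rewrite -mulrA -expRD ler_wpM2l//.
  have -> : `|X w| + (`|b| + 1) * `|X w| = (`|b| + 2) * `|X w| by ring.
  by apply: expR_abs_le; rewrite addr_ge0.
have mr x : measurable_fun setT (fun w => X w ^+ r.+1 * expR (x * X w)).
  apply: measurable_funM; first exact: measurable_funX.
  by apply: measurableT_comp => //; apply: measurable_funM.
have itvx (x : R) : `]x - 1, x + 1[%classic x by rewrite /= in_itv/=; lra.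
have ir x : P.-integrable setT (EFin \o (fun w => X w ^+ r.+1 * expR (x * X w))).
  apply: le_integrable (iG x) => //; first exact/measurable_EFinP.
  move=> w _ /=; rewrite lee_fin; apply: le_trans (bnd x x w (itvx x)) _.
  exact: ler_norm.
have G0 b w : 0 <= G b w by rewrite mulr_ge0// addr_ge0// expR_ge0.
have hder : forall x w, `]a - 1, a + 1[%classic x -> [set: T] w ->
  derivable (f ^~ w) x 1 by move=> x w _ _; have [] := derf x w.
have hb : forall x w, `]a - 1, a + 1[%classic x -> [set: T] w ->
  `|partial1of2 f x w| <= G a w by move=> x w xI _; rewrite f1E; exact: bnd.
have := differentiation_under_integral measurableT (itvx a)
  (fun x _ => (ih x).1) hder (G0 a) (iG a) hb.
rewrite (_ : (fun x => _) = (fun x => (moment_poly r).[x] * expR (x ^+ 2 / 2))).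
  move=> E; split; first exact: ir.
  have fin := integrable_fin_num measurableT (ir a).
  rewrite -[LHS]fineK//; congr EFin.
  transitivity (\int[P]_y partial1of2 f a y)%R.
    by apply: eq_Rintegral => w _; rewrite f1E.
  rewrite -E derive1E.
  have hp := is_derive_poly (moment_poly r) a.
  have he : is_derive a (1:R) (fun x => expR (x ^+ 2 / 2)) (a * expR (a ^+ 2 / 2)).
    have h2 : is_derive a (1:R) (fun x : R => x ^+ 2 / 2) a.
      apply: is_derive_eq; rewrite /GRing.scale/=; by field.
    have := @is_derive1_comp _ expR (fun x : R => x ^+ 2 / 2) a _ _ (is_derive_expR (a ^+ 2 / 2)) h2.
    by rewrite mulrC.
  have /@derive_val -> := is_deriveM hp he.
  by rewrite /= !hornerE /GRing.scale/=; ring.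
apply/funext => x; rewrite /Rintegral.
by rewrite (ih x).2.
Qed.

End tilted_moments.

Lemma moment_poly_values (R : realType) (a : R) :
 [/\ (moment_poly R 0).[a] = 1,
     (moment_poly R 1).[a] = a,
     (moment_poly R 2).[a] = a ^+ 2 + 1,
     (moment_poly R 3).[a] = a ^+ 3 + 3 * a &
     (moment_poly R 4).[a] = a ^+ 4 + 6 * a ^+ 2 + 3 ].
Proof.
have E1 : moment_poly R 1 = 'X by rewrite /= -[1]/(1%:P) derivC add0r mulr1.
have E2 : moment_poly R 2 = 1%:P + 'X * 'X.
  by rewrite -[LHS]/((moment_poly R 1)^`() + 'X * moment_poly R 1) E1 derivX.
have E3 : moment_poly R 3 = 'X + 'X + 'X * (1%:P + 'X * 'X).
  rewrite -[LHS]/((moment_poly R 2)^`() + 'X * moment_poly R 2) E2.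
  by rewrite derivD derivC derivM derivX add0r mul1r mulr1.
have E4 : moment_poly R 4 = 1%:P + 1%:P + (1%:P + 'X * 'X + 'X * ('X + 'X)) +
    'X * ('X + 'X + 'X * (1%:P + 'X * 'X)).
  rewrite -[LHS]/((moment_poly R 3)^`() + 'X * moment_poly R 3) E3.
  by rewrite !(derivD, derivC, derivM, derivX) add0r !mul1r !mulr1.
rewrite E1 E2 E3 E4.
by split; rewrite !hornerE/=; ring.
Qed.

Section tilted_mean.
Variable R : realType.
Implicit Types (a v : R) (p q : R -> R).

(** Mean of [p] under the normal law of mean [a] and variance one, written through its density with
    respect to the standard one. Quantifying over all probability spaces makes it a statement about
    [a] and [p] alone. *)
Definition tilted_mean a p v : Prop := measurable_fun setT p /\
  forall d (T : measurableType d) (P : probability T R) (X : T -> R),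
    normal_mgf P X ->
    has_mean P (fun w => p (X w) * expR (a * X w - a ^+ 2 / 2)) v.

Lemma eq_tilted_mean a p q v : p =1 q -> tilted_mean a p v -> tilted_mean a q v.
Proof. by move=> /funext ->. Qed.

Lemma tilted_mean_pow a r :
  tilted_mean a (fun x => x ^+ r) (moment_poly R r).[a].
Proof.
split; first exact: exprn_measurable.
move=> d T P X hX.
have := has_meanZ (expR (- (a ^+ 2 / 2))) (has_mean_tilted_moment r a hX).
rewrite mulrCA -expRD addNr expR0 mulr1.
by apply: eq_has_mean => w; rewrite expRD; ring.
Qed.

Lemma tilted_meanD a p q u v : tilted_mean a p u -> tilted_mean a q v ->
  tilted_mean a (fun x => p x + q x) (u + v).
Proof.
move=> [mp hp] [mq hq]; split; first exact: measurable_funD.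
move=> d T P X hX; apply: eq_has_mean (has_meanD (hp _ _ _ _ hX) (hq _ _ _ _ hX)) => w.
by rewrite mulrDl.
Qed.

Lemma tilted_meanZ a c p u : tilted_mean a p u ->
  tilted_mean a (fun x => c * p x) (c * u).
Proof.
move=> [mp hp]; split; first exact: measurable_funM.
move=> d T P X hX; apply: eq_has_mean (has_meanZ c (hp _ _ _ _ hX)) => w.
by rewrite mulrA.
Qed.

(** Degree four is enough: only products of two polynomials of degree at most two are integrated. *)
Lemma tilted_mean_quartic a (c0 c1 c2 c3 c4 : R) :
  tilted_mean a (fun x => c0 + c1 * x + c2 * x ^+ 2 + c3 * x ^+ 3 + c4 * x ^+ 4)
    (c0 + c1 * a + c2 * (a ^+ 2 + 1) + c3 * (a ^+ 3 + 3 * a) +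
     c4 * (a ^+ 4 + 6 * a ^+ 2 + 3)).
Proof.
have M r := tilted_mean_pow a r.
have := tilted_meanD (tilted_meanD (tilted_meanD (tilted_meanD
  (tilted_meanZ c0 (M 0)) (tilted_meanZ c1 (M 1)))
  (tilted_meanZ c2 (M 2))) (tilted_meanZ c3 (M 3))) (tilted_meanZ c4 (M 4)).
have [-> -> -> -> ->] := moment_poly_values a.
rewrite [c0 * 1]mulr1; apply: eq_tilted_mean => x.
by [].
Qed.

Let quarticP a c0 c1 c2 c3 c4 q v :
  (forall x, c0 + c1 * x + c2 * x ^+ 2 + c3 * x ^+ 3 + c4 * x ^+ 4 = q x) ->
  c0 + c1 * a + c2 * (a ^+ 2 + 1) + c3 * (a ^+ 3 + 3 * a) +
     c4 * (a ^+ 4 + 6 * a ^+ 2 + 3) = v -> tilted_mean a q v.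
Proof. by move=> h <-; apply: eq_tilted_mean (tilted_mean_quartic _ _ _ _ _ _). Qed.

(** Only degrees up to two occur, since a cycle runs along an edge at most twice; a larger [n] gets
    the polynomial of degree two. *)
Definition hermite n (x : R) : R :=
  match n with 0%N => 1 | 1%N => x | _ => x ^+ 2 - 1 end.

(** Mean of a product of two Hermite polynomials after a shift by [a]. At [a = 0] orthogonality
    leaves [n!] on the diagonal and [0] elsewhere. *)
Definition hermite_cov a n n' : R :=
  match n, n' with
  | 0%N, 0%N => 1
  | 0%N, 1%N | 1%N, 0%N => a
  | 0%N, _ | _, 0%N => a ^+ 2
  | 1%N, 1%N => 1 + a ^+ 2
  | 1%N, _ | _, 1%N => a ^+ 3 + 2 * a
  | _, _ => a ^+ 4 + 4 * a ^+ 2 + 2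
  end.
Lemma hermite_covC a m n : hermite_cov a m n = hermite_cov a n m.
Proof. by case: m n => [|[|m]] [|[|n]]. Qed.

Lemma tilted_mean_hermite a m n :
  tilted_mean a (fun x => hermite m x * hermite n x) (hermite_cov a m n).
Proof.
wlog mn : m n / (m <= n)%N.
  move=> H; have [|/ltnW nm] := leqP m n; first exact: H.
  rewrite hermite_covC; apply: eq_tilted_mean (H _ _ nm) => x.
  by rewrite mulrC.
case: m n mn => [|[|m]] [|[|n]]// _ /=.
- by apply: (quarticP (c0:=1) (c1:=0) (c2:=0) (c3:=0) (c4:=0)) => [x|]; rewrite ?mulr1; ring.
- by apply: (quarticP (c0:=0) (c1:=1) (c2:=0) (c3:=0) (c4:=0)) => [x|]; rewrite ?mulr1; ring.
- by apply: (quarticP (c0:=(-1)) (c1:=0) (c2:=1) (c3:=0) (c4:=0)) => [x|]; rewrite ?mulr1; ring.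
- by apply: (quarticP (c0:=0) (c1:=0) (c2:=1) (c3:=0) (c4:=0)) => [x|]; rewrite ?mulr1; ring.
- by apply: (quarticP (c0:=0) (c1:=(-1)) (c2:=0) (c3:=1) (c4:=0)) => [x|]; rewrite ?mulr1; ring.
- by apply: (quarticP (c0:=1) (c1:=0) (c2:=(-2)) (c3:=0) (c4:=1)) => [x|]; rewrite ?mulr1; ring.
Qed.

Lemma tilted_mean_centered a : tilted_mean a (fun x => x - a) 0.
Proof.
by apply: (quarticP (c0:=(- a)) (c1:=1) (c2:=0) (c3:=0) (c4:=0)) => [x|]; rewrite ?mulr1; ring.
Qed.

Lemma tilted_mean_centered2 a : tilted_mean a (fun x => (x - a) * (x - a)) 1.
Proof.
by apply: (quarticP (c0:=(a ^+ 2)) (c1:=(- 2 * a)) (c2:=1) (c3:=0) (c4:=0)) => [x|]; rewrite ?mulr1; ring.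
Qed.

(** Gaussian integration by parts: the centered variable acts as a derivative, which sends the
    Hermite polynomial of degree [n] to [n] times the previous one, and the latter has mean
    [a ^ (n - 1)]. *)
Lemma tilted_mean_centered_hermite a n : (n <= 2)%N ->
  tilted_mean a (fun x => (x - a) * hermite n x) (n%:R * a ^+ n.-1).
Proof.
case: n => [|[|[|n]]]//= _.
- by apply: (quarticP (c0:=(- a)) (c1:=1) (c2:=0) (c3:=0) (c4:=0)) => [x|]; rewrite ?mulr1; ring.
- by apply: (quarticP (c0:=0) (c1:=(- a)) (c2:=1) (c3:=0) (c4:=0)) => [x|]; rewrite ?mulr1; ring.
- by apply: (quarticP (c0:=a) (c1:=(-1)) (c2:=(- a)) (c3:=1) (c4:=0)) => [x|]; rewrite ?mulr1; ring.
Qed.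

Lemma hermite_cov0 a n : (n <= 2)%N -> hermite_cov a n 0 = a ^+ n.
Proof. by case: n => [|[|[|n]]]. Qed.

(** Matching the common degree leaves [|m - n|] unmatched factors, each worth one power of the
    shift. No entry of [hermite_cov] has coefficients of sum above [7]. *)
Lemma hermite_cov_bound a b m n : (m <= 2)%N -> (n <= 2)%N -> `|a| <= b -> b <= 1 ->
  `|hermite_cov a m n| <= 7 ^+ minn m n * b ^+ (m + n - (minn m n).*2).
Proof.
move=> + + ab b1; have b0 : 0 <= b by apply: le_trans ab.
have a2 : a ^+ 2 <= b ^+ 2 by rewrite -real_normK ?num_real// lerXn2r ?nnegrE.
have a20 : 0 <= a ^+ 2 by exact: sqr_ge0.
have b21 : b ^+ 2 <= 1 by rewrite exprn_ile1.
have a40 : 0 <= a ^+ 4 by exact: exprn_even_ge0.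
have a42 : a ^+ 4 <= 1.
  rewrite -[4%N]/(2 * 2)%N exprM exprn_ile1//; exact: le_trans b21.
wlog mn : m n / (m <= n)%N.
  move=> H m2 n2; case/orP: (leq_total m n) => mn; first exact: H.
  by rewrite hermite_covC minnC addnC; apply: H.
case: m n mn => [|[|[|m]]] [|[|[|n]]]//= _ _ _; rewrite /minn/= ?expr0 ?mul1r ?expr1 ?mulr1.
- by rewrite normr1.
- by [].
- by rewrite ger0_norm.
- by rewrite ger0_norm; lra.
- have -> : a ^+ 3 + 2 * a = (a ^+ 2 + 2) * a by ring.
  rewrite normrM ler_pM// ger0_norm; lra.
- by rewrite ger0_norm; lra.
Qed.

End tilted_mean.

(** * Cycles and the edges they share *)

Section cycles.
Variable N : nat.
Implicit Types (u v : 'I_N) (e : 'I_N * 'I_N).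

Definition pairs : {set 'I_N * 'I_N} := [set e : 'I_N * 'I_N | (e.1 < e.2)%N]%SET.

Definition edge u v : 'I_N * 'I_N := if (u <= v)%N then (u, v) else (v, u).

Lemma edgeC u v : edge u v = edge v u.
Proof.
rewrite /edge; case: ltngtP => // uv.
by have -> : u = v by exact: val_inj.
Qed.

Lemma edge_inj u v u' v' : edge u v = edge u' v' ->
  (u = u' /\ v = v') \/ (u = v' /\ v = u').
Proof. by rewrite /edge; do 2 case: ifP => _; case=> -> ->; [left|right|right|left]. Qed.

Lemma edge_pairs u v : u != v -> edge u v \in pairs.
Proof.
rewrite /edge inE => uv; case: ifPn => /= [le|]; last by rewrite -ltnNge.
by rewrite ltn_neqAle le andbT.
Qed.

Definition cedge k (i : {ffun 'I_k -> 'I_N}) p := edge (i p) (i (ordS p)).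

(** For an injective [i] this is [0] or [1] when [2 < k]; when [k = 2] both steps run along the same
    edge and it is [0] or [2]. *)
Definition mult k (i : {ffun 'I_k -> 'I_N}) e := #|[pred p | cedge i p == e]|.

Lemma mult_gt0P k (i : {ffun 'I_k -> 'I_N}) e :
  reflect (exists p, cedge i p = e) (0 < mult i e)%N.
Proof.
rewrite /mult; apply: (iffP card_gt0P) => [[p]|[p <-]].
  by rewrite inE => /eqP; exists p.
by exists p; rewrite inE.
Qed.

Lemma mult_cedge_gt0 k (i : {ffun 'I_k -> 'I_N}) p : (0 < mult i (cedge i p))%N.
Proof. by apply/mult_gt0P; exists p. Qed.

Lemma ordS_neq k (p : 'I_k) : (1 < k)%N -> ordS p != p.
Proof.
move=> k1; apply/eqP => /(congr1 val) /= h.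
have pk := ltn_ord p.
have [pk1|pk1] := ltnP p.+1 k; first by rewrite modn_small// in h; lia.
have e : p.+1 = k by lia.
by move: h; rewrite e modnn; lia.
Qed.

Lemma ordSS_neq k (p : 'I_k) : (2 < k)%N -> ordS (ordS p) != p.
Proof.
move=> k1; apply/eqP => /(congr1 val) /= h.
have pk := ltn_ord p.
have [pk1|pk1] := ltnP p.+1 k.
  rewrite (modn_small pk1) in h.
  have [pk2|pk2] := ltnP p.+2 k; first by rewrite modn_small// in h; lia.
  have e : p.+2 = k by lia.
  by move: h; rewrite e modnn; lia.
have e : p.+1 = k by lia.
by move: h; rewrite e modnn modn_small; lia.
Qed.

Lemma ordSS_2 (p : 'I_2) : ordS (ordS p) = p.
Proof. by apply: val_inj; case: p => [[|[|]]]. Qed.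

Lemma val_iter_ordS k n (q : 'I_k) : nat_of_ord (iter n (@ordS k) q) = ((q + n) %% k)%N.
Proof.
elim: n => [|n ih] /=; first by rewrite addn0 modn_small.
by rewrite ih addnS -addn1 modnDml addn1.
Qed.

(** The number of steps matters only modulo [k]; the added [k] keeps the subtraction from
    truncating. *)
Lemma iter_ordS k (q p : 'I_k) : iter (p + k - q)%N (@ordS k) q = p.
Proof.
apply: val_inj; rewrite /= val_iter_ordS subnKC ?modnDr ?modn_small//.
by rewrite ltnW// ltn_addl.
Qed.

Lemma sum_mult_pred k (i : {ffun 'I_k -> 'I_N}) (Q : pred ('I_N * 'I_N)) :
  (\sum_(e | Q e) mult i e = \sum_p Q (cedge i p))%N.
Proof.
rewrite -[RHS]big_mkcond sum1_card [RHS](eq_card (B := [pred p | Q (cedge i p)]))//.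
rewrite -sum1_card (partition_big (cedge i) Q)//=.
apply: eq_bigr => e Qe; rewrite /mult -sum1_card; apply: eq_bigl => p.
by rewrite !inE; apply/esym; rewrite andb_idl// => /eqP ->.
Qed.

Section one_cycle.
Variables (k : nat) (i : {ffun 'I_k -> 'I_N}).
Hypotheses (k1 : (1 < k)%N) (inji : injective i).

Lemma cedge_pairs p : cedge i p \in pairs.
Proof. by apply: edge_pairs; rewrite (inj_eq inji) eq_sym ordS_neq. Qed.

Lemma mult_notin_pairs e : e \notin pairs -> mult i e = 0%N.
Proof.
move=> nS; apply/eqP; rewrite -leqn0 leqNgt; apply/mult_gt0P => -[p pe].
by rewrite -pe cedge_pairs in nS.
Qed.

Lemma sum_mult : (\sum_(e in pairs) mult i e = k)%N.
Proof.
rewrite sum_mult_pred (eq_bigr (fun=> 1%N)) => [|p _]; last by rewrite cedge_pairs.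
by rewrite sum1_card card_ord.
Qed.

Lemma cedge_eq p q : cedge i q = cedge i p ->
  q = p \/ (q = ordS p /\ ordS q = p).
Proof.
move=> /edge_inj[[/inji -> _]|[/inji -> /inji ?]]; first by left.
by right.
Qed.

Lemma mult_le2 e : (mult i e <= 2)%N.
Proof.
have [/mult_gt0P[p <-]|] := ltnP 0 (mult i e); last by rewrite leqn0 => /eqP ->.
have sub : [pred q | cedge i q == cedge i p] \subset [set p; ordS p]%SET.
  apply/fintype.subsetP => q; rewrite !inE => /eqP/cedge_eq[->|[-> _]]; rewrite eqxx ?orbT//.
apply: leq_trans (subset_leq_card sub) _.
by rewrite cards2; case: (_ != _).
Qed.

Lemma mult_le1 e : (2 < k)%N -> (mult i e <= 1)%N.
Proof.
move=> k2; have [/mult_gt0P[p <-]|] := ltnP 0 (mult i e); last by rewrite leqn0 => /eqP ->.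
have sub : [pred q | cedge i q == cedge i p] \subset [set p]%SET.
  apply/fintype.subsetP => q; rewrite !inE => /eqP/cedge_eq[->|[qp]]; rewrite ?eqxx//.
  by rewrite qp => /eqP; rewrite (negbTE (ordSS_neq _ _)).
by apply: leq_trans (subset_leq_card sub) _; rewrite cards1.
Qed.

Lemma mult_2 e : k = 2 -> (0 < mult i e)%N -> mult i e = 2.
Proof.
move=> k2 /mult_gt0P[p <-]; rewrite /mult -[RHS]k2 -[RHS]card_ord.
apply: eq_card => q; rewrite !inE; apply/eqP.
have [->//|qp] := eqVneq q p.
have -> : q = ordS p.
  apply: val_inj; case: p q qp => p pk [q qk] /=; rewrite -val_eqE/= => qp.
  by subst k; case: p pk qp => [|[|p]]//; case: q qk => [|[|q]].
rewrite /cedge edgeC; congr edge; congr (i _).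
apply: val_inj => /=; have := ordSS_2; move: p {qp}; rewrite k2 => p /(_ p).
by move/(congr1 val).
Qed.

Lemma prod_mult (R : comNzRingType) (F : 'I_N * 'I_N -> R) :
  \prod_(e in pairs) F e ^+ mult i e = \prod_p F (cedge i p).
Proof.
rewrite [RHS](partition_big (cedge i) (mem pairs)) => [|p _]; last exact: cedge_pairs.
apply: eq_bigr => e _; rewrite (eq_bigr (fun=> F e)) => [|p /eqP -> //].
by rewrite prodr_const; congr (_ ^+ _); apply: eq_card => p; rewrite inE.
Qed.

(** This product of factorials is the second moment of the weight of a cycle without shift. *)
Lemma prod_mult_fact_2 : k = 2 -> (\prod_(e in pairs) (mult i e)`! = 2)%N.
Proof.
move=> k2; pose p0 : 'I_k := Ordinal (ltnW k1); pose e0 := cedge i p0.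
have e0P : e0 \in pairs by exact: cedge_pairs.
have m0 : mult i e0 = 2 by apply: mult_2 => //; exact: mult_cedge_gt0.
rewrite (bigD1 e0)//= m0 big1// => e /andP[eP ee0].
suff -> : mult i e = 0%N by [].
have := sum_mult; rewrite (bigD1 e0)//= m0 (bigD1 e)//=; last by rewrite eP.
lia.
Qed.

Lemma prod_mult_fact_gt2 : (2 < k)%N -> (\prod_(e in pairs) (mult i e)`! = 1)%N.
Proof.
by move=> k2; rewrite big1// => e _; have := mult_le1 e k2; case: (mult i e) => [|[|]].
Qed.

End one_cycle.

Definition same_mult k l (i : {ffun 'I_k -> 'I_N}) (j : {ffun 'I_l -> 'I_N}) :=
  [forall e, mult i e == mult j e].

Lemma same_multP k l (i : {ffun 'I_k -> 'I_N}) (j : {ffun 'I_l -> 'I_N}) :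
  reflect (mult i =1 mult j) (same_mult i j).
Proof. by apply: (iffP forallP) => H e; exact/eqP/H. Qed.

Lemma same_mult_size k l (i : {ffun 'I_k -> 'I_N}) (j : {ffun 'I_l -> 'I_N}) :
  (1 < k)%N -> (1 < l)%N -> injective i -> injective j -> same_mult i j -> k = l.
Proof.
move=> k1 l1 inji injj /same_multP ij.
by rewrite -(sum_mult k1 inji) -(sum_mult l1 injj); apply: eq_bigr => e _.
Qed.

Section count_same.
Variables (k : nat) (i : {ffun 'I_k -> 'I_N}).
Hypotheses (k1 : (1 < k)%N) (inji : injective i).

Let p0 : 'I_k := Ordinal (ltnW k1).

Let S := [set j : {ffun 'I_k -> 'I_N} | injectiveb j && same_mult i j]%SET.

Let start (j : {ffun 'I_k -> 'I_N}) := (j p0, j (ordS p0)).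

(** A cycle with prescribed edges is determined by its first two vertices: at each vertex the next
    edge is forced. *)
Let start_inj : {in S &, injective start}.
Proof.
move=> j j'; rewrite !inE => /andP[/injectiveP injj /same_multP jm].
move=> /andP[/injectiveP injj' /same_multP jm'] [j0 j1].
suff H n : j (iter n (@ordS k) p0) = j' (iter n (@ordS k) p0) /\
    j (iter n.+1 (@ordS k) p0) = j' (iter n.+1 (@ordS k) p0).
  by apply/ffunP => p; have [+ _] := H (p + k - p0)%N; rewrite iter_ordS.
elim: n => [//|n [jn jn1]]; split => //.
set q := iter n (@ordS k) p0 in jn jn1 *.
rewrite /= -/q in jn1 *.
have [p] : exists p, cedge j p = cedge j' (ordS q).
  by apply/mult_gt0P; rewrite -jm jm'; exact: mult_cedge_gt0.
rewrite /cedge -jn1 => /edge_inj[[/injj ->]//|[pq /injj sp]].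
(* Remaining case: the edge is traversed backwards, so it is the one just used. Then [q] is its own
   second successor, and the two cycles close up together. *)
have e : p = q by apply: (can_inj (@ordSK k)); exact: sp.
rewrite e jn in pq; have qq : q = ordS (ordS q) by exact: injj'.
by rewrite -qq.
Qed.

Let start_img (j : {ffun 'I_k -> 'I_N}) : j \in S -> exists a, 
  start j = (i a, i (ordS a)) \/ start j = (i (ordS a), i a).
Proof.
rewrite inE => /andP[/injectiveP injj /same_multP jm].
have [a] : exists a, cedge i a = cedge j p0.
  by apply/mult_gt0P; rewrite jm; exact: mult_cedge_gt0.
rewrite /cedge /start => /edge_inj[[<- <-]|[<- <-]]; exists a; first by left.
by right.
Qed.

(** Rotations and reflections give [2 k] cycles with the same edges when [2 < k]. For [k = 2] there
    are only two, and the factorial [2] makes up the difference; hence the same variance bound [2 k]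
    in both cases. *)
Lemma card_same_mult : (#|S| * \prod_(e in pairs) (mult i e)`! <= k.*2)%N.
Proof.
rewrite -(card_in_imset start_inj).
have [k2|k2] : (2 < k)%N \/ k = 2 by lia.
  rewrite prod_mult_fact_gt2// muln1.
  pose f (ab : 'I_k * bool) := if ab.2 then (i ab.1, i (ordS ab.1)) else (i (ordS ab.1), i ab.1).
  apply: (@leq_trans #|f @: [set: _]%SET|).
    apply: subset_leq_card; apply/fintype.subsetP => x /imsetP[j jS ->].
    have [a [e|e]] := start_img jS; rewrite e; apply/imsetP.
      by exists (a, true); rewrite ?inE.
    by exists (a, false); rewrite ?inE.
  by apply: leq_trans (leq_imset_card _ _) _; rewrite cardsT card_prod card_bool card_ord muln2.
rewrite prod_mult_fact_2// muln2 leq_double.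
pose f (a : 'I_k) := (i a, i (ordS a)).
have SS (a : 'I_k) : ordS (ordS a) = a.
  by move: a; rewrite k2 => a; exact: ordSS_2.
apply: (@leq_trans #|f @: [set: _]%SET|).
  apply: subset_leq_card; apply/fintype.subsetP => x /imsetP[j jS ->].
  have [a [e|e]] := start_img jS; rewrite e; apply/imsetP.
    by exists a; rewrite ?inE.
  by exists (ordS a); rewrite ?inE// /f SS.
by apply: leq_trans (leq_imset_card _ _) _; rewrite cardsT card_ord.
Qed.

End count_same.

Definition shared k l (i : {ffun 'I_k -> 'I_N}) (j : {ffun 'I_l -> 'I_N}) :=
  #|[set v | (v \in codom i) && (v \in codom j)]%SET|.

Lemma sharedC k l (i : {ffun 'I_k -> 'I_N}) (j : {ffun 'I_l -> 'I_N}) :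
  shared i j = shared j i.
Proof. by apply: eq_card => v; rewrite !inE andbC. Qed.

Lemma edge_shared k l (i : {ffun 'I_k -> 'I_N}) (j : {ffun 'I_l -> 'I_N}) p :
  (0 < mult j (cedge i p))%N -> i p \in codom j /\ i (ordS p) \in codom j.
Proof.
by move=> /mult_gt0P[q /edge_inj[[<- <-]|[<- <-]]]; rewrite !codom_f.
Qed.

(** Unless the cycles coincide, the common edges form disjoint paths, and a path has more vertices
    than edges. The strict inequality is what makes overlapping pairs of distinct cycles negligible,
    by a factor [1 / N]. *)
Lemma shared_ge k l (i : {ffun 'I_k -> 'I_N}) (j : {ffun 'I_l -> 'I_N}) :
  (1 < k)%N -> (1 < l)%N -> injective i -> injective j ->
  ~~ same_mult i j -> (0 < shared i j)%N ->
  (\sum_(e in pairs) minn (mult i e) (mult j e) < shared i j)%N.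
Proof.
wlog kl : k l i j / (l <= k)%N.
  move=> H; have [lk|/ltnW kl] := leqP l k; first exact: H.
  move=> k1 l1 inji injj; rewrite sharedC => nij sh.
  under eq_bigr do rewrite minnC.
  apply: H => //; apply: contraNN nij => /same_multP ji.
  by apply/same_multP => e; rewrite ji.
move=> k1 l1 inji injj nij sh.
(* Steps of the longer cycle that run along an edge of the shorter one. Both ends of such a step are
   shared, hence so are the positions in [T] and their successors. *)
pose T := [set p | (0 < mult j (cedge i p))%N]%SET.
have sumT : (\sum_(e in pairs) minn (mult i e) (mult j e) <= #|T|)%N.
  have -> : #|T| = (\sum_(e in pairs | 0 < mult j e) mult i e)%N.
    rewrite sum_mult_pred -sum1dep_card big_mkcond; apply: eq_bigr => p _.
    by rewrite cedge_pairs//=; case: ltnP.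
  rewrite [leqRHS]big_mkcondr; apply: leq_sum => e _.
  by case: ifPn => [_|]; [exact: geq_minl|rewrite -leqNgt leqn0 => /eqP ->; rewrite minn0].
have sharedT : (#|T :|: [set ordS p | p in T]| <= shared i j)%N.
  rewrite -(card_imset _ inji); apply: subset_leq_card; apply/fintype.subsetP => v.
  case/imsetP => p; rewrite !inE => /orP[pT|/imsetP[q qT ->]] ->.
    by rewrite codom_f; have [-> _] := edge_shared pT.
  rewrite inE in qT.
  by rewrite codom_f; have [_ ->] := edge_shared qT.
have [T0|Tn0] := eqVneq T finset.set0.
  by move: sumT; rewrite T0 cards0 leqn0 => /eqP ->.
(* A nonempty proper [T] is not closed under successor, so the successors contribute at least one
   further vertex. *)
have [TT|TnT] := eqVneq T [set: 'I_k]%SET; last first.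
  apply: leq_ltn_trans sumT _; apply: leq_trans sharedT.
  apply: proper_card; rewrite properE finset.subsetUl/=.
  apply: contraNN TnT => /fintype.subsetP sub; rewrite finset.eqEsubset finset.subsetT/=.
  have [q qT] := set0Pn _ Tn0.
  have clos n : iter n (@ordS k) q \in T.
    elim: n => [//|n ih]; apply: sub; rewrite inE; apply/orP; right.
    by apply/imsetP; exists (iter n (@ordS k) q).
  apply/fintype.subsetP => p _.
  by rewrite -(iter_ordS q p); exact: clos.
(* Every edge of the longer cycle lies on the shorter one. The multiplicities are then ordered, and
   comparing their totals [k] and [l] forces equality. *)
exfalso; move/negP: nij; apply; apply/same_multP.
have le e : (mult i e <= mult j e)%N.
  have [ip|] := ltnP 0 (mult i e); last by rewrite leqn0 => /eqP ->.
  have jp : (0 < mult j e)%N.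
    have /mult_gt0P[p <-] := ip.
    have : p \in T by rewrite TT inE.
    by rewrite inE.
  have [k2|k2] := ltnP 2 k; first by apply: leq_trans (mult_le1 inji e k2) jp.
  have l2 : l = 2 by lia.
  rewrite (mult_2 l1 injj l2 jp).
  exact: mult_le2.

have sumE : (\sum_(e in pairs) mult i e = \sum_(e in pairs) mult j e)%N.
  apply/eqP; rewrite eqn_leq; apply/andP; split; first exact: leq_sum.
  by rewrite !sum_mult.
move=> e; have [eP|eP] := boolP (e \in pairs); last by rewrite !mult_notin_pairs.
apply/eqP; rewrite eqn_leq le /=.
move: sumE; rewrite (bigD1 e)//= [RHS](bigD1 e)//=.
have : (\sum_(e' in pairs | e' != e) mult i e' <= \sum_(e' in pairs | e' != e) mult j e')%N.
  by apply: leq_sum.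
move=> h1 h2; rewrite -(leq_add2r (\sum_(e' in pairs | e' != e) mult j e')).
by rewrite -h2 leq_add2l.
Qed.

Lemma shared_inj k l (i : {ffun 'I_k -> 'I_N}) (j : {ffun 'I_l -> 'I_N}) :
  injective j -> shared i j = (\sum_p (j p \in codom i))%N.
Proof.
move=> injj; rewrite -[RHS]big_mkcond sum1_card.
rewrite -(card_imset (mem [pred p | j p \in codom i]) injj).
apply: eq_card => v; rewrite !inE; apply/andP/imsetP.
  by move=> [vi /codomP[p vp]]; exists p => //; rewrite inE -vp.
by move=> [p]; rewrite inE => pi ->; rewrite pi codom_f.
Qed.

(* Distributing [\prod_p N ^ (j p \in codom i)] over the sum counts all
   overlap patterns at once. *)
Lemma sum_shared k l (i : {ffun 'I_k -> 'I_N}) :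
  (\sum_(j : {ffun 'I_l -> 'I_N} | injectiveb j) N ^ shared i j <= (k.+1 * N) ^ l)%N.
Proof.
apply: (@leq_trans (\sum_(j : {ffun 'I_l -> 'I_N}) \prod_p N ^ (j p \in codom i))%N).
  rewrite [leqRHS](bigID (fun j : {ffun 'I_l -> 'I_N} => injectiveb j))/= -[leqLHS]addn0 leq_add//.
  apply: leq_sum => j /injectiveP injj.
  by rewrite shared_inj// -expn_sum.
rewrite -(bigA_distr_bigA (fun (p : 'I_l) (v : 'I_N) => N ^ (v \in codom i))%N).
rewrite prod_nat_const card_ord.
suff H : (\sum_(v : 'I_N) N ^ (v \in codom i) <= k.+1 * N)%N.
  by case: l => // l; rewrite leq_exp2r.
rewrite (bigID (mem (codom i)))/= mulSn addnC leq_add//.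
  rewrite (eq_bigr (fun=> 1%N)) => [|v /negbTE ->//].
  by rewrite sum1_card; apply: leq_trans (max_card _) _; rewrite card_ord.
rewrite (eq_bigr (fun=> N)) => [|v ->]; last by rewrite expn1.
rewrite sum_nat_const leq_mul2r; apply/orP; right.
by apply: leq_trans (card_size _) _; rewrite size_codom card_ord.
Qed.

End cycles.

(** * Cycle counts under a Gaussian shift *)

Section tilted_disorder.
Context d (T : measurableType d) (R : realType) (P : probability T R).
Variables (N : nat) (g : 'I_N * 'I_N -> {RV P >-> R}).
Hypothesis g_indep : mutually_independent (pairs N) g.
Hypothesis g_normal : forall e, e \in pairs N -> normal_mgf P (g e).
Implicit Types (a : 'I_N * 'I_N -> R) (F G : T -> R).

(** Density under which the [g e] are independent normal variables with means [a e] and variance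
    one. *)
Definition tilt a w := \prod_(e in pairs N) expR (a e * g e w - a e ^+ 2 / 2).

Definition has_tilted_mean a F (v : R) := has_mean P (fun w => F w * tilt a w) v.

Lemma eq_has_tilted_mean a F G v :
  F =1 G -> has_tilted_mean a F v -> has_tilted_mean a G v.
Proof. by move=> /funext ->. Qed.

Lemma has_tilted_meanD a F G u v : has_tilted_mean a F u ->
  has_tilted_mean a G v -> has_tilted_mean a (fun w => F w + G w) (u + v).
Proof. by move=> hF hG; apply: eq_has_mean (has_meanD hF hG) => w; rewrite mulrDl. Qed.

Lemma has_tilted_meanZ a c F u : has_tilted_mean a F u ->
  has_tilted_mean a (fun w => c * F w) (c * u).
Proof. by move=> hF; apply: eq_has_mean (has_meanZ c hF) => w; rewrite mulrA. Qed.

Lemma has_tilted_mean_sum a (I : Type) (r : seq I) (Q : pred I) (F : I -> T -> R)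
    (v : I -> R) : (forall i, Q i -> has_tilted_mean a (F i) (v i)) ->
  has_tilted_mean a (fun w => \sum_(i <- r | Q i) F i w) (\sum_(i <- r | Q i) v i).
Proof.
move=> h; apply: eq_has_mean (has_mean_sum r h) => w.
by rewrite mulr_suml.
Qed.

Lemma has_tilted_mean_prod a (p : 'I_N * 'I_N -> R -> R) m :
  (forall e, e \in pairs N -> tilted_mean (a e) (p e) (m e)) ->
  has_tilted_mean a (fun w => \prod_(e in pairs N) p e (g e w))
    (\prod_(e in pairs N) m e).
Proof.
move=> hp.
have := @has_mean_prod _ _ _ _ _ _ _ g_indep
  (fun e x => p e x * expR (a e * x - a e ^+ 2 / 2)) m.
move=> H; apply: eq_has_mean (H _ _) => [w|e eP|e eP].
- by rewrite big_split.
- apply: measurable_funM; first by case: (hp e eP).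
  apply: measurableT_comp => //; apply: measurable_funB => //.
- by have [_ h] := hp e eP; apply: h; exact: g_normal.
Qed.

Lemma has_tilted_mean_cst a c : has_tilted_mean a (fun=> c) c.
Proof.
rewrite -[X in has_tilted_mean _ _ X]mulr1.
apply: (@eq_has_tilted_mean _ (fun=> c * 1)) => [w|]; first by rewrite mulr1.
apply: has_tilted_meanZ.
have := @has_tilted_mean_prod a (fun _ _ => 1) (fun=> 1).
rewrite big1// => H; apply: eq_has_tilted_mean (H _) => [w|e _]; first by rewrite ?big1.
apply: eq_tilted_mean (tilted_mean_hermite (a e) 0 0) => x /=.
by rewrite mulr1.
Qed.

Definition noise a e w := g e w - a e.

(** Turns a function of one edge variable into a product over all pairs, the form required by
    [has_tilted_mean_prod]. *)
Let single (X : R -> R) (e0 e : 'I_N * 'I_N) : R -> R := if e == e0 then X else fun=> 1.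

Let prod_single (X : R -> R) e0 w : e0 \in pairs N ->
  \prod_(e in pairs N) single X e0 e (g e w) = X (g e0 w).
Proof.
move=> e0P; rewrite (bigD1 e0)//= /single eqxx big1 ?mulr1// => e /andP[_ /negbTE ee0].
by rewrite ee0.
Qed.

Let tilted_mean1 (b : R) : tilted_mean b (fun=> 1) 1.
Proof.
by apply: eq_tilted_mean (tilted_mean_hermite b 0 0) => x /=; rewrite mulr1.
Qed.

Lemma has_tilted_mean_noise a e : e \in pairs N -> has_tilted_mean a (noise a e) 0.
Proof.
move=> eP; have := @has_tilted_mean_prod a (single (fun x => x - a e) e)
  (fun e' => if e' == e then 0 else 1).
rewrite (bigD1 e)//= eqxx mul0r => H.
apply: eq_has_tilted_mean (H _) => [w|e' _]; first exact: prod_single.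
by rewrite /single; case: eqP => // ->; exact: tilted_mean_centered.
Qed.

Lemma has_tilted_mean_noise2 a e e' : e \in pairs N -> e' \in pairs N ->
  has_tilted_mean a (fun w => noise a e w * noise a e' w) (e == e')%:R.
Proof.
move=> eP e'P; have [<-|ee'] := eqVneq e e'.
  have := @has_tilted_mean_prod a (single (fun x => (x - a e) * (x - a e)) e)
    (fun e' => 1).
  rewrite big1// => H.
  apply: eq_has_tilted_mean (H _) => [w|e'' _].
    exact: (prod_single (fun x => (x - a e) * (x - a e))).
  by rewrite /single; case: eqP => // ->; exact: tilted_mean_centered2.
have := @has_tilted_mean_prod a
  (fun e'' x => single (fun x => x - a e) e e'' x * single (fun x => x - a e') e' e'' x)
  (fun e'' => if (e'' == e) || (e'' == e') then 0 else 1).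
rewrite (bigD1 e)//= eqxx mul0r => H.
apply: eq_has_tilted_mean (H _) => [w|e'' _].
  by rewrite big_split/= (prod_single (fun x => x - a e))// (prod_single (fun x => x - a e')).
rewrite /single; have [->|ne] := eqVneq e'' e.
  rewrite (negbTE ee') /=; apply: eq_tilted_mean (tilted_mean_centered (a e)) => x.
  by rewrite mulr1.
have [->|ne'] := eqVneq e'' e'; rewrite ?(negbTE ne')/=.
  by apply: eq_tilted_mean (tilted_mean_centered (a e')) => x; rewrite mul1r.
by apply: eq_tilted_mean (tilted_mean1 _) => x; rewrite mulr1.
Qed.

(* For [2 < k] this is the product of the disorder along the cycle; for [k = 2]
   the Hermite polynomial [x ^+ 2 - 1] absorbs the centering of the count. *)
Definition cycle_weight k (i : {ffun 'I_k -> 'I_N}) w :=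
  \prod_(e in pairs N) hermite (mult i e) (g e w).

Section cycle_pairs.
Variables (k l : nat) (i : {ffun 'I_k -> 'I_N}) (j : {ffun 'I_l -> 'I_N}).

Lemma has_tilted_mean_cycle2 a :
  has_tilted_mean a (fun w => cycle_weight i w * cycle_weight j w)
    (\prod_(e in pairs N) hermite_cov (a e) (mult i e) (mult j e)).
Proof.
have := @has_tilted_mean_prod a (fun e x => hermite (mult i e) x * hermite (mult j e) x)
  (fun e => hermite_cov (a e) (mult i e) (mult j e)).
move=> H; apply: eq_has_tilted_mean (H _) => [w|e _]; first by rewrite big_split.
exact: tilted_mean_hermite.
Qed.

Hypotheses (k1 : (1 < k)%N) (inji : injective i).

Lemma has_tilted_mean_cycle a :
  has_tilted_mean a (cycle_weight i) (\prod_(p < k) a (cedge i p)).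
Proof.
rewrite -(prod_mult k1 inji).
apply: (@has_tilted_mean_prod a (fun e => hermite (mult i e))) => e _.
have := tilted_mean_hermite (a e) (mult i e) 0; rewrite hermite_cov0 ?mult_le2//.
by apply: eq_tilted_mean => x; rewrite /= mulr1.
Qed.

(** Integration by parts: pairing with the noise at [e] differentiates the weight in [g e], that is,
    deletes one occurrence of [e] from the cycle. *)
Lemma has_tilted_mean_noise_cycle a e : e \in pairs N ->
  has_tilted_mean a (fun w => noise a e w * cycle_weight i w)
    (\sum_(p < k | cedge i p == e) \prod_(q < k | q != p) a (cedge i q)).
Proof.
move=> eP.
have := @has_tilted_mean_prod a
  (fun e' x => single (fun x => x - a e) e e' x * hermite (mult i e') x)
  (fun e' => if e' == e then (mult i e)%:R * a e ^+ (mult i e).-1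
             else a e' ^+ mult i e').
move=> H.
have -> : \sum_(p < k | cedge i p == e) \prod_(q < k | q != p) a (cedge i q) =
  \prod_(e' in pairs N) (if e' == e then (mult i e)%:R * a e ^+ (mult i e).-1
             else a e' ^+ mult i e').
  rewrite (bigD1 e)//= eqxx.
  pose c := \prod_(e' in pairs N | e' != e) a e' ^+ mult i e'.
  rewrite [X in _ = _ * X](_ : _ = c); last first.
    by apply: eq_bigr => e' /andP[_ /negbTE ->].
  rewrite (eq_bigr (fun=> a e ^+ (mult i e).-1 * c)); last first.
    move=> p /eqP pe.
    have cE : c = \prod_(q < k | cedge i q != e) a (cedge i q).
      rewrite [RHS](partition_big (cedge i) (fun e' => (e' \in pairs N) && (e' != e)))/=.
        apply: eq_bigr => e' /andP[e'P e'e].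
        rewrite (eq_bigr (fun=> a e')) => [|q /andP[_ /eqP -> //]].
        rewrite prodr_const; congr (_ ^+ _); apply: eq_card => q.
        rewrite inE unfold_in; apply/esym; rewrite andb_idl// => /eqP ->//.
      by move=> q ->; rewrite cedge_pairs.
    rewrite cE (bigID (fun q => cedge i q == e))/=; congr (_ * _).
      rewrite (eq_bigr (fun=> a e)) => [|q /andP[_ /eqP ->//]].
      rewrite prodr_const; congr (_ ^+ _).
      rewrite /mult [in RHS](cardD1 p) inE pe eqxx add1n /=; apply: eq_card => q.
      by rewrite unfold_in !inE.
    apply: eq_bigl => q; rewrite andb_idl//.
    by apply: contraNneq => ->; rewrite pe.
  rewrite sumr_const -[RHS]mulrA mulr_natl; congr (_ *+ _).
apply: eq_has_tilted_mean (H _) => [w|e' _].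
  by rewrite big_split/= (prod_single (fun x => x - a e)).
rewrite /single; case: eqP => [->|_].
  by apply: tilted_mean_centered_hermite; exact: mult_le2.
have := tilted_mean_hermite (a e') (mult i e') 0; rewrite hermite_cov0 ?mult_le2//.
by apply: eq_tilted_mean => x; rewrite /= mulr1 mul1r.
Qed.

End cycle_pairs.
End tilted_disorder.

(** The proportion of maps from [k] points to [N] points that are not injective is at most
    [k ^ 2 / N]; multiplied out to stay in the natural numbers. *)
Lemma ffact_lower_bound N k : (N ^ k.+1 <= N * N ^_ k + k ^ 2 * N ^ k)%N.
Proof.
elim: k => [|k ih]; first by rewrite ffactn0 muln1 expn1 expn0 muln1 leq_addr.
have [kN|Nk] := leqP k N; last first.
  apply: (@leq_trans (k.+1 ^ 2 * N ^ k.+1)%N); last exact: leq_addl.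
  rewrite [leqLHS]expnS leq_mul2r; apply/orP; right.
  rewrite -mulnn; apply: leq_trans (leq_pmulr _ _) => //; lia.
rewrite ffactnSr; set X := (N ^_ k)%N in ih *.
rewrite !expnS in ih *; set Y := (N ^ k)%N in ih *.
have := leq_mul (leqnn (N - k)%N) ih.
have NE : (N = k + (N - k))%N by rewrite subnKC.
have rN : (N - k <= N)%N by exact: leq_subr.
set r := (N - k)%N in NE rN *.
have h2 : (r * (k ^ 2 * Y) <= N * (k ^ 2 * Y))%N by rewrite leq_mul2r rN orbT.
have -> : (N * (N * Y) = k * (N * Y) + r * (N * Y))%N by rewrite -mulnDl -NE.
rewrite !expn0 !muln1 -mulnn in h2 *; rewrite ?expn0 ?muln1 => h1; nia.
Qed.

(** * Sums over closed walks for a shift of rank two *)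

Section rank_two_cycles.
Variables (R : realType) (N : nat) (sigma tau : 'I_N -> R).
Hypothesis sigma2 : forall u, sigma u * sigma u = 1.
Hypothesis tau2 : forall u, tau u * tau u = 1.

Definition overlap_sum : R := \sum_(u < N) sigma u * tau u.

Lemma spin_norm1 (f : 'I_N -> R) u : f u * f u = 1 -> `|f u| = 1.
Proof. by move=> h; apply/eqP; rewrite -(@eqrXn2 _ 2)// ?normr_ge0// -normrX expr2 h normr1 expr1n. Qed.

Lemma overlap_sum_le : `|overlap_sum| <= N%:R.
Proof.
apply: (le_trans (ler_norm_sum _ _ _)).
rewrite (eq_bigr (fun=> 1)) => [|u _]; last first.
  by rewrite normrM !spin_norm1 ?mulr1.
by rewrite sumr_const card_ord.
Qed.

Let spin (b : bool) := if b then sigma else tau.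

Let sum_spin b b' : \sum_(u < N) spin b u * spin b' u =
  if b == b' then N%:R else overlap_sum.
Proof.
case: b b' => [] [] /=; rewrite /overlap_sum.
- by rewrite (eq_bigr (fun=> 1)) ?sumr_const ?card_ord.
- by [].
- by apply: eq_bigr => u _; rewrite mulrC.
- by rewrite (eq_bigr (fun=> 1)) ?sumr_const ?card_ord.
Qed.

Variables (k : nat) (A B : 'I_k -> R).
Hypothesis k_gt0 : (0 < k)%N.
Hypothesis A1 : forall p, `|A p| <= 1.
Hypothesis B1 : forall p, `|B p| <= 1.

Let term (i : {ffun 'I_k -> 'I_N}) p :=
  A p * (sigma (i p) * sigma (i (ordS p))) + B p * (tau (i p) * tau (i (ordS p))).

Let coef (b : bool) p := if b then A p else B p.

(** Regrouped by vertices, the product factorizes: vertex [p] carries the spins chosen for the steps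
    leaving and entering it, and its sum is [N] if they agree and the overlap otherwise. *)
Let sum_prod_spin (S : {ffun 'I_k -> bool}) :
  \sum_(i : {ffun 'I_k -> 'I_N}) \prod_p (spin (S p) (i p) * spin (S p) (i (ordS p))) =
  \prod_p if S p == S (ord_pred p) then N%:R else overlap_sum.
Proof.
under [RHS]eq_bigr do rewrite -sum_spin.
rewrite [RHS]bigA_distr_bigA; apply: eq_bigr => i _.
rewrite !big_split/=; congr (_ * _).
rewrite (reindex (@ord_pred k))/=; last first.
  exact: onW_bij (Bijective (@ord_predK k) (@ordSK k)).
by apply: eq_bigr => p _; rewrite ord_predK.
Qed.

(** Expanding each step into its [sigma] and [tau] parts, the two constant choices give the main
    term. Any other choice switches somewhere, which replaces a factor [N] by the overlap; there are
    at most [2 ^ k] of them. The coefficients vary with the position so that one step can later be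
    restricted to a single spin. *)
Lemma sum_rank_two_cycle :
  `|\sum_(i : {ffun 'I_k -> 'I_N}) \prod_p term i p -
     N%:R ^+ k * (\prod_p A p + \prod_p B p)| * N%:R <=
  2 ^+ k * N%:R ^+ k * `|overlap_sum|.
Proof.
pose val (S : {ffun 'I_k -> bool}) :=
  (\prod_p coef (S p) p) * \prod_p if S p == S (ord_pred p) then N%:R else overlap_sum.
have E : \sum_(i : {ffun 'I_k -> 'I_N}) \prod_p term i p = \sum_S val S.
  transitivity (\sum_(i : {ffun 'I_k -> 'I_N}) \sum_(S : {ffun 'I_k -> bool})
     \prod_p (coef (S p) p * (spin (S p) (i p) * spin (S p) (i (ordS p))))).
    apply: eq_bigr => i _; rewrite -(bigA_distr_bigA (fun p b =>
      coef b p * (spin b (i p) * spin b (i (ordS p))))).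
    by apply: eq_bigr => p _; rewrite big_bool.
  rewrite exchange_big; apply: eq_bigr => S _.
  by rewrite /val -sum_prod_spin mulr_sumr; apply: eq_bigr => i _; rewrite big_split.
pose cst b : {ffun 'I_k -> bool} := [ffun=> b].
have val_cst b : val (cst b) = N%:R ^+ k * \prod_p coef b p.
  rewrite /val mulrC; congr (_ * _); last by apply: eq_bigr => p _; rewrite ffunE.
  rewrite (eq_bigr (fun=> N%:R)) => [|p _]; last by rewrite !ffunE eqxx.
  by rewrite prodr_const card_ord.
have ctf : cst false != cst true.
  by apply/eqP => /ffunP/(_ (Ordinal k_gt0)); rewrite !ffunE.
have other S : (S != cst true) && (S != cst false) ->
    `|val S| * N%:R <= N%:R ^+ k * `|overlap_sum|.
  move=> /andP[St Sf].
  have [p Sp] : exists p, S p != S (ord_pred p).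
    apply: contrapT => nex.
    have Seq p : S p = S (ord_pred p).
      by apply/eqP; apply: contrapT => np; apply: nex; exists p; apply/negP.
    have Sord p : S (ordS p) = S p by rewrite (Seq (ordS p)) ordSK.
    pose p0 : 'I_k := Ordinal k_gt0.
    have Sc p : S p = S p0.
      rewrite -(iter_ordS p0 p); elim: (_ - _)%N => //= n <-.
      by rewrite Sord.
    case: (S p0) Sc => Sc.
      by move/eqP: St; apply; apply/ffunP => p; rewrite Sc ffunE.
    by move/eqP: Sf; apply; apply/ffunP => p; rewrite Sc ffunE.
  rewrite /val normrM [X in _ * `|X|](bigD1 p)//= (negbTE Sp) normrM.
  have c1 : `|\prod_q coef (S q) q| <= 1.
    rewrite normr_prod; apply: prodr_ile1 => q _; rewrite normr_ge0/=.
    by rewrite /coef; case: (S q).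
  have c2 : `|\prod_(q | q != p) (if S q == S (ord_pred q) then N%:R else overlap_sum)|
      <= N%:R ^+ k.-1.
    rewrite normr_prod; apply: (@le_trans _ _ (\prod_(q < k | q != p) N%:R)).
      apply: ler_prod => q _; rewrite normr_ge0/=; case: ifP => _.
        by rewrite ger0_norm.
      exact: overlap_sum_le.
    rewrite prodr_const le_eqVlt; apply/orP; left; apply/eqP; congr (_ ^+ _).
    by rewrite cardC1 card_ord.
  apply: (@le_trans _ _ (1 * (`|overlap_sum| * N%:R ^+ k.-1) * N%:R)).
    apply: ler_wpM2r => //; apply: ler_pM => //.
    exact: ler_wpM2l.
  by rewrite mul1r -mulrA -exprSr prednK// mulrC.
rewrite E (bigD1 (cst true))//= (bigD1 (cst false))//= !val_cst.
rewrite (_ : _ - _ = \sum_(S | (S != cst true) && (S != cst false)) val S); last first.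
  by rewrite mulrDr /coef; ring.
apply: (@le_trans _ _ ((\sum_(S | (S != cst true) && (S != cst false)) `|val S|) * N%:R)).
  by apply: ler_wpM2r => //; exact: ler_norm_sum.
rewrite mulr_suml.
apply: (@le_trans _ _ (\sum_(S | (S != cst true) && (S != cst false))
    (N%:R ^+ k * `|overlap_sum|))); first by apply: ler_sum => S; exact: other.
rewrite sumr_const -[_ *+ _]mulr_natl -mulrA; apply: ler_wpM2r.
  by rewrite mulr_ge0.
rewrite -natrX ler_nat; apply: leq_trans (max_card _) _.
by rewrite card_ffun card_bool card_ord.
Qed.

Let term2 i p : `|term i p| <= 2.
Proof.
apply: (le_trans (ler_normD _ _)); rewrite !normrM !spin_norm1// !mulr1.
by have := A1 p; have := B1 p; lra.
Qed.

(** The walks removed are at most a proportion [k ^ 2 / N] of all, and each has weight at most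
    [2 ^ k]. *)
Lemma sum_inj_rank_two_cycle :
  `|\sum_(i : {ffun 'I_k -> 'I_N} | injectiveb i) \prod_p term i p -
     N%:R ^+ k * (\prod_p A p + \prod_p B p)| * N%:R <=
  2 ^+ k * N%:R ^+ k * (`|overlap_sum| + (k ^ 2)%:R).
Proof.
have := sum_rank_two_cycle.
rewrite (bigID (fun i : {ffun 'I_k -> 'I_N} => injectiveb i))/=.
set X := (X in `|X + _ - _|); set Y := (X in `|_ + X - _|).
set Z := N%:R ^+ k * _ => h.
have hY : `|Y| * N%:R <= 2 ^+ k * (N%:R ^+ k * (k ^ 2)%:R).
  apply: (@le_trans _ _ ((\sum_(i : {ffun 'I_k -> 'I_N} | ~~ injectiveb i) 2 ^+ k) * N%:R)).
    apply: ler_wpM2r => //; apply: (le_trans (ler_norm_sum _ _ _)).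
    apply: ler_sum => i _; rewrite normr_prod.
    apply: (@le_trans _ _ (\prod_(p < k) 2)); last by rewrite prodr_const card_ord.
    by apply: ler_prod => p _; rewrite normr_ge0 term2.
  rewrite sumr_const -[_ *+ _]mulr_natr -mulrA ler_wpM2l//.
  rewrite -!natrX -!natrM ler_nat.
  have cN : (#|[pred i : {ffun 'I_k -> 'I_N} | ~~ injectiveb i]| + N ^_ k = N ^ k)%N.
    have := card_inj_ffuns 'I_k 'I_N; rewrite !card_ord => <-.
    have := cardC [pred i : {ffun 'I_k -> 'I_N} | injectiveb i].
    rewrite card_ffun !card_ord => <-; rewrite addnC; congr (_ + _)%N.
    by apply: eq_card => i; rewrite !inE.
  have := ffact_lower_bound N k; rewrite expnS -cN.
  rewrite mulnDr [leqLHS]addnC leq_add2l => h0.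
  by rewrite [leqLHS]mulnC [leqRHS]mulnC; exact: h0.
have -> : X - Z = (X + Y - Z) - Y by ring.
apply: (@le_trans _ _ ((`|X + Y - Z| + `|Y|) * N%:R)).
  by apply: ler_wpM2r => //; exact: ler_normB.
rewrite mulrDl mulrDr; apply: lerD => //.
by rewrite -mulrA.
Qed.

End rank_two_cycles.

(** * Covariances of cycle weights and cycle sums *)

Section cycle_covariance.
Variables (R : realType) (N : nat) (a : 'I_N * 'I_N -> R).
Hypothesis N4 : (4 <= N)%N.

Let x : R := Num.sqrt N%:R.

Let x_gt0 : 0 < x.
Proof. by rewrite sqrtr_gt0 ltr0n; lia. Qed.

Let x2 : x ^+ 2 = N%:R.
Proof. by rewrite sqr_sqrtr. Qed.

Hypothesis a_le : forall e, `|a e| <= 2 / x.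

Let b := 2 / x.

Let b_ge0 : 0 <= b.
Proof. by rewrite divr_ge0// ltW. Qed.

(** This is where [4 <= N] comes from. *)
Let b_le1 : b <= 1.
Proof.
rewrite ler_pdivrMr// mul1r -(@ler_pXn2r _ 2)// ?nnegrE ?(ltW x_gt0)//.
by rewrite x2 -natrX ler_nat.
Qed.

Definition cycle_pair_mean k l (i : {ffun 'I_k -> 'I_N}) (j : {ffun 'I_l -> 'I_N}) :=
  \prod_(e in pairs N) hermite_cov (a e) (mult i e) (mult j e).

Definition cycle_mean k (i : {ffun 'I_k -> 'I_N}) := \prod_(p < k) a (cedge i p).

(** The power of [7] comes from [hermite_cov_bound], the [1] from the product of the means, and the
    power of [2] from [|a| <= 2 / sqrt N]. *)
Definition overlap_const k l : R := (7 ^+ k + 1) * 2 ^+ (k + l).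

Let cycle_mean_le k (i : {ffun 'I_k -> 'I_N}) : `|cycle_mean i| <= b ^+ k.
Proof.
rewrite normr_prod -[in leRHS](card_ord k) -prodr_const.
by apply: ler_prod => p _; rewrite normr_ge0 a_le.
Qed.

Lemma hermite_cov_diag_ge0 (c : R) m : (m <= 2)%N -> 0 <= hermite_cov c m m.
Proof.
have c2 := sqr_ge0 c; have c4 : 0 <= c ^+ 4 by exact: exprn_even_ge0.
by case: m => [|[|[|m]]]//= _; lra.
Qed.

Lemma hermite_cov_diag_le (c b' : R) m : (m <= 2)%N -> c ^+ 2 <= b' ->
  hermite_cov c m m <= m`!%:R * (1 + b') ^+ m.
Proof.
have c0 : 0 <= c ^+ 2 by exact: sqr_ge0.
case: m => [|[|[|m]]]//= _ cb; first by rewrite expr0 mulr1.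
  by rewrite expr1 mul1r; lra.
have -> : c ^+ 4 = (c ^+ 2) ^+ 2 by rewrite -exprM.
set y := c ^+ 2 in c0 cb *; rewrite -[2`!]/2%N.
have : y ^+ 2 <= b' ^+ 2 by rewrite ler_pXn2r// nnegrE; lra.
by rewrite !expr2; nra.
Qed.

(** Three cases: the same edges, where the factorials appear; no common vertex, where independence
    gives equality; and a partial overlap, where [shared_ge] gains the factor [1 / N]. *)
Lemma cycle_pair_cov_le k l (i : {ffun 'I_k -> 'I_N}) (j : {ffun 'I_l -> 'I_N}) :
  (1 < k)%N -> (1 < l)%N -> injective i -> injective j ->
  cycle_pair_mean i j <= cycle_mean i * cycle_mean j +
    (if same_mult i j then (\prod_(e in pairs N) (mult i e)`!)%:R * (1 + b ^+ 2) ^+ k else 0) +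
    overlap_const k l / x ^+ (k + l) * N%:R ^+ (shared i j) / N%:R.
Proof.
move=> k1 l1 inji injj.
have mE : cycle_mean i * cycle_mean j =
    \prod_(e in pairs N) (a e ^+ mult i e * a e ^+ mult j e).
  by rewrite big_split /= !prod_mult.
have Nr : 0 < N%:R :> R by rewrite ltr0n; lia.
have oc0 : 0 <= overlap_const k l / x ^+ (k + l) * N%:R ^+ (shared i j) / N%:R.
  by rewrite !mulr_ge0// ?invr_ge0 ?exprn_ge0 ?addr_ge0 ?ltW// exprn_ge0.
case: ifPn => ij.
  have {}ij := same_multP _ _ ij.
  have -> : cycle_mean i * cycle_mean j = (\prod_(e in pairs N) a e ^+ mult i e) ^+ 2.
    by rewrite mE expr2 -big_split/=; apply: eq_bigr => e _; rewrite -ij.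
  apply: (@le_trans _ _ ((\prod_(e in pairs N) (mult i e)`!)%:R * (1 + b ^+ 2) ^+ k)); last first.
    by have := sqr_ge0 (\prod_(e in pairs N) a e ^+ mult i e); lra.
  have -> : (1 + b ^+ 2) ^+ k = \prod_(e in pairs N) (1 + b ^+ 2) ^+ mult i e.
    by rewrite prodrXr sum_mult.
  rewrite natr_prod -big_split/=.
  apply: ler_prod => e _; rewrite -ij; apply/andP; split.
    by apply: hermite_cov_diag_ge0; exact: mult_le2.
  apply: hermite_cov_diag_le; first exact: mult_le2.
  by rewrite -real_normK ?num_real// lerXn2r ?nnegrE// a_le.
rewrite addr0; have [sh|sh] := posnP (shared i j).
  suff -> : cycle_pair_mean i j = cycle_mean i * cycle_mean j by rewrite lerDl.
  rewrite mE; apply: eq_bigr => e _.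
  have [ie|ie] := posnP (mult i e).
    by rewrite ie hermite_covC hermite_cov0 ?mult_le2// expr0 mul1r.
  have [je|je] := posnP (mult j e).
    by rewrite je hermite_cov0 ?mult_le2// expr0 mulr1.
  exfalso; move: sh; apply/eqP; rewrite -lt0n; apply/card_gt0P.
  have [p pe] := mult_gt0P _ _ ie.
  exists (i p); rewrite inE codom_f/=.
  by have [] : i p \in codom j /\ i (ordS p) \in codom j by apply: edge_shared; rewrite pe.
have lt_sh := shared_ge k1 l1 inji injj ij sh.
set M := (\sum_(e in pairs N) _)%N in lt_sh.
(* [M] counts the matched occurrences of edges, [M'] below the unmatched ones, each of which costs a
   factor [b]. *)
have M2 : (M.*2 + \sum_(e in pairs N) (mult i e + mult j e - (minn (mult i e) (mult j e)).*2)
    = k + l)%N.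
  transitivity (\sum_(e in pairs N) mult i e + \sum_(e in pairs N) mult j e)%N.
    rewrite -[RHS]big_split/= -mul2n big_distrr/= -big_split/=.
    apply: eq_bigr => e _; rewrite -mul2n; lia.
  by rewrite !sum_mult.
set M' := (\sum_(e in pairs N) _)%N in M2.
(* In powers of [x] one has [M' = k + l - 2 M], and [M < shared i j] bounds [N ^ M] by
   [N ^ shared / N]. *)
have bigb : b ^+ M' <= 2 ^+ (k + l) / x ^+ (k + l) * N%:R ^+ (shared i j) / N%:R.
  have -> : b ^+ M' = 2 ^+ M' / x ^+ (k + l) * N%:R ^+ M.
    rewrite -M2 exprMn exprVn -x2 -exprM exprD -mul2n.
    have u0 : x ^+ (2 * M) != 0 by rewrite expf_neq0// gt_eqF.
    have v0 : x ^+ M' != 0 by rewrite expf_neq0// gt_eqF.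
    by move: (x ^+ (2 * M)) (x ^+ M') (2 ^+ M') u0 v0 => u v z u0 v0; field; rewrite ?u0 ?v0.
  rewrite -[leRHS]mulrA ler_pM//.
  - by rewrite mulr_ge0// invr_ge0 exprn_ge0// (ltW x_gt0).
  - rewrite ler_pM2r ?invr_gt0 ?exprn_gt0// ler_weXn2l//; first by lra.
    lia.
  - by rewrite ler_pdivlMr// -exprSr ler_weXn2l// ler1n; lia.
have H1 : `|cycle_pair_mean i j| <= 7 ^+ k * b ^+ M'.
  rewrite normr_prod.
  apply: (@le_trans _ _ (\prod_(e in pairs N) (7 ^+ minn (mult i e) (mult j e) *
      b ^+ (mult i e + mult j e - (minn (mult i e) (mult j e)).*2)))).
    apply: ler_prod => e _; rewrite normr_ge0/=.
    by apply: hermite_cov_bound; rewrite ?mult_le2.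
  rewrite big_split/= !prodrXr; apply: ler_wpM2r.
    by rewrite exprn_ge0.
  rewrite ler_weXn2l//; first by lra.
  apply: (@leq_trans (\sum_(e in pairs N) mult i e)); last by rewrite sum_mult.
  by apply: leq_sum => e _; exact: geq_minl.
have H2 : `|cycle_mean i * cycle_mean j| <= b ^+ M'.
  rewrite normrM; apply: (@le_trans _ _ (b ^+ (k + l))).
    by rewrite exprD ler_pM.
  by apply: ler_wiXn2l => //; lia.
have := ler_norm (cycle_pair_mean i j); have := ler_norm (- (cycle_mean i * cycle_mean j)).
rewrite normrN /overlap_const.
set Y := 2 ^+ (k + l) / x ^+ (k + l) * N%:R ^+ (shared i j) / N%:R in bigb *.
have -> : (7 ^+ k + 1) * 2 ^+ (k + l) / x ^+ (k + l) * N%:R ^+ shared i j / N%:R =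
  7 ^+ k * Y + Y by rewrite /Y; ring.
have : 7 ^+ k * b ^+ M' <= 7 ^+ k * Y by rewrite ler_wpM2l// exprn_ge0.
lra.
Qed.

End cycle_covariance.

Section cycle_sums.
Context d (T : measurableType d) (R : realType) (P : probability T R).
Variables (N : nat) (g : 'I_N * 'I_N -> {RV P >-> R}).
Hypothesis g_indep : mutually_independent (pairs N) g.
Hypothesis g_normal : forall e, e \in pairs N -> normal_mgf P (g e).

Let x : R := Num.sqrt N%:R.

Definition cycle_sum k w : R :=
  (x ^+ k)^-1 * \sum_(i : {ffun 'I_k -> 'I_N} | injectiveb i) cycle_weight g i w.

Section means.
Variable a : 'I_N * 'I_N -> R.

Definition cycle_sum_mean k : R :=
  (x ^+ k)^-1 * \sum_(i : {ffun 'I_k -> 'I_N} | injectiveb i) cycle_mean a i.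

Definition cycle_sum_pair_mean k l : R := (x ^+ k)^-1 * (x ^+ l)^-1 *
  \sum_(i : {ffun 'I_k -> 'I_N} | injectiveb i)
    \sum_(j : {ffun 'I_l -> 'I_N} | injectiveb j) cycle_pair_mean a i j.

Lemma has_tilted_mean_cycle_sum k : (1 < k)%N ->
  has_tilted_mean g a (cycle_sum k) (cycle_sum_mean k).
Proof.
move=> k1; apply: has_tilted_meanZ; apply: has_tilted_mean_sum => i /injectiveP inji.
exact: has_tilted_mean_cycle.
Qed.

Lemma has_tilted_mean_cycle_sum2 k l :
  has_tilted_mean g a (fun w => cycle_sum k w * cycle_sum l w)
    (cycle_sum_pair_mean k l).
Proof.
apply: (@eq_has_tilted_mean _ _ _ _ _ _ _ (fun w => (x ^+ k)^-1 * (x ^+ l)^-1 *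
  \sum_(i : {ffun 'I_k -> 'I_N} | injectiveb i)
    \sum_(j : {ffun 'I_l -> 'I_N} | injectiveb j) (cycle_weight g i w * cycle_weight g j w))).
  move=> w; rewrite /cycle_sum mulrACA; congr (_ * _).
  by rewrite mulr_suml; apply: eq_bigr => i _; rewrite mulr_sumr.
apply: has_tilted_meanZ; apply: has_tilted_mean_sum => i _.
by apply: has_tilted_mean_sum => j _; exact: has_tilted_mean_cycle2.
Qed.

Hypothesis N4 : (4 <= N)%N.
Hypothesis a_le : forall e, `|a e| <= 2 / x.

Let Nr : 0 < N%:R :> R.
Proof. by rewrite ltr0n; lia. Qed.

Let x_gt0 : 0 < x.
Proof. by rewrite sqrtr_gt0. Qed.

Let x2 : x ^+ 2 = N%:R.
Proof. by rewrite sqr_sqrtr. Qed.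

Let b := 2 / x.

Lemma sum_injectiveb_le k : \sum_(i : {ffun 'I_k -> 'I_N} | injectiveb i) (1 : R) <= N%:R ^+ k.
Proof.
rewrite sumr_const -natrX ler_nat.
by apply: leq_trans (max_card _) _; rewrite card_ffun !card_ord.
Qed.

Lemma sum_same_mult_le k (c : R) : (1 < k)%N -> 0 <= c ->
  \sum_(i : {ffun 'I_k -> 'I_N} | injectiveb i)
    \sum_(j : {ffun 'I_k -> 'I_N} | injectiveb j)
      (if same_mult i j then (\prod_(e in pairs N) (mult i e)`!)%:R * c else 0)
  <= N%:R ^+ k * ((2 * k%:R) * c).
Proof.
move=> k1 c0.
apply: (@le_trans _ _ (\sum_(i : {ffun 'I_k -> 'I_N} | injectiveb i) 1 * (2 * k%:R * c))).
  apply: ler_sum => i /injectiveP inji; rewrite mul1r.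
  rewrite -big_mkcondr sumr_const -[leLHS]mulr_natl mulrA ler_wpM2r//.
  have := card_same_mult k1 inji.
  rewrite -(ler_nat R) natrM -mul2n natrM; apply: le_trans.
  by rewrite ler_wpM2r// ler_nat; apply: subset_leq_card; apply/fintype.subsetP => j; rewrite inE.
by rewrite -mulr_suml ler_wpM2r ?sum_injectiveb_le// !mulr_ge0.
Qed.

(** Summing the three contributions: pairs with the same edges give the variance, at most [2 k] up
    to the shift, and [sum_shared] shows that all partial overlaps together still have size
    [1 / N]. *)
Lemma cycle_sum_cov_le k l : (1 < k)%N -> (1 < l)%N ->
  cycle_sum_pair_mean k l <= cycle_sum_mean k * cycle_sum_mean l +
    (if k == l then 2 * k%:R * (1 + b ^+ 2) ^+ k else 0) +
    overlap_const R k l * k.+1%:R ^+ l / N%:R.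
Proof.
move=> k1 l1.
pose S (i : {ffun 'I_k -> 'I_N}) (j : {ffun 'I_l -> 'I_N}) : R :=
  if same_mult i j then (\prod_(e in pairs N) (mult i e)`!)%:R * (1 + b ^+ 2) ^+ k else 0.
pose O (i : {ffun 'I_k -> 'I_N}) (j : {ffun 'I_l -> 'I_N}) : R :=
  overlap_const R k l / x ^+ (k + l) * N%:R ^+ (shared i j) / N%:R.
have xk m : 0 < x ^+ m by rewrite exprn_gt0.
have b2 : 0 <= 1 + b ^+ 2 by rewrite addr_ge0// sqr_ge0.
have SS : \sum_(i : {ffun 'I_k -> 'I_N} | injectiveb i) \sum_(j : {ffun 'I_l -> 'I_N} | injectiveb j) S i j <=
    x ^+ k * x ^+ l * (if k == l then 2 * k%:R * (1 + b ^+ 2) ^+ k else 0).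
  case: eqP => [kl|/eqP kl].
    rewrite /S {S O}; subst l; rewrite -expr2 exprAC x2.
    by apply: sum_same_mult_le => //; rewrite exprn_ge0.
  rewrite mulr0 big1// => i /injectiveP inji; rewrite big1// => j /injectiveP injj.
  rewrite /S ifF//; apply/negbTE; apply: contraNN kl => h.
  by apply/eqP; exact: same_mult_size h.
have OO : \sum_(i : {ffun 'I_k -> 'I_N} | injectiveb i) \sum_(j : {ffun 'I_l -> 'I_N} | injectiveb j) O i j <=
    x ^+ k * x ^+ l * (overlap_const R k l * k.+1%:R ^+ l / N%:R).
  pose c := overlap_const R k l / x ^+ (k + l) / N%:R.
  have c0 : 0 <= c by rewrite !mulr_ge0// ?invr_ge0// ?addr_ge0 ?exprn_ge0// ltW.
  apply: (@le_trans _ _ (\sum_(i : {ffun 'I_k -> 'I_N} | injectiveb i) 1 * (c * (k.+1%:R * N%:R) ^+ l))).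
    apply: ler_sum => i _; rewrite mul1r.
    apply: (@le_trans _ _ (c * (\sum_(j : {ffun 'I_l -> 'I_N} | injectiveb j) N ^ shared i j)%:R)).
      rewrite natr_sum mulr_sumr; apply: ler_sum => j _.
      by rewrite /O /c natrX mulrAC.
    by rewrite ler_wpM2l// -natrM -natrX ler_nat sum_shared.
  rewrite -mulr_suml; apply: (@le_trans _ _ (N%:R ^+ k * (c * (k.+1%:R * N%:R) ^+ l))).
    by rewrite ler_wpM2r ?sum_injectiveb_le// mulr_ge0// exprn_ge0// mulr_ge0.
  rewrite /c le_eqVlt; apply/orP; left; apply/eqP.
  rewrite exprMn -x2 -!exprM exprD !mul2n -!addnn !exprD.
  by field; rewrite !gt_eqF.
have M : \sum_(i : {ffun 'I_k -> 'I_N} | injectiveb i) \sum_(j : {ffun 'I_l -> 'I_N} | injectiveb j) cycle_pair_mean a i j <=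
    (\sum_(i : {ffun 'I_k -> 'I_N} | injectiveb i) cycle_mean a i) *
    (\sum_(j : {ffun 'I_l -> 'I_N} | injectiveb j) cycle_mean a j) +
    (\sum_(i : {ffun 'I_k -> 'I_N} | injectiveb i) \sum_(j : {ffun 'I_l -> 'I_N} | injectiveb j) S i j +
     \sum_(i : {ffun 'I_k -> 'I_N} | injectiveb i) \sum_(j : {ffun 'I_l -> 'I_N} | injectiveb j) O i j).
  rewrite mulr_suml -!big_split/=; apply: ler_sum => i /injectiveP inji.
  rewrite mulr_sumr -!big_split/=; apply: ler_sum => j /injectiveP injj.
  by rewrite addrA; exact: cycle_pair_cov_le.
rewrite /cycle_sum_pair_mean -invfM mulrC ler_pdivrMr ?mulr_gt0//.
apply: (le_trans M).
set B := if k == l then _ else _ in SS *.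
set C := _ / N%:R in OO *.
rewrite (_ : (_ + B + C) * _ = x ^+ k * x ^+ l * (cycle_sum_mean k * cycle_sum_mean l) +
  (x ^+ k * x ^+ l * B + x ^+ k * x ^+ l * C)); last by ring.
apply: lerD; last exact: lerD.
rewrite le_eqVlt; apply/orP; left; apply/eqP.
by rewrite /cycle_sum_mean; field; rewrite !gt_eqF.
Qed.

End means.

(** Without shift, Hermite orthogonality kills every pair with different multiplicities, so that
    counting rotations and reflections gives the bound without error term. *)
Lemma cycle_sum_second_moment k : (1 < k)%N -> (4 <= N)%N ->
  cycle_sum_pair_mean (fun=> 0) k k <= 2 * k%:R.
Proof.
move=> k1 N4.
have x_gt0 : 0 < x by rewrite sqrtr_gt0 ltr0n; lia.
have x2 : x ^+ 2 = N%:R by rewrite sqr_sqrtr.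
have xk : 0 < x ^+ k by rewrite exprn_gt0.
rewrite /cycle_sum_pair_mean -invfM mulrC ler_pdivrMr ?mulr_gt0//.
rewrite -expr2 exprAC x2 mulrC.
apply: le_trans (_ : _ <= N%:R ^+ k * (2 * k%:R * 1)) _; last by rewrite mulr1.
apply: le_trans (sum_same_mult_le k1 ler01).
apply: ler_sum => i /injectiveP inji; apply: ler_sum => j /injectiveP injj.
have h0 m n : (m <= 2)%N -> (n <= 2)%N -> hermite_cov (0 : R) m n = if m == n then m`!%:R else 0.
  case: m n => [|[|[|m]]] [|[|[|n]]]//= _ _; rewrite ?expr0n/= ?mulr0 ?addr0 ?add0r//.
case: ifPn => [/same_multP ij|nij].
  rewrite mulr1 natr_prod le_eqVlt; apply/orP; left; apply/eqP.
  by apply: eq_bigr => e _; rewrite h0 ?mult_le2// ij eqxx.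
have [e eP ije] : exists2 e, e \in pairs N & mult i e != mult j e.
  apply: contrapT => nex; move/negP: nij; apply; apply/same_multP => e.
  have [eP|eP] := boolP (e \in pairs N); last by rewrite !mult_notin_pairs.
  by apply/eqP; apply: contrapT => /negP h; apply: nex; exists e.
by rewrite /cycle_pair_mean (bigD1 e)//= h0 ?mult_le2// (negbTE ije) mul0r.
Qed.

End cycle_sums.

Lemma sum_pairs_sym (R : realType) N (F : 'I_N -> 'I_N -> R) :
  (forall u v, F u v = F v u) ->
  \sum_u \sum_v F u v = 2 * (\sum_(e in pairs N) F e.1 e.2) + \sum_u F u u.
Proof.
move=> Fsym.
have S (Q : rel 'I_N) : \sum_u \sum_(v | Q u v) F u v =
    \sum_(e : 'I_N * 'I_N | Q e.1 e.2) F e.1 e.2.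
  by rewrite pair_big_dep.
have lt : \sum_(u < N) \sum_(v < N | (u < v)%N) F u v = \sum_(e in pairs N) F e.1 e.2.
  by rewrite (S (fun u v : 'I_N => u < v)%N); apply: eq_bigl => e; rewrite inE.
have gt : \sum_(u < N) \sum_(v < N | (v < u)%N) F u v = \sum_(e in pairs N) F e.1 e.2.
  rewrite -lt (exchange_big_dep predT)//=; apply: eq_bigr => u _.
  by apply: eq_bigr => v _; rewrite Fsym.
rewrite mulr2n mulrDl mul1r -{1}lt -gt -!big_split/=; apply: eq_bigr => u _.
rewrite (bigD1 u)//= addrC; congr (_ + _).
rewrite (bigID (fun v : 'I_N => (u < v)%N))/=; congr (_ + _).
  apply: eq_bigl => v; rewrite andb_idl//.
  by move=> uv; rewrite -val_eqE/= gtn_eqF.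
by apply: eq_bigl => v; rewrite -val_eqE/=; lia.
Qed.

(** * Tilted means for a pair of spin configurations *)

Section tilted_pair.
Context d (T : measurableType d) (R : realType) (P : probability T R).
Variables (N : nat) (g : 'I_N * 'I_N -> {RV P >-> R}).
Hypothesis g_indep : mutually_independent (pairs N) g.
Hypothesis g_normal : forall e, e \in pairs N -> normal_mgf P (g e).
Hypothesis N4 : (4 <= N)%N.
Variables (sigma tau : 'I_N -> R) (s : R).
Hypothesis sigma2 : forall u, sigma u * sigma u = 1.
Hypothesis tau2 : forall u, tau u * tau u = 1.
Hypotheses (s_ge0 : 0 <= s) (s_le1 : s <= 1).

Let x : R := Num.sqrt N%:R.

Let Nr : 0 < N%:R :> R.
Proof. by rewrite ltr0n; lia. Qed.

Let x_gt0 : 0 < x.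
Proof. by rewrite sqrtr_gt0. Qed.

Let x2 : x ^+ 2 = N%:R.
Proof. by rewrite sqr_sqrtr. Qed.

(** The shift that completing the square produces in the product of the Gibbs weights of [sigma] and
    [tau]. *)
Definition pair_tilt (e : 'I_N * 'I_N) : R :=
  s / x * (sigma e.1 * sigma e.2 + tau e.1 * tau e.2).

Let a := pair_tilt.

Let sn1 u : `|sigma u| = 1. Proof. exact: spin_norm1. Qed.
Let tn1 u : `|tau u| = 1. Proof. exact: spin_norm1. Qed.

Lemma pair_tilt_le e : `|pair_tilt e| <= 2 / x.
Proof.
rewrite /pair_tilt normrM (_ : `|s / x| = s / x); last first.
  by rewrite ger0_norm// divr_ge0// ltW.
rewrite mulrAC ler_wpM2r// ?invr_ge0 ?(ltW x_gt0)//.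
have h : `|sigma e.1 * sigma e.2 + tau e.1 * tau e.2| <= 2.
  by apply: (le_trans (ler_normD _ _)); rewrite !normrM !sn1 !tn1; lra.
by rewrite -[leRHS]mul1r ler_pM.
Qed.

Let O := overlap_sum sigma tau.

Let edge_sym (f : 'I_N -> R) u v : f (edge u v).1 * f (edge u v).2 = f u * f v.
Proof. by rewrite /edge; case: ifP => //= _; rewrite mulrC. Qed.

Let cE k (i : {ffun 'I_k -> 'I_N}) p :
  a (cedge i p) = s / x * (1 * (sigma (i p) * sigma (i (ordS p))) +
                           1 * (tau (i p) * tau (i (ordS p)))).
Proof. by rewrite /a /pair_tilt /cedge !edge_sym !mul1r. Qed.

Definition cycle_err k : R := 2 ^+ k * (`|O| + (k ^ 2)%:R) / N%:R.

Let scale_err k (c S M : R) : (0 < k)%N -> 0 <= c <= 1 ->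
  `|S - N%:R ^+ k * M| * N%:R <= 2 ^+ k * N%:R ^+ k * (`|O| + (k ^ 2)%:R) ->
  `|(N%:R ^+ k)^-1 * c * S - c * M| <= cycle_err k.
Proof.
move=> k0 /andP[c0 c1] h.
have Nk : 0 < N%:R ^+ k :> R by rewrite exprn_gt0.
have -> : (N%:R ^+ k)^-1 * c * S - c * M = c * ((N%:R ^+ k)^-1 * (S - N%:R ^+ k * M)).
  by field; rewrite gt_eqF.
rewrite normrM ger0_norm//; apply: (@le_trans _ _ (`|(N%:R ^+ k)^-1 * (S - N%:R ^+ k * M)|)).
  by rewrite ler_piMl.
rewrite normrM (ger0_norm (_ : 0 <= (N%:R ^+ k)^-1)) ?invr_ge0 ?(ltW Nk)//.
rewrite mulrC ler_pdivrMr// /cycle_err mulrAC ler_pdivlMr//.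
by rewrite [leRHS]mulrAC.
Qed.

(** Walks that are [sigma] throughout and walks that are [tau] throughout contribute [s ^ k]
    each. *)
Lemma cycle_sum_mean_pair k : (1 < k)%N ->
  `|cycle_sum_mean a k - 2 * s ^+ k| <= cycle_err k.
Proof.
move=> k1.
have -> : cycle_sum_mean a k = (N%:R ^+ k)^-1 * s ^+ k *
    \sum_(i : {ffun 'I_k -> 'I_N} | injectiveb i) \prod_p
      (1 * (sigma (i p) * sigma (i (ordS p))) + 1 * (tau (i p) * tau (i (ordS p)))).
  rewrite /cycle_sum_mean -/x.
  rewrite (eq_bigr (fun i : {ffun 'I_k -> 'I_N} => (s / x) ^+ k * \prod_p
      (1 * (sigma (i p) * sigma (i (ordS p))) + 1 * (tau (i p) * tau (i (ordS p)))))).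
    rewrite -mulr_sumr mulrA; congr (_ * _).
    by rewrite -x2 -exprM mul2n -addnn exprD exprMn exprVn; field; rewrite expf_neq0// gt_eqF.
  move=> i _; apply: etrans (eq_bigr _ (fun p _ => cE i p)) _.
  by rewrite big_split/= prodr_const card_ord.
rewrite [2 * _]mulrC; apply: scale_err => //; first lia.
  by rewrite exprn_ge0// exprn_ile1.
have := @sum_inj_rank_two_cycle R N sigma tau sigma2 tau2 k (fun=> 1) (fun=> 1).
have -> : \prod_(p < k) (fun=> 1 : R) p = 1 by rewrite big1.
by apply; rewrite ?normr1// ltnW.
Qed.

Definition noise_sum (f : 'I_N -> R) w : R :=
  x^-1 * \sum_(e in pairs N) f e.1 * f e.2 * noise g a e w.

Lemma has_tilted_mean_noise_sum f : has_tilted_mean g a (noise_sum f) 0.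
Proof.
rewrite -[X in has_tilted_mean _ _ _ X](mulr0 x^-1); apply: has_tilted_meanZ.
have := @has_tilted_mean_sum _ _ _ _ _ g a _ (index_enum _) (mem (pairs N))
  (fun e w => f e.1 * f e.2 * noise g a e w) (fun e => f e.1 * f e.2 * 0).
rewrite big1; last by move=> e _; rewrite mulr0.
by apply => e eP; apply: has_tilted_meanZ; exact: has_tilted_mean_noise.
Qed.

Lemma has_tilted_mean_noise_sum2 :
  has_tilted_mean g a (fun w => noise_sum sigma w * noise_sum tau w)
    ((O ^+ 2 / N%:R - 1) / 2).
Proof.
have := @has_tilted_meanZ _ _ _ _ _ g a (N%:R^-1)
  (fun w => \sum_(e in pairs N) \sum_(e' in pairs N)
     (sigma e.1 * sigma e.2) * (tau e'.1 * tau e'.2) * (noise g a e w * noise g a e' w))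
  (\sum_(e in pairs N) \sum_(e' in pairs N)
     (sigma e.1 * sigma e.2) * (tau e'.1 * tau e'.2) * (e == e')%:R).
move=> H.
have E : N%:R^-1 * (\sum_(e in pairs N) \sum_(e' in pairs N)
     (sigma e.1 * sigma e.2) * (tau e'.1 * tau e'.2) * (e == e')%:R)
   = (O ^+ 2 / N%:R - 1) / 2.
  have -> : \sum_(e in pairs N) \sum_(e' in pairs N)
     (sigma e.1 * sigma e.2) * (tau e'.1 * tau e'.2) * (e == e')%:R =
    \sum_(e in pairs N) (sigma e.1 * tau e.1) * (sigma e.2 * tau e.2).
    apply: eq_bigr => e eP; rewrite (bigD1 e)//= eqxx mulr1 big1 ?addr0.
      by rewrite mulrACA.
    by move=> e' /andP[_ /negbTE]; rewrite eq_sym => ->; rewrite mulr0.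
  have := @sum_pairs_sym R N (fun u v => (sigma u * tau u) * (sigma v * tau v))
    (fun u v => mulrC _ _).
  rewrite (eq_bigr (fun u => (sigma u * tau u) * O)); last by move=> u _; rewrite mulr_sumr.
  rewrite -mulr_suml -/O => h.
  have h1 : \sum_u (sigma u * tau u) * (sigma u * tau u) = N%:R.
    rewrite (eq_bigr (fun=> 1)) ?sumr_const ?card_ord// => u _.
    by rewrite mulrACA sigma2 tau2 mulr1.
  rewrite h1 in h.
  have -> : \sum_(e in pairs N) sigma e.1 * tau e.1 * (sigma e.2 * tau e.2) = (O * O - N%:R) / 2.
    by rewrite h; field.
  by field; rewrite gt_eqF.
rewrite -E; apply: eq_has_tilted_mean (H _) => [w|].
  rewrite /noise_sum mulrACA -invfM -expr2 x2; congr (_ * _).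
  rewrite mulr_suml; apply: eq_bigr => e _; rewrite mulr_sumr.
  by apply: eq_bigr => e' _; rewrite mulrACA.
apply: has_tilted_mean_sum => e eP; apply: has_tilted_mean_sum => e' e'P.
by apply: has_tilted_meanZ; exact: has_tilted_mean_noise2.
Qed.

Definition noise_cycle_mean (f : 'I_N -> R) k : R :=
  x^-1 * (x ^+ k)^-1 * \sum_(i : {ffun 'I_k -> 'I_N} | injectiveb i) \sum_(e in pairs N)
    f e.1 * f e.2 * \sum_(p < k | cedge i p == e) \prod_(q < k | q != p) a (cedge i q).

Lemma has_tilted_mean_noise_sum_cycle f k : (1 < k)%N ->
  has_tilted_mean g a (fun w => noise_sum f w * cycle_sum g k w) (noise_cycle_mean f k).
Proof.
move=> k1.
apply: (@eq_has_tilted_mean _ _ _ _ _ _ _ (fun w => x^-1 * (x ^+ k)^-1 *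
   \sum_(i : {ffun 'I_k -> 'I_N} | injectiveb i) \sum_(e in pairs N)
    f e.1 * f e.2 * (noise g a e w * cycle_weight g i w))).
  move=> w; rewrite /noise_sum /cycle_sum mulrACA; congr (_ * _).
  rewrite mulr_sumr; apply: eq_bigr => i _; rewrite mulr_suml; apply: eq_bigr => e _.
  by rewrite mulrA.
apply: has_tilted_meanZ; apply: has_tilted_mean_sum => i /injectiveP inji.
apply: has_tilted_mean_sum => e eP; apply: has_tilted_meanZ.
exact: has_tilted_mean_noise_cycle.
Qed.

(** The noise deletes one of the [k] steps and puts the spin [f] in its place. This step then
    selects the constant choice [f] alone, which leaves [s ^ (k - 1)] once instead of twice. *)
Lemma noise_cycle_mean_pair (b : bool) k : (1 < k)%N ->
  `|noise_cycle_mean (if b then sigma else tau) k - k%:R * s ^+ k.-1| <= k%:R * cycle_err k.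
Proof.
move=> k1; set f := if b then sigma else tau.
(* At the deleted step [p] the coefficient of the spin other than [f] is zero. *)
pose A (p q : 'I_k) : R := if b || (q != p) then 1 else 0.
pose B (p q : 'I_k) : R := if ~~ b || (q != p) then 1 else 0.
pose S p := \sum_(i : {ffun 'I_k -> 'I_N} | injectiveb i) \prod_q
      (A p q * (sigma (i q) * sigma (i (ordS q))) + B p q * (tau (i q) * tau (i (ordS q)))).
have -> : noise_cycle_mean f k = \sum_p ((N%:R ^+ k)^-1 * s ^+ k.-1 * S p).
  rewrite -mulr_sumr /S exchange_big/= /noise_cycle_mean.
  rewrite (eq_bigr (fun i : {ffun 'I_k -> 'I_N} => (s / x) ^+ k.-1 * \sum_p \prod_q
      (A p q * (sigma (i q) * sigma (i (ordS q))) + B p q * (tau (i q) * tau (i (ordS q)))))).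
    rewrite -mulr_sumr mulrA; congr (_ * _).
    rewrite -x2 -exprM mul2n -addnn exprD exprMn exprVn -[in LHS](prednK (ltnW k1)).
    rewrite -[in RHS](prednK (ltnW k1)) exprS /=.
    by field; rewrite expf_neq0// gt_eqF.
  move=> i /injectiveP inji.
  transitivity (\sum_(e in pairs N) \sum_(p < k | cedge i p == e)
      f (cedge i p).1 * f (cedge i p).2 * \prod_(q < k | q != p) a (cedge i q)).
    apply: eq_bigr => e _; rewrite mulr_sumr; apply: eq_bigr => p /eqP ->//.
  rewrite -(partition_big (cedge i) (mem (pairs N)) (P := xpredT)) => [|p _]; last exact: cedge_pairs.
  rewrite mulr_sumr; apply: eq_bigr => p _.
  rewrite [in RHS](bigD1 p)//= mulrCA; congr (_ * _).
    rewrite /A /B eqxx /= !orbF /f; case: (b) => /=.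
      by rewrite mul1r mul0r addr0 edge_sym.
    by rewrite mul1r mul0r add0r edge_sym.
  rewrite (_ : (s / x) ^+ k.-1 = \prod_(q < k | q != p) (s / x)); last first.
    by rewrite prodr_const cardC1 card_ord.
  rewrite -big_split/=; apply: eq_bigr => q qp.
  by rewrite /A /B qp !orbT cE.
rewrite (_ : k%:R * s ^+ k.-1 = \sum_(p < k) s ^+ k.-1 * 1); last first.
  by rewrite sumr_const card_ord mulr1 mulr_natl.
rewrite -sumrB; apply: (le_trans (ler_norm_sum _ _ _)).
rewrite (_ : k%:R * cycle_err k = \sum_(p < k) cycle_err k); last first.
  by rewrite sumr_const card_ord mulr_natl.
apply: ler_sum => p _; apply: scale_err; first lia.
  by rewrite exprn_ge0// exprn_ile1.
have := @sum_inj_rank_two_cycle R N sigma tau sigma2 tau2 k (A p) (B p) (ltnW k1).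
have -> : \prod_q A p q + \prod_q B p q = 1.
  rewrite /A /B; case: (b) => /=.
    by rewrite big1// (bigD1 p)//= eqxx mul0r addr0.
  by rewrite (bigD1 p)//= eqxx mul0r add0r big1.
apply.
  by move=> q; rewrite /A; case: ifP; rewrite ?normr1 ?normr0.
by move=> q; rewrite /B; case: ifP; rewrite ?normr1 ?normr0.
Qed.

End tilted_pair.

Section tilted_pair_bound.
Variable (R : realType) (n : nat).

(** Leading term of the tilted mean of [cycle_drift], the cycle sums having mean about [2 s ^ k]. *)
Definition odd_sum (s : R) := \sum_(k < n | (1 < k)%N) s ^+ (k.*2).-1.

(** Half of it is the leading term both of the variance bound for [cycle_drift] and of its
    covariance with each noise sum. One variance and two covariances of opposite sign leave
    [- diag_sum / 2] in [limit_form]. *)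
Definition diag_sum (s : R) := \sum_(k < n | (1 < k)%N) k%:R * s ^+ (k.-1).*2.

(* Limiting value of the tilted mean of the product of the two centered
   derivatives, as a function of [q = O ^+ 2 / N], [O] the overlap sum. *)
Definition limit_form (s q : R) :=
  (q - 1) / 2 + (s * (q - 1) - odd_sum s) ^+ 2 / 4 - diag_sum s / 2.

(** [K1] collects the errors in the means, from [cycle_err], and [K2] those in the covariances, from
    [cycle_sum_cov_le]. The factor [n] bounds [odd_sum]. *)
Definition error_const : R :=
  let K1 := \sum_(k < n | (1 < k)%N) k%:R * 2 ^+ k * (1 + (k ^ 2)%:R) in
  let K2 := \sum_(k < n | (1 < k)%N) 2 * k%:R * 3 ^+ k +
            \sum_(k < n | (1 < k)%N) \sum_(l < n | (1 < l)%N)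
              overlap_const R k l * k.+1%:R ^+ l in
  (3 + n%:R) * K1 + K2 + K1 ^+ 2.

Lemma expr1D_le k (y : R) : 0 <= y <= 1 -> (1 + y) ^+ k <= 1 + 3 ^+ k * y.
Proof.
move=> /andP[y0 y1]; elim: k => [|k ih]; first by rewrite !expr0; lra.
rewrite exprSr; apply: (@le_trans _ _ ((1 + 3 ^+ k * y) * (1 + y))).
  by apply: ler_wpM2r => //; lra.
rewrite exprS; have : 1 <= 3 ^+ k :> R by apply: exprn_ege1; lra.
set z := 3 ^+ k => z1.
have h1 : 0 <= (z - 1) * y by apply: mulr_ge0; lra.
have h2 : 0 <= z * y * (1 - y) by apply: mulr_ge0; [apply: mulr_ge0|]; lra.
nra.
Qed.

Variables (d : measure_display) (T : measurableType d) (P : probability T R).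
Variables (N : nat) (g : 'I_N * 'I_N -> {RV P >-> R}).
Hypothesis g_indep : mutually_independent (pairs N) g.
Hypothesis g_normal : forall e, e \in pairs N -> normal_mgf P (g e).
Hypothesis N4 : (4 <= N)%N.
Variables (sigma tau : 'I_N -> R) (s : R).
Hypothesis sigma2 : forall u, sigma u * sigma u = 1.
Hypothesis tau2 : forall u, tau u * tau u = 1.
Hypotheses (s_ge0 : 0 <= s) (s_le1 : s <= 1).

Let x : R := Num.sqrt N%:R.
Let a := pair_tilt sigma tau s.
Let O := overlap_sum sigma tau.
Let q := O ^+ 2 / N%:R.

Definition cycle_drift w := \sum_(k < n | (1 < k)%N) s ^+ k.-1 * cycle_sum g k w / 2.

(** The logarithmic derivative of the weight of [f] minus that of the cycle exponent, rewritten
    around the tilted mean of the energy; [centered_derivativeE] is the identification. *)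
Definition centered_derivative (f : 'I_N -> R) w :=
  noise_sum g sigma tau s f w + (s * (q - 1) / 2 + odd_sum s / 2) - cycle_drift w.

Let Nr : 0 < N%:R :> R.
Proof. by rewrite ltr0n; lia. Qed.

Let x_gt0 : 0 < x.
Proof. by rewrite sqrtr_gt0. Qed.

Let x2 : x ^+ 2 = N%:R.
Proof. by rewrite sqr_sqrtr. Qed.

(** A common majorant, in terms of [q], of the two sizes of error [1 / N] and [|O| / N]. *)
Let y := (1 + q) / x.

Let q_ge0 : 0 <= q.
Proof. by rewrite divr_ge0 ?sqr_ge0// ltW. Qed.

Let x_ge1 : 1 <= x.
Proof. by rewrite -sqrtr1 ler_wsqrtr// ler1n; lia. Qed.

Let y_ge0 : 0 <= y.
Proof. by apply: divr_ge0; [rewrite addr_ge0|exact: ltW]. Qed.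

Let invN_le : N%:R^-1 <= y.
Proof.
rewrite /y -x2 expr2 invfM ler_wpM2r ?invr_ge0 ?(ltW x_gt0)//.
by apply: (@le_trans _ _ 1); rewrite ?invf_le1// lerDl.
Qed.

Let absO_le : `|O| / N%:R <= y.
Proof.
have -> : `|O| / N%:R = (`|O| / x) / x by rewrite -x2 expr2 invfM mulrA.
rewrite /y ler_wpM2r ?invr_ge0 ?(ltW x_gt0)//.
have -> : q = (`|O| / x) ^+ 2 by rewrite /q -x2 exprMn exprVn real_normK ?num_real.
set z := `|O| / x; have := sqr_ge0 (z - 1); have := sqr_ge0 z.
by rewrite !expr2; nra.
Qed.

Let b01 : 0 <= (2 / x) ^+ 2 <= 1.
Proof. by rewrite sqr_ge0/= exprMn exprVn x2 ler_pdivrMr// mul1r -natrX ler_nat. Qed.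

Let cycle_err_le k : cycle_err sigma tau k <= 2 ^+ k * (1 + (k ^ 2)%:R) * y.
Proof.
rewrite /cycle_err -/O -!mulrA ler_wpM2l ?exprn_ge0// mulrDl [leRHS]mulrDl mul1r.
by apply: lerD => //; rewrite ler_wpM2l.
Qed.

(** Expand the product into noise, constant and drift. Only an upper bound is needed, because these
    values will be averaged into a second moment. *)
Lemma tilted_pair_bound : exists v,
  has_tilted_mean g a
    (fun w => centered_derivative sigma w * centered_derivative tau w) v /\
  v <= limit_form s q + error_const * ((1 + q) ^+ 2 / x).
Proof.
pose u := s * (q - 1) / 2 + odd_sum s / 2.
pose A f w := noise_sum g sigma tau s f w.
pose B w := cycle_drift w.
pose LB := \sum_(k < n | (1 < k)%N) s ^+ k.-1 * cycle_sum_mean a k / 2.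
pose LAB f := \sum_(k < n | (1 < k)%N) s ^+ k.-1 * noise_cycle_mean sigma tau s f k / 2.
pose LBB := \sum_(k < n | (1 < k)%N) \sum_(l < n | (1 < l)%N)
  s ^+ k.-1 * s ^+ l.-1 / 4 * cycle_sum_pair_mean a k l.
have hB : has_tilted_mean g a B LB.
  apply: has_tilted_mean_sum => k k1.
  rewrite mulrAC; apply: eq_has_tilted_mean (has_tilted_meanZ _ (has_tilted_mean_cycle_sum g_indep g_normal a k1)) => w.
  by rewrite mulrAC.
have hAB f : has_tilted_mean g a (fun w => A f w * B w) (LAB f).
  apply: (@eq_has_tilted_mean _ _ _ _ _ _ _ (fun w => \sum_(k < n | (1 < k)%N)
     s ^+ k.-1 / 2 * (noise_sum g sigma tau s f w * cycle_sum g k w))).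
    by move=> w; rewrite mulr_sumr; apply: eq_bigr => k _; rewrite /A; ring.
  apply: has_tilted_mean_sum => k k1; rewrite mulrAC; apply: has_tilted_meanZ.
  exact: has_tilted_mean_noise_sum_cycle.
have hBB : has_tilted_mean g a (fun w => B w * B w) LBB.
  apply: (@eq_has_tilted_mean _ _ _ _ _ _ _ (fun w => \sum_(k < n | (1 < k)%N)
     \sum_(l < n | (1 < l)%N) s ^+ k.-1 * s ^+ l.-1 / 4 * (cycle_sum g k w * cycle_sum g l w))).
    move=> w; rewrite mulr_suml; apply: eq_bigr => k _; rewrite mulr_sumr.
    by apply: eq_bigr => l _; field.
  apply: has_tilted_mean_sum => k k1; apply: has_tilted_mean_sum => l l1.
  by apply: has_tilted_meanZ; exact: has_tilted_mean_cycle_sum2.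
have hA f : has_tilted_mean g a (A f) 0 by exact: has_tilted_mean_noise_sum.
have hAA := @has_tilted_mean_noise_sum2 _ _ _ _ _ _ g_indep g_normal N4 sigma tau s sigma2 tau2 s_ge0 s_le1.
(* The noise sums are centered, so products of a constant with one of them drop out. *)
exists ((q - 1) / 2 - LAB sigma - LAB tau + (u ^+ 2 - 2 * u * LB + LBB)).
split.
  have hcst := has_tilted_mean_cst g_indep g_normal a (u ^+ 2).
  have := has_tilted_meanD hAA (has_tilted_meanD (has_tilted_meanZ (-1) (hAB sigma))
    (has_tilted_meanD (has_tilted_meanZ (-1) (hAB tau))
    (has_tilted_meanD (has_tilted_meanZ u (hA sigma)) (has_tilted_meanD (has_tilted_meanZ u (hA tau))
    (has_tilted_meanD hcst (has_tilted_meanD (has_tilted_meanZ (- 2 * u) hB) hBB)))))).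
  set v := (X in has_tilted_mean _ _ _ X) => hv.
  have -> : (q - 1) / 2 - LAB sigma - LAB tau + (u ^+ 2 - 2 * u * LB + LBB) = v.
    by rewrite /v -/O -/q; ring.
  apply: eq_has_tilted_mean hv => w; rewrite /centered_derivative -/(A sigma w) -/(A tau w) -/u -/(B w).
  by ring.
pose K1 : R := \sum_(k < n | (1 < k)%N) k%:R * 2 ^+ k * (1 + (k ^ 2)%:R).
pose K2 : R := \sum_(k < n | (1 < k)%N) 2 * k%:R * 3 ^+ k +
            \sum_(k < n | (1 < k)%N) \sum_(l < n | (1 < l)%N)
              overlap_const R k l * k.+1%:R ^+ l.
have s01 k : 0 <= s ^+ k <= 1 by rewrite exprn_ge0// exprn_ile1.
(* These covariances enter with a minus sign, so a lower bound is enough. *)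
have LAB_ge (b : bool) : diag_sum s / 2 - K1 * y / 2 <= LAB (if b then sigma else tau).
  rewrite /diag_sum /K1 !mulr_suml -sumrB; apply: ler_sum => k k1.
  have h := noise_cycle_mean_pair N4 sigma2 tau2 s_ge0 s_le1 b k1.
  have h2 := ler_wpM2l (ler0n R k) (cycle_err_le k).
  rewrite -[k.-1.*2]addnn exprD; move: h h2 (s01 k.-1) => /=.
  set Z := noise_cycle_mean _ _ _ _ _; set E := cycle_err _ _ _; set S := s ^+ k.-1.
  set C := 2 ^+ k * _ * y; rewrite ler_norml => /andP[h1 _] h2 /andP[S0 S1].
  have h3 : S * (k%:R * S - k%:R * C) <= S * Z by apply: ler_wpM2l => //; lra.
  have h4 : S * (k%:R * C) <= k%:R * C.
    have C0 : 0 <= C by apply: mulr_ge0 => //; apply: mulr_ge0 => //; exact: exprn_ge0.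
    by apply: ler_piMl => //; exact: mulr_ge0.
  rewrite (_ : k%:R * 2 ^+ k * (1 + (k ^ 2)%:R) * y = k%:R * C); last by rewrite /C; ring.
  nra.
have LB_near : `|LB - odd_sum s| <= K1 * y / 2.
  rewrite /LB /odd_sum -sumrB /K1 !mulr_suml; apply: (le_trans (ler_norm_sum _ _ _)).
  apply: ler_sum => k k1.
  have h := cycle_sum_mean_pair N4 sigma2 tau2 s_ge0 s_le1 k1.
  have -> : s ^+ k.-1 * cycle_sum_mean a k / 2 - s ^+ (k.*2).-1 =
      s ^+ k.-1 * (cycle_sum_mean a k - 2 * s ^+ k) / 2.
    have -> : (k.*2).-1 = (k.-1 + k)%N by case: (k : nat) k1 => // k' _; rewrite doubleS /= -addnn addnS.
    by rewrite exprD; field.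
  have /andP[S0 S1] := s01 k.-1.
  rewrite !normrM (ger0_norm S0) (ger0_norm (_ : 0 <= 2^-1))// ler_wpM2r//.
  apply: (@le_trans _ _ (cycle_err sigma tau k)).
    by apply: le_trans h; rewrite ler_piMl.
  apply: (le_trans (cycle_err_le k)); rewrite ler_wpM2r// ler_wpM2r//.
  by rewrite ler_peMl ?exprn_ge0// ler1n ltnW.
have LBB_le : LBB <= LB ^+ 2 + diag_sum s / 2 + K2 * y.
  have step k l : (1 < k)%N -> (1 < l)%N ->
     s ^+ k.-1 * s ^+ l.-1 / 4 * cycle_sum_pair_mean a k l <=
     (s ^+ k.-1 * cycle_sum_mean a k / 2) * (s ^+ l.-1 * cycle_sum_mean a l / 2) +
     ((if k == l then s ^+ (k.-1).*2 * k%:R / 2 + 2 * k%:R * 3 ^+ k * y else 0) +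
     overlap_const R k l * k.+1%:R ^+ l * y).
    move=> k1 l1.
    have h := cycle_sum_cov_le N4 (pair_tilt_le N4 sigma2 tau2 s_ge0 s_le1) k1 l1.
    have /andP[S0 S1] := s01 k.-1; have /andP[S0' S1'] := s01 l.-1.
    set S := s ^+ k.-1 in S0 S1 *; set S' := s ^+ l.-1 in S0' S1' *.
    have SS0 : 0 <= S * S' / 4 by rewrite divr_ge0// mulr_ge0.
    have SS1 : S * S' / 4 <= 1 by have := ler_pM S0 S0' S1 S1'; rewrite mulr1; lra.
    apply: (le_trans (ler_wpM2l SS0 h)).
    rewrite -[X in _ * X]addrA [leLHS]mulrDr; apply: lerD.
      by rewrite le_eqVlt; apply/orP; left; apply/eqP; field.
    rewrite mulrDr; apply: lerD; last first.
      apply: (@le_trans _ _ (overlap_const R k l * k.+1%:R ^+ l / N%:R)).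
        by rewrite ler_piMl// !mulr_ge0// ?exprn_ge0// ?addr_ge0 ?exprn_ge0// invr_ge0 ltW.
      by rewrite ler_wpM2l// !mulr_ge0// ?exprn_ge0// ?addr_ge0 ?exprn_ge0.
    case: eqP => [kl|_]; last by rewrite mulr0.
    have -> : S' = S by rewrite /S' -kl.
    have hb := expr1D_le k b01.
    have bE : (2 / x) ^+ 2 = 4 / N%:R by rewrite exprMn exprVn x2 -natrX.
    rewrite bE in hb *.
    have N1 : N%:R^-1 * 3 ^+ k <= y * 3 ^+ k by rewrite ler_wpM2r ?exprn_ge0.
    have S20 : 0 <= S * S <= 1 by rewrite mulr_ge0//= mulr_ile1.
    have k0 : 0 <= k%:R :> R by [].
    rewrite -[(k.-1).*2]addnn exprD -/S.
    set W := (1 + _) ^+ k in hb *.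
    have h1 : W <= 1 + 4 * (y * 3 ^+ k).
      by apply: (le_trans hb); rewrite (_ : 3 ^+ k * (4 / N%:R) = 4 * (N%:R^-1 * 3 ^+ k)); [lra|ring].
    have h2 : S * S * k%:R * W <= S * S * k%:R * (1 + 4 * (y * 3 ^+ k)).
      by apply: ler_wpM2l => //; rewrite mulr_ge0//; case/andP: S20.
    have h3 : S * S * (k%:R * (y * 3 ^+ k)) <= k%:R * (y * 3 ^+ k).
      case/andP: S20 => ? ?; apply: ler_piMl => //; apply: mulr_ge0 => //.
      by apply: mulr_ge0 => //; exact: exprn_ge0.
    nra.
  have -> : LB ^+ 2 + diag_sum s / 2 + K2 * y = 
     \sum_(k < n | (1 < k)%N) \sum_(l < n | (1 < l)%N)
     ((s ^+ k.-1 * cycle_sum_mean a k / 2) * (s ^+ l.-1 * cycle_sum_mean a l / 2) +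
     ((if k == l then s ^+ (k.-1).*2 * k%:R / 2 + 2 * k%:R * 3 ^+ k * y else 0) +
     overlap_const R k l * k.+1%:R ^+ l * y)).
    rewrite (eq_bigr (fun k : 'I_n =>
      \sum_(l < n | (1 < l)%N)
        (s ^+ k.-1 * cycle_sum_mean a k / 2) * (s ^+ l.-1 * cycle_sum_mean a l / 2) +
      ((s ^+ (k.-1).*2 * k%:R / 2 + 2 * k%:R * 3 ^+ k * y) +
       \sum_(l < n | (1 < l)%N) overlap_const R k l * k.+1%:R ^+ l * y))); last first.
      move=> k k1; rewrite big_split/=; congr (_ + _).
      rewrite big_split/=; congr (_ + _).
      rewrite (bigD1 k)//= eqxx big1 ?addr0// => l /andP[_ /negbTE].
      by rewrite eq_sym => ->.
    rewrite !big_split/=.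
    rewrite /K2 mulrDl !mulr_suml expr2 -!addrA; congr (_ + _).
      by rewrite mulr_suml; apply: eq_bigr => k _; rewrite mulr_sumr.
    congr (_ + (_ + _)); first by apply: eq_bigr => k _; rewrite [k%:R * _]mulrC.
    by apply: eq_bigr => k _; rewrite mulr_suml.
  apply: ler_sum => k k1; apply: ler_sum => l l1; exact: step.
have os : 0 <= odd_sum s <= n%:R.
  rewrite sumr_ge0/=; last by move=> k _; case/andP: (s01 (k.*2).-1).
  apply: (@le_trans _ _ (\sum_(k < n) 1)); last by rewrite sumr_const card_ord.
  rewrite /odd_sum big_mkcond; apply: ler_sum => k _; case: ifP => _ //.
  by case/andP: (s01 (k.*2).-1).
have K10 : 0 <= K1 by rewrite sumr_ge0// => k _; rewrite !mulr_ge0// ?exprn_ge0.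
have K20 : 0 <= K2.
  rewrite addr_ge0// ?sumr_ge0// => k _; rewrite ?mulr_ge0// ?exprn_ge0//.
  rewrite sumr_ge0// => l _.
  by rewrite /overlap_const !mulr_ge0// ?addr_ge0 ?exprn_ge0.
pose Y := (1 + q) ^+ 2 / x.
have yY : y <= Y.
  rewrite /y /Y ler_wpM2r ?invr_ge0 ?(ltW x_gt0)// expr2 ler_peMr//; first by rewrite addr_ge0.
  by rewrite lerDl.
have qyY : (1 + q) * y = Y by rewrite /y /Y expr2 mulrA.
have yyY : y ^+ 2 <= Y.
  rewrite /y /Y exprMn ler_wpM2l ?sqr_ge0// expr2 ler_piMr ?invr_ge0 ?(ltW x_gt0)//.
  by rewrite invf_le1.
have := LAB_ge true; have := LAB_ge false; rewrite /=.
rewrite -/Y /limit_form /error_const -/K1 -/K2.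
move: os LB_near LBB_le; set os := odd_sum s; set ds := diag_sum s.
move=> /andP[os0 osn] LBn LBBl hs ht.
(* With [LB] replaced by its leading term [os], [u - LB] becomes [p / 2]; [D] is the error of this
   replacement. *)
have sq : (u - LB) ^+ 2 <= (s * (q - 1) - os) ^+ 2 / 4 + (1 + n%:R) * K1 * Y + K1 ^+ 2 * Y.
  pose p := s * (q - 1) - os; pose D := LB - os.
  have -> : u - LB = p / 2 - D by rewrite /u /p /D /os; field.
  have pn : `|p| <= 1 + q + n%:R.
    rewrite /p; apply: (le_trans (ler_normB _ _)); apply: lerD.
      rewrite normrM (ger0_norm s_ge0); apply: (@le_trans _ _ `|q - 1|).
        by apply: ler_piMl.
      by apply: (le_trans (ler_normB _ _)); rewrite normr1 ger0_norm// addrC.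
    by rewrite ger0_norm.
  have pD : `|p * D| <= (1 + n%:R) * K1 * Y.
    rewrite normrM; apply: (@le_trans _ _ ((1 + q + n%:R) * (K1 * y))).
      apply: ler_pM => //; apply: (le_trans LBn).
      have : 0 <= K1 * y by apply: mulr_ge0.
      lra.
    rewrite (_ : _ * _ * Y = K1 * ((1 + n%:R) * Y)); last by ring.
    rewrite mulrCA; apply: ler_wpM2l => //; rewrite -qyY mulrA; apply: ler_wpM2r => //.
    have : 0 <= n%:R * q by apply: mulr_ge0.
    rewrite mulrDl mul1r mulrDr mulr1; lra.
  have DD : D ^+ 2 <= K1 ^+ 2 * Y.
    apply: (@le_trans _ _ (K1 ^+ 2 * y ^+ 2)); last first.
      by apply: ler_wpM2l => //; exact: sqr_ge0.
    rewrite -exprMn -real_normK ?num_real// ler_pXn2r ?nnegrE//; last exact: mulr_ge0.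
    apply: (le_trans LBn); have : 0 <= K1 * y by apply: mulr_ge0.
    lra.
  have := ler_norm (- (p * D)); rewrite normrN => pD'.
  rewrite (_ : (p / 2 - D) ^+ 2 = p ^+ 2 / 4 - p * D + D ^+ 2); last by field.
  rewrite -/p; lra.
have yK1 : K1 * y <= K1 * Y by rewrite ler_wpM2l.
have yK2 : K2 * y <= K2 * Y by rewrite ler_wpM2l.
have -> : ((3 + n%:R) * K1 + K2 + K1 ^+ 2) * Y = 2 * (K1 * Y) + (1 + n%:R) * K1 * Y + K2 * Y + K1 ^+ 2 * Y by ring.
have sqE : (u - LB) ^+ 2 = u ^+ 2 - 2 * u * LB + LB ^+ 2 by ring.
rewrite sqE in sq.
have K1Y0 : 0 <= K1 * Y by apply: le_trans yK1; exact: mulr_ge0.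
lra.
Qed.

End tilted_pair_bound.

(** * Averages over sums of signs *)

Section rademacher.
Variable R : realType.
Implicit Types (F G : R -> R) (s t u : R) (N : nat).

(* [rad N F] is the mean of [F] at a sum of [N] independent random signs. *)
Fixpoint rad N F : R :=
  if N is N'.+1 then
    (rad N' (fun s => F (s + 1)) + rad N' (fun s => F (s - 1))) / 2
  else F 0.

Lemma eq_rad N F G : F =1 G -> rad N F = rad N G.
Proof. by move=> /funext ->. Qed.

Lemma ler_rad N F G : (forall s, F s <= G s) -> rad N F <= rad N G.
Proof.
elim: N F G => [|N ih] F G FG /=; first exact: FG.
by rewrite ler_pM2r// lerD// ih.
Qed.

Lemma radD N F G : rad N (fun s => F s + G s) = rad N F + rad N G.
Proof. by elim: N F G => [|N ih] F G //=; rewrite !ih; field. Qed.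

Lemma radZ N c F : rad N (fun s => c * F s) = c * rad N F.
Proof. by elim: N F => [|N ih] F //=; rewrite !ih; field. Qed.

Lemma radB N F G : rad N (fun s => F s - G s) = rad N F - rad N G.
Proof. by elim: N F G => [|N ih] F G //=; rewrite !ih; field. Qed.

Lemma rad_cst N c : rad N (fun=> c) = c.
Proof. by elim: N => //= N ->; field. Qed.

Lemma rad_ge0 N F : (forall s, 0 <= F s) -> 0 <= rad N F.
Proof. by move=> F0; rewrite -(rad_cst N 0); exact: ler_rad. Qed.

Lemma rad_norm N F : `|rad N F| <= rad N (fun s => `|F s|).
Proof.
rewrite ler_norml -mulN1r -radZ; apply/andP; split; apply: ler_rad => s.
  by rewrite mulN1r lerNl -normrN; exact: ler_norm.
exact: ler_norm.
Qed.

(** Discrete integration by parts: given the others, one sign times [F] averages to half a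
    difference of [F], and by symmetry the [N + 1] signs contribute equally. The recursion defining
    [rad] makes induction the direct proof. *)
Lemma rad_stein N F :
  rad N.+1 (fun s => s * F s) = N.+1%:R * rad N (fun s => (F (s + 1) - F (s - 1)) / 2).
Proof.
elim: N F => [|N ih] F; first by rewrite /= !add0r; ring.
pose dF s := (F (s + 1) - F (s - 1)) / 2.
have dFE M : rad M dF = (rad M (fun s => F (s + 1)) - rad M (fun s => F (s - 1))) / 2.
  by rewrite -radB [RHS]mulrC -radZ; apply: eq_rad => s; rewrite /dF mulrC.
have E F' c : rad N.+1 (fun s => (s + c) * F' s) =
    rad N.+1 (fun s => s * F' s) + c * rad N.+1 F'.
  by rewrite -radZ -radD; apply: eq_rad => s; rewrite mulrDl.
rewrite -[LHS]/((rad N.+1 (fun s => (s + 1) * F (s + 1)) +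
                 rad N.+1 (fun s => (s - 1) * F (s - 1))) / 2).
rewrite (E (fun s => F (s + 1))) (E (fun s => F (s - 1))) !ih.
have A1 : rad N (fun s => (F (s + 1 + 1) - F (s - 1 + 1)) / 2) = rad N (fun s => dF (s + 1)).
  by apply: eq_rad => s; rewrite /dF; congr ((_ - F _) / _); ring.
have A2 : rad N (fun s => (F (s + 1 - 1) - F (s - 1 - 1)) / 2) = rad N (fun s => dF (s - 1)).
  by apply: eq_rad => s; rewrite /dF; congr ((F _ - _) / _); ring.
rewrite A1 A2.
have D1 : rad N.+1 dF = (rad N (fun s => dF (s + 1)) + rad N (fun s => dF (s - 1))) / 2 by [].
have := dFE N.+1; rewrite -[rad N.+1 (fun s => _ / 2)]/(rad N.+1 dF).
set a := rad N.+1 (fun s => F (s + 1)); set c := rad N.+1 (fun s => F (s - 1)).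
rewrite D1; set p := rad N (fun s => dF (s + 1)); set q := rad N (fun s => dF (s - 1)).
move=> h; have -> : a = p + q + c by lra.
by rewrite -[N.+2%:R]natr1; field.
Qed.

Lemma sum_spins N F :
  (2 ^+ N)^-1 * \sum_(e : {ffun 'I_N -> bool}) F (\sum_(u < N) (-1) ^+ e u) = rad N F.
Proof.
elim: N F => [|N ih] F.
  rewrite /= expr0 invr1 mul1r (big_pred1 [ffun=> true]).
    by rewrite big_ord0.
  by move=> e; rewrite /= ; apply/esym/eqP/ffunP => -[].
pose h (p : bool * {ffun 'I_N -> bool}) : {ffun 'I_N.+1 -> bool} :=
  [ffun u => if unlift ord0 u is Some v then p.2 v else p.1].
pose h' (e : {ffun 'I_N.+1 -> bool}) := (e ord0, [ffun v => e (lift ord0 v)]).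
have hK : cancel h h'.
  move=> [c e]; rewrite /h /h'; congr (_, _); first by rewrite ffunE unlift_none.
  by apply/ffunP => v; rewrite !ffunE liftK.
have h'K : cancel h' h.
  move=> e; apply/ffunP => u; rewrite ffunE.
  by case: unliftP => [v ->|->] /=; rewrite ?ffunE.
have hsum p : \sum_(u < N.+1) (-1 : R) ^+ h p u = \sum_(u < N) (-1) ^+ p.2 u + (-1) ^+ p.1.
  rewrite big_ord_recl ffunE unlift_none addrC; congr (_ + _).
  by apply: eq_bigr => u _; rewrite ffunE liftK.
rewrite (reindex h) /=; last by exists h' => ? _.
under eq_bigr do rewrite hsum.
rewrite -(pair_bigA _ (fun (c : bool) (e : {ffun 'I_N -> bool}) => F (\sum_(u < N) (-1) ^+ e u + (-1) ^+ c)))/=.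
rewrite big_bool /= -!ih expr1 expr0 exprS -mulrDr addrC.
by field; rewrite expf_neq0.
Qed.

(** Odd terms cancel, and the even ones are compared through [2 ^ n * n! <= (2 n)!]. *)
Lemma cosh_le_expR u : (expR u + expR (- u)) / 2 <= expR (u ^+ 2 / 2).
Proof.
pose c (v : R) := series (exp_coeff v).
have cv v : c v n @[n --> \oo] --> expR v by exact: is_cvg_series_exp_coeff.
have step n : (c u n.*2 + c (- u) n.*2) / 2 <= c (u ^+ 2 / 2) n.
  elim: n => [|n ih]; first by rewrite /c /series/= !big_geq// addr0 mul0r.
  rewrite /c doubleS !seriesSr -/(c _ _) -/(c _ _) -/(c _ _).
  have -> : exp_coeff (- u) n.*2 = exp_coeff u n.*2.
    by rewrite /exp_coeff/= exprNn -signr_odd odd_double expr0 mul1r.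
  have -> : exp_coeff (- u) n.*2.+1 = - exp_coeff u n.*2.+1.
    by rewrite /exp_coeff/= exprNn -signr_odd /= odd_double /= expr1 !mulN1r mulNr.
  suff : exp_coeff u n.*2 <= exp_coeff (u ^+ 2 / 2) n.
    move: ih; rewrite /c; lra.
  rewrite /exp_coeff/= exprMn exprVn -exprM mul2n -mulrA; apply: ler_wpM2l.
    by rewrite -mul2n exprM exprn_ge0// sqr_ge0.
  rewrite -invfM lef_pV2 ?posrE ?mulr_gt0 ?exprn_gt0 ?ltr0n ?fact_gt0//.
  rewrite -natrX -natrM ler_nat; elim: n {ih} => // n ih.
  rewrite doubleS !factS expnS.
  have -> : (2 * 2 ^ n * (n.+1 * n`!) = (n.+1).*2 * (2 ^ n * n`!))%N by rewrite -mul2n; lia.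
  by rewrite doubleS leq_mul2l /=; apply: leq_trans ih _; exact: leq_pmull.
have cv2 v : c v n.*2 @[n --> \oo] --> expR v.
  apply/cvgrPdist_le => e e0; have /cvgrPdist_le/(_ e e0)[M _ HM] := cv v.
  exists M => // n /= Mn; apply: HM => /=.
  by apply: leq_trans Mn _; rewrite -addnn leq_addl.
have h1 : (c u n.*2 + c (- u) n.*2) / 2 @[n --> \oo] --> (expR u + expR (- u)) / 2.
  by apply: cvgM; [apply: cvgD; exact: cv2|exact: cvg_cst].
apply: (ler_cvg_to h1 (cv (u ^+ 2 / 2))).
by apply: nearW => n; exact: step.
Qed.

(** Averaging out one sign replaces [l] by [l + l ^ 2] at the price of [exp (l / 2)], and the bound
    [1 / (1 - N l)] is stable under this step. It is weaker than the square root expected of a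
    normal variable, but finite on the same range. *)
Lemma rad_expR_sqr N (l : R) : 0 <= l -> N%:R * l < 1 ->
  rad N (fun s => expR (l * s ^+ 2 / 2)) * (1 - N%:R * l) <= 1.
Proof.
elim: N l => [|N ih] l l0 Nl.
  by rewrite /= expr0n/= mulr0 mul0r expR0 mul0r subr0 mulr1.
have N0 : 0 <= N%:R :> R by [].
rewrite -[N.+1%:R]natr1 in Nl *.
pose l' := l + l ^+ 2.
have l2 : 0 <= l ^+ 2 by exact: sqr_ge0.
have l'0 : 0 <= l' by rewrite addr_ge0.
have Nl2 : N%:R * l < 1 by apply: le_lt_trans Nl; rewrite mulrDl lerDl mul1r.
have Nl' : N%:R * l' < 1.
  rewrite /l' mulrDr; apply: le_lt_trans Nl; rewrite mulrDl mul1r lerD2l expr2 mulrA.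
  by apply: ler_piMl => //; exact: ltW.
have {}ih := ih l' l'0 Nl'.
have step : rad N.+1 (fun s => expR (l * s ^+ 2 / 2)) <=
    expR (l / 2) * rad N (fun s => expR (l' * s ^+ 2 / 2)).
  rewrite /= -radD mulrC -radZ -radZ; apply: ler_rad => s.
  have -> : l * (s + 1) ^+ 2 / 2 = (l * s ^+ 2 / 2 + l / 2) + l * s by field.
  have -> : l * (s - 1) ^+ 2 / 2 = (l * s ^+ 2 / 2 + l / 2) + - (l * s) by field.
  have -> : l' * s ^+ 2 / 2 = l * s ^+ 2 / 2 + (l * s) ^+ 2 / 2 by rewrite /l'; field.
  rewrite !expRD; have := cosh_le_expR (l * s).
  move=> h; have e1 := expR_ge0 (l * s ^+ 2 / 2); have e2 := expR_ge0 (l / 2).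
  have := ler_wpM2l (mulr_ge0 e1 e2) h; nra.
have d0 : 0 < 1 - N%:R * l' by rewrite subr_gt0.
have d1 : 0 <= 1 - (N%:R + 1) * l by rewrite subr_ge0 ltW.
apply: le_trans (ler_wpM2r d1 step) _.
set E := rad N _ in ih *.
have E0 : 0 <= E by apply: rad_ge0 => s; exact: expR_ge0.
have l1 : l < 1 by nra.
have el : expR (l / 2) * (1 - l) <= 1.
  have : expR (l / 2) <= expR l by rewrite ler_expR; lra.
  have : 1 - l <= expR (- l) by have := expR_ge1Dx (- l); lra.
  move=> h1 h2; have h3 : expR l * expR (- l) = 1 by rewrite -expRD subrr expR0.
  apply: (@le_trans _ _ (expR l * expR (- l))); last by rewrite h3.
  by apply: ler_pM => //; lra.
have key : 1 - (N%:R + 1) * l <= (1 - l) * (1 - N%:R * l').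
  rewrite /l'; have : 0 <= N%:R * l ^+ 3 by apply: mulr_ge0 => //; exact: exprn_ge0.
  by rewrite !exprS expr0; nra.
apply: (@le_trans _ _ (expR (l / 2) * E * ((1 - l) * (1 - N%:R * l')))).
  by apply: ler_wpM2l => //; apply: mulr_ge0 => //; exact: expR_ge0.
rewrite mulrACA -[leRHS]mulr1; apply: ler_pM => //.
- by apply: mulr_ge0; [exact: expR_ge0|lra].
- by apply: mulr_ge0 => //; exact: ltW.
Qed.

(** The leading terms [u] cancel. For [u] above one the bound is crude, since [u <= u ^ 2]. *)
Lemma sinh_sub_le u :
  `|(expR u - expR (- u)) / 2 - u * ((expR u + expR (- u)) / 2)| <=
  2 * u ^+ 2 * ((expR u + expR (- u)) / 2).
Proof.
wlog u0 : u / 0 <= u.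
  move=> H; have [|/ltW u0] := leP 0 u; first exact: H.
  have := H (- u); rewrite oppr_ge0 => /(_ u0); rewrite opprK sqrrN.
  rewrite (_ : _ - _ = - ((expR u - expR (- u)) / 2 - u * ((expR u + expR (- u)) / 2))); last by ring.
  by rewrite normrN [expR (- u) + _]addrC.
have ep := expR_gt0 u; have en := expR_gt0 (- u).
have epn : expR u * expR (- u) = 1 by rewrite -expRD subrr expR0.
have g1 : 1 + u <= expR u by exact: expR_ge1Dx.
have g2 : 1 - u <= expR (- u) by exact: expR_ge1Dx.
have eu1 : 1 <= expR u by lra.
set p := expR u in ep epn g1 eu1 *; set q := expR (- u) in en epn g2 *.
have q1 : q <= 1 by nra.
have [u1|u1] := leP u 1.
  have a1 : p * (1 - u) <= 1 by rewrite -epn; apply: ler_wpM2l => //; lra.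
  have a2 : q * (1 + u) <= 1 by rewrite -epn mulrC; apply: ler_wpM2r => //; lra.
  have a3 : 1 - u ^+ 2 <= p * (1 - u).
    rewrite (_ : 1 - u ^+ 2 = (1 + u) * (1 - u)); last by ring.
    by apply: ler_wpM2r => //; lra.
  have a4 : 1 - u ^+ 2 <= q * (1 + u).
    rewrite (_ : 1 - u ^+ 2 = (1 - u) * (1 + u)); last by ring.
    by apply: ler_wpM2r => //; lra.
  have c1 : 1 <= (p + q) / 2.
    have : 0 <= (p - q) ^+ 2 by exact: sqr_ge0.
    have : 0 <= (p + q - 2) * (p + q + 2) -> 1 <= (p + q) / 2 by nra.
    by nra.
  apply: (@le_trans _ _ (u ^+ 2)); last first.
    have := sqr_ge0 u; nra.
  by rewrite ler_norml; apply/andP; split; nra.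
have u2 : u <= u ^+ 2 by rewrite expr2; nra.
by rewrite ler_norml; apply/andP; split; nra.
Qed.

End rademacher.

Section rademacher_moments.
Variable R : realType.
Implicit Types (s t u l : R) (N : nat).

Lemma expr1D_le_expR j (e y : R) : 0 < e -> 0 <= y ->
  (1 + y) ^+ j <= j`!%:R * (2 / e) ^+ j * expR (e / 2) * expR (e * y / 2).
Proof.
move=> e0 y0; have h0 : 0 <= e * (1 + y) / 2.
  by rewrite divr_ge0// mulr_ge0 ?(ltW e0)// addr_ge0.
have -> : 1 + y = 2 / e * (e * (1 + y) / 2) by field; exact: lt0r_neq0.
rewrite exprMn [_ * (2 / e) ^+ j]mulrC -!(mulrA ((2 / e) ^+ j)); apply: ler_wpM2l.
  by rewrite exprn_ge0// divr_ge0// ltW.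
apply: (le_trans (exprn_le_expR j h0)).
by rewrite -[leRHS]mulrA ler_wpM2l// -expRD ler_expR; lra.
Qed.

(** The polynomial is absorbed by raising the exponential rate by [e], which is possible as long as
    the total rate stays below one. *)
Lemma rad_poly_expR N j (m l t e : R) : N%:R <= m -> 0 < m -> 0 <= l ->
  N%:R * l <= t -> 0 < e -> t + e < 1 ->
  rad N (fun s => (1 + s ^+ 2 / m) ^+ j * expR (l * s ^+ 2 / 2)) <=
  j`!%:R * (2 / e) ^+ j * expR (e / 2) / (1 - t - e).
Proof.
move=> Nm m0 l0 Nl e0 te.
have em0 : 0 <= e / m by rewrite divr_ge0// ltW.
have NL : N%:R * (l + e / m) <= t + e.
  rewrite mulrDr lerD// mulrCA -[leRHS]mulr1 ler_wpM2l ?(ltW e0)//.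
  by rewrite ler_pdivrMr// mul1r.
have := rad_expR_sqr (addr_ge0 l0 em0) (le_lt_trans NL te).
set E := rad N _ => hE.
have E0 : 0 <= E by apply: rad_ge0 => s; exact: expR_ge0.
have dp : 0 < 1 - t - e by lra.
have hE' : E <= (1 - t - e)^-1.
  rewrite -[leRHS]mul1r ler_pdivlMr//; apply: le_trans hE; apply: ler_wpM2l => //.
  lra.
apply: (@le_trans _ _ (j`!%:R * (2 / e) ^+ j * expR (e / 2) * E)); last first.
  apply: ler_wpM2l => //; rewrite !mulr_ge0 ?expR_ge0// exprn_ge0// divr_ge0//.
  exact: ltW.
rewrite -radZ; apply: ler_rad => s.
have y0 : 0 <= s ^+ 2 / m by rewrite divr_ge0 ?sqr_ge0// ltW.
have -> : expR ((l + e / m) * s ^+ 2 / 2) = expR (e * (s ^+ 2 / m) / 2) * expR (l * s ^+ 2 / 2).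
  by rewrite -expRD; congr expR; field; exact: lt0r_neq0.
by rewrite mulrA ler_wpM2r ?expR_ge0//; exact: expr1D_le_expR.
Qed.

Lemma rad_stein_expR N l k :
  rad N.+1 (fun s => s ^+ k.+1 * expR (l * s ^+ 2 / 2)) =
  N.+1%:R * rad N (fun s => expR (l * (s ^+ 2 + 1) / 2) *
    (((s + 1) ^+ k * expR (l * s) - (s - 1) ^+ k * expR (- (l * s))) / 2)).
Proof.
rewrite (eq_rad _ (G := fun s => s * (s ^+ k * expR (l * s ^+ 2 / 2)))); last first.
  by move=> s; rewrite exprS mulrA.
rewrite rad_stein; congr (_ * _); apply: eq_rad => s.
have -> : l * (s + 1) ^+ 2 / 2 = l * (s ^+ 2 + 1) / 2 + l * s by field.
have -> : l * (s - 1) ^+ 2 / 2 = l * (s ^+ 2 + 1) / 2 + - (l * s) by field.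
by rewrite !expRD; ring.
Qed.

(** Written over one sign fewer and with the same exponential factor as [rad_stein_expR], so that
    the two can be subtracted under a single average. *)
Lemma radS_expR N l k :
  rad N.+1 (fun s => s ^+ k * expR (l * s ^+ 2 / 2)) =
  rad N (fun s => expR (l * (s ^+ 2 + 1) / 2) *
    (((s + 1) ^+ k * expR (l * s) + (s - 1) ^+ k * expR (- (l * s))) / 2)).
Proof.
rewrite [LHS]/= -radD mulrC -radZ; apply: eq_rad => s.
have -> : l * (s + 1) ^+ 2 / 2 = l * (s ^+ 2 + 1) / 2 + l * s by field.
have -> : l * (s - 1) ^+ 2 / 2 = l * (s ^+ 2 + 1) / 2 + - (l * s) by field.
by rewrite !expRD; ring.
Qed.

(* With [u = l * s = k * z / r] and [r ^+ 2] the number of signs, the bound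
   [sinh_sub_le] makes the defect in both relations of order [1 / r]. *)
Lemma stein_error1 (r z k : R) : 1 <= r -> 0 <= k <= 1 ->
  let s := r * z in let l := k / r ^+ 2 in
  let p := expR (l * s) in let q := expR (- (l * s)) in
  is_true (`|((s + 1) ^+ 1 * p - (s - 1) ^+ 1 * q) / 2 - ((s + 1) ^+ 0 * p + (s - 1) ^+ 0 * q) / 2
    - l * (((s + 1) ^+ 2 * p + (s - 1) ^+ 2 * q) / 2)|
  <= (p + q) / 2 * (22 * (1 + z ^+ 2) ^+ 3 / r)).
Proof.
move=> r1 /andP[k0 k1] s l p q.
have p0 : 0 < p by exact: expR_gt0.
have q0 : 0 < q by exact: expR_gt0.
have := sinh_sub_le (l * s); rewrite -/p -/q.
have r0 : r != 0 by rewrite lt0r_neq0//; lra.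
pose c := (p + q) / 2; pose h := (p - q) / 2; rewrite -/c -/h => hd.
have hc : `|h| <= c by rewrite ler_norml /h /c; apply/andP; split; lra.
have c0 : 0 <= c by rewrite /c; lra.
pose i := r^-1; have i0 : 0 <= i by rewrite invr_ge0; lra.
have i1 : i <= 1 by rewrite invf_le1//; lra.
have ri : r * i = 1 by rewrite mulfV.
rewrite (_ : _ - _ - _ = r * z * (h - l * s * c) - k * i ^+ 2 * c - 2 * (k * i * z * h)); last first.
  by rewrite /h /c /l /s /i; field.
have ls : l * s = k * i * z by rewrite /l /s /i; field.
rewrite ls in hd *.
rewrite -/c -/i; clearbody c h i.
have k2 : k ^+ 2 <= 1 by rewrite expr2; nra.
have t1 : `|r * z * (h - k * i * z * c)| <= 2 * `|z| ^+ 3 * c * i.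
  rewrite !normrM (ger0_norm (_ : 0 <= r)); last by lra.
  apply: (le_trans (ler_wpM2l _ hd)); first by rewrite mulr_ge0//; lra.
  rewrite !exprMn -(real_normK (num_real z)).
  rewrite [leLHS](_ : _ = k ^+ 2 * (2 * `|z| ^+ 3 * c * i) * (r * i)); last by ring.
  rewrite ri mulr1; apply: ler_piMl => //; rewrite !mulr_ge0//.
have i2 : i ^+ 2 <= i by rewrite expr2 ler_piMr.
have t2 : `|k * i ^+ 2 * c| <= c * i.
  rewrite ger0_norm ?mulr_ge0 ?sqr_ge0// mulrC ler_wpM2l//.
  by apply: le_trans i2; rewrite ler_piMl ?sqr_ge0.
have t3 : `|k * i * z * h| <= `|z| * c * i.
  rewrite !normrM (ger0_norm k0) (ger0_norm i0).
  rewrite [leLHS](_ : _ = k * (`|z| * `|h| * i)); last by ring.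
  apply: (@le_trans _ _ (`|z| * `|h| * i)); first by rewrite ler_piMl ?mulr_ge0.
  by rewrite ler_wpM2r// ler_wpM2l.
(* The constant and the cube are those of [stein_error2], so that both errors have the same form. *)
have Z : 2 * `|z| ^+ 3 + 1 + 2 * `|z| <= 22 * (1 + z ^+ 2) ^+ 3.
  rewrite -(real_normK (num_real z)); have := normr_ge0 z; set y := `|z| => y0.
  have : y <= 1 + y ^+ 2 by have := sqr_ge0 (y - 1); nra.
  have := sqr_ge0 y; set x := y ^+ 2 => x0 xy.
  rewrite (_ : y ^+ 3 = y * x); last by rewrite /x; ring.
  have : y * x <= (1 + x) * x by rewrite ler_wpM2r.
  have : 0 <= x ^+ 3 by rewrite exprn_ge0.
  have : 0 <= x ^+ 2 by rewrite exprn_ge0.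
  nra.
have ci : 0 <= c * i by rewrite mulr_ge0.
have := ler_wpM2l ci Z.
have := ler_normB (r * z * (h - k * i * z * c) - k * i ^+ 2 * c) (2 * (k * i * z * h)).
have := ler_normB (r * z * (h - k * i * z * c)) (k * i ^+ 2 * c).
rewrite (normrM 2) (ger0_norm (_ : 0 <= 2 :> R))//.
move=> n1 n2 n3; rewrite (_ : c * (_ * i) = c * i * (22 * (1 + z ^+ 2) ^+ 3)); last by ring.
apply: le_trans n3; lra.
Qed.

Lemma stein_error2 (r z k : R) : 1 <= r -> 0 <= k <= 1 ->
  let s := r * z in let l := k / r ^+ 2 in
  let p := expR (l * s) in let q := expR (- (l * s)) in
  is_true (`|(((s + 1) ^+ 3 * p - (s - 1) ^+ 3 * q) / 2
     - 3 * (((s + 1) ^+ 2 * p + (s - 1) ^+ 2 * q) / 2)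
    - l * (((s + 1) ^+ 4 * p + (s - 1) ^+ 4 * q) / 2)) / r ^+ 2|
  <= (p + q) / 2 * (22 * (1 + z ^+ 2) ^+ 3 / r)).
Proof.
move=> r1 /andP[k0 k1] s l p q.
have p0 : 0 < p by exact: expR_gt0.
have q0 : 0 < q by exact: expR_gt0.
have := sinh_sub_le (l * s); rewrite -/p -/q.
have r0 : r != 0 by rewrite lt0r_neq0//; lra.
pose c := (p + q) / 2; pose h := (p - q) / 2; rewrite -/c -/h => hd.
have hc : `|h| <= c by rewrite ler_norml /h /c; apply/andP; split; lra.
have c0 : 0 <= c by rewrite /c; lra.
pose i := r^-1; have i0 : 0 <= i by rewrite invr_ge0; lra.
have i1 : i <= 1 by rewrite invf_le1//; lra.
have ri : r * i = 1 by rewrite mulfV.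
rewrite (_ : _ / r ^+ 2 = r * z ^+ 3 * (h - l * s * c) - i * (3 * z * h)
   - i ^+ 2 * (2 * c) - k * i ^+ 2 * ((6 * z ^+ 2 + i ^+ 2) * c)
   - k * i * ((4 * z ^+ 3 + 4 * z * i ^+ 2) * h)); last first.
  by rewrite /h /c /l /s /i; field.
have ls : l * s = k * i * z by rewrite /l /s /i; field.
rewrite ls in hd *.
rewrite -/c -/i; clearbody c h i.
have k2 : k ^+ 2 <= 1 by rewrite expr2; nra.
have i2 : i ^+ 2 <= i by rewrite expr2 ler_piMr.
have i21 : i ^+ 2 <= 1 by apply: le_trans i1.
have t1 : `|r * z ^+ 3 * (h - k * i * z * c)| <= 2 * `|z| ^+ 5 * c * i.
  rewrite (normrM (r * _)) (normrM r) normrX (ger0_norm (_ : 0 <= r)); last by lra.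
  apply: (le_trans (ler_wpM2l _ hd)); first by rewrite !mulr_ge0//; lra.
  rewrite !exprMn -(real_normK (num_real z)).
  rewrite [leLHS](_ : _ = k ^+ 2 * (2 * `|z| ^+ 5 * c * i) * (r * i)); last by ring.
  by rewrite ri mulr1; apply: ler_piMl => //; rewrite !mulr_ge0.
have t2 : `|i * (3 * z * h)| <= 3 * `|z| * c * i.
  by rewrite !normrM (ger0_norm i0) (ger0_norm (_ : 0 <= 3))// mulrC ler_wpM2r// ler_wpM2l// mulr_ge0.
have t3 : `|i ^+ 2 * (2 * c)| <= 2 * c * i.
  by rewrite ger0_norm ?mulr_ge0 ?sqr_ge0// mulrC ler_wpM2l// mulr_ge0.
have z20 := sqr_ge0 z; have i20 := sqr_ge0 i.
have t4 : `|k * i ^+ 2 * ((6 * z ^+ 2 + i ^+ 2) * c)| <= (6 * z ^+ 2 + 1) * c * i.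
  rewrite ger0_norm; last by rewrite !mulr_ge0// addr_ge0// mulr_ge0.
  rewrite mulrC; apply: ler_pM.
  - by rewrite !mulr_ge0// addr_ge0// mulr_ge0.
  - by rewrite mulr_ge0.
  - by rewrite ler_wpM2r// lerD2l.
  - by apply: le_trans i2; rewrite ler_piMl.
have t5 : `|k * i * ((4 * z ^+ 3 + 4 * z * i ^+ 2) * h)| <= (4 * `|z| ^+ 3 + 4 * `|z|) * c * i.
  rewrite normrM mulrC; apply: ler_pM => //.
    rewrite normrM; apply: ler_pM => //.
    apply: (le_trans (ler_normD _ _)); rewrite (normrM 4 (z ^+ 3)) normrX (normrM (4 * z)) (normrM 4) (ger0_norm (_ : 0 <= 4))//.
    by rewrite lerD2l (ger0_norm i20) ler_piMr// mulr_ge0.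
  by rewrite ger0_norm ?mulr_ge0// ler_piMl.
(* [22] is the sum of the coefficients on the left. *)
have Z : 2 * `|z| ^+ 5 + 3 * `|z| + 2 + (6 * z ^+ 2 + 1) + (4 * `|z| ^+ 3 + 4 * `|z|) <= 22 * (1 + z ^+ 2) ^+ 3.
  rewrite -(real_normK (num_real z)); have := normr_ge0 z; set y := `|z| => y0.
  have : y <= (1 + y ^+ 2) / 2 by have := sqr_ge0 (y - 1); nra.
  have := sqr_ge0 y; set x := y ^+ 2 => x0 xy.
  rewrite (_ : y ^+ 3 = y * x); last by rewrite /x; ring.
  rewrite (_ : y ^+ 5 = y * x ^+ 2); last by rewrite /x; ring.
  have : y * x <= (1 + x) / 2 * x by rewrite ler_wpM2r.
  have x2 : 0 <= x ^+ 2 by rewrite exprn_ge0.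
  have : y * x ^+ 2 <= (1 + x) / 2 * x ^+ 2 by rewrite ler_wpM2r.
  have : 0 <= x ^+ 3 by rewrite exprn_ge0.
  nra.
have ci : 0 <= c * i by rewrite mulr_ge0.
have := ler_wpM2l ci Z.
rewrite (_ : c * (_ * i) = c * i * (22 * (1 + z ^+ 2) ^+ 3)); last by ring.
apply: le_trans.
rewrite [leRHS](_ : _ = 2 * `|z| ^+ 5 * c * i + 3 * `|z| * c * i + 2 * c * i
  + (6 * z ^+ 2 + 1) * c * i + (4 * `|z| ^+ 3 + 4 * `|z|) * c * i); last by ring.
by do 4 (apply: (le_trans (ler_normB _ _)); apply: lerD => //).
Qed.

End rademacher_moments.

(** * Normal approximation of the overlap average *)

Section rademacher_limit.
Variable R : realType.

(** The bound of [rad_poly_expR] for [j = 3] and [t = c], with [e] half of the gap between [c] and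
    one; the cube is the one in the Stein errors. *)
Definition exp_moment_const (c : R) : R :=
  let e := (1 - c) / 2 in 3`!%:R * (2 / e) ^+ 3 * expR (e / 2) / (1 - c - e).

Definition stein_const (c : R) : R := expR 1 * 22 * exp_moment_const c.

Lemma exp_moment_const_ge0 c : c < 1 -> 0 <= exp_moment_const c.
Proof.
move=> c1; rewrite /exp_moment_const; set e := (1 - c) / 2.
have e0 : 0 < e by rewrite /e; lra.
have e1 : 0 <= 1 - c - e by rewrite /e; lra.
by rewrite divr_ge0// mulr_ge0 ?expR_ge0// mulr_ge0// exprn_ge0// divr_ge0// ltW.
Qed.

(** The hyperbolic cosine raises the rate from [l] to [l + l ^ 2], but the average runs over one
    sign fewer: [N (l + l ^ 2) <= (N + 1) l = k], so the rate stays below [c]. *)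
Lemma rad_stein_error N (k c : R) (E : R -> R) : 0 <= k <= c -> c < 1 ->
  let l := k / N.+1%:R in
  (forall s, `|E s| <= (expR (l * s) + expR (- (l * s))) / 2 *
     (22 * (1 + s ^+ 2 / N.+1%:R) ^+ 3 / Num.sqrt N.+1%:R)) ->
  `|rad N (fun s => expR (l * (s ^+ 2 + 1) / 2) * E s)| <=
     stein_const c / Num.sqrt N.+1%:R.
Proof.
move=> /andP[k0 kc] c1 l hE.
have n0 : 0 < N.+1%:R :> R by rewrite ltr0n.
have r0 : 0 < Num.sqrt N.+1%:R :> R by rewrite sqrtr_gt0.
have l0 : 0 <= l by rewrite divr_ge0// ltW.
have Nl : N.+1%:R * l = k by rewrite /l mulrC divfK ?lt0r_neq0.
have l1 : l <= 1.
  rewrite /l ler_pdivrMr// mul1r; apply: (@le_trans _ _ 1); first by lra.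
  by rewrite ler1n.
have NL : N%:R * (l + l ^+ 2) <= c.
  apply: (le_trans _ kc); rewrite -Nl -[N.+1%:R]natr1 mulrDr mulrDl mul1r lerD2l.
  rewrite expr2 mulrA ler_piMl//; apply: (@le_trans _ _ k); last by lra.
  by rewrite -Nl ler_wpM2r// ler_nat.
have e0 : 0 < (1 - c) / 2 by lra.
have ce : c + (1 - c) / 2 < 1 by lra.
have := @rad_poly_expR R N 3 N.+1%:R (l + l ^+ 2) c _ _ n0 (addr_ge0 l0 (sqr_ge0 l)) NL e0 ce.
rewrite ler_nat => /(_ (leqnSn N)); rewrite -/(exp_moment_const c) => hM.
rewrite /stein_const -mulrA mulrAC -mulrA mulrC -mulrA.
apply: (@le_trans _ _ (expR 1 * 22 / Num.sqrt N.+1%:R * exp_moment_const c)); last first.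
  by rewrite le_eqVlt; apply/orP; left; apply/eqP; field; exact: lt0r_neq0.
apply: (le_trans (rad_norm _ _)).
apply: (le_trans _ (ler_wpM2l _ hM)); last by rewrite divr_ge0 ?ltW// mulr_ge0// expR_ge0.
rewrite -radZ; apply: ler_rad => s.
rewrite normrM (ger0_norm (expR_ge0 _)).
have p3 : 0 <= (1 + s ^+ 2 / N.+1%:R) ^+ 3 by rewrite exprn_ge0// addr_ge0// divr_ge0 ?sqr_ge0// ltW.
set p := (1 + _) ^+ 3 in p3 hE *.
have hE' := hE s; rewrite -/p in hE'.
have ch := cosh_le_expR (l * s).
apply: (@le_trans _ _ (expR (l * (s ^+ 2 + 1) / 2) * (expR ((l * s) ^+ 2 / 2) * (22 * p / Num.sqrt N.+1%:R)))).
  rewrite ler_wpM2l ?expR_ge0//; apply: (le_trans hE'); apply: ler_wpM2r => //.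
  by rewrite divr_ge0 ?(ltW r0)// mulr_ge0.
rewrite mulrA -expRD.
have -> : l * (s ^+ 2 + 1) / 2 + (l * s) ^+ 2 / 2 = l / 2 + (l + l ^+ 2) * s ^+ 2 / 2 by field.
rewrite expRD; set a := expR (_ * s ^+ 2 / 2).
have a0 : 0 <= a by exact: expR_ge0.
have h1 : expR (l / 2) <= expR 1 by rewrite ler_expR; lra.
rewrite [leLHS](_ : _ = expR (l / 2) * (22 / Num.sqrt N.+1%:R * (p * a))); last by field; exact: lt0r_neq0.
rewrite [leRHS](_ : _ = expR 1 * (22 / Num.sqrt N.+1%:R * (p * a))); last by field; exact: lt0r_neq0.
by rewrite ler_wpM2r// mulr_ge0//; exact: mulr_ge0.
Qed.

Definition exp_moment N (k : R) j :=
  rad N (fun s => (s ^+ 2 / N%:R) ^+ j * expR (k * (s ^+ 2 / N%:R) / 2)).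

Section stein_relations.
Variables (N : nat) (k c : R).
Hypotheses (kc : 0 <= k <= c) (c1 : c < 1).

Let n : R := N.+1%:R.
Let l := k / n.

Let n0 : n != 0. Proof. by rewrite lt0r_neq0// ltr0n. Qed.

Let exp_momentE j : exp_moment N.+1 k j =
  n ^- j * rad N.+1 (fun s => s ^+ (j.*2) * expR (l * s ^+ 2 / 2)).
Proof.
rewrite /exp_moment -radZ; apply: eq_rad => s; rewrite -/n exprMn exprVn -exprM mul2n.
have -> : k * (s ^+ 2 / n) / 2 = l * s ^+ 2 / 2 by rewrite /l; field.
ring.
Qed.

Let k01 : 0 <= k <= 1. Proof. by case/andP: kc => -> /le_trans; apply; exact: ltW. Qed.

Let r1 : 1 <= Num.sqrt n. Proof. by rewrite -sqrtr1 ler_wsqrtr// ler1n. Qed.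

Let r2 : Num.sqrt n ^+ 2 = n. Proof. by rewrite sqr_sqrtr. Qed.

Let r0 : Num.sqrt n != 0. Proof. by rewrite lt0r_neq0// (lt_le_trans ltr01). Qed.

Let scaled (s : R) : Num.sqrt n * (s / Num.sqrt n) = s.
Proof. by field. Qed.

Let scaled2 (s : R) : (s / Num.sqrt n) ^+ 2 = s ^+ 2 / n.
Proof. by rewrite exprMn exprVn r2. Qed.

(** With [exp_moment_stein2] this gives, up to [1 / sqrt N], the relations [(1 - k) psi_1 = psi_0]
    and [(1 - k) psi_2 = 3 psi_1], those of a normal variable of variance [1 / (1 - k)]. *)
Lemma exp_moment_stein1 :
  `|exp_moment N.+1 k 1 - exp_moment N.+1 k 0 - k * exp_moment N.+1 k 1| <=
  stein_const c / Num.sqrt n.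
Proof.
have := @rad_stein_error N k c (fun s =>
  ((s + 1) ^+ 1 * expR (l * s) - (s - 1) ^+ 1 * expR (- (l * s))) / 2 -
  ((s + 1) ^+ 0 * expR (l * s) + (s - 1) ^+ 0 * expR (- (l * s))) / 2
    - l * (((s + 1) ^+ 2 * expR (l * s) + (s - 1) ^+ 2 * expR (- (l * s))) / 2)) kc c1.
rewrite -/n -/l => /(_ _)/=; set X := rad _ _ => H.
have -> : exp_moment N.+1 k 1 - exp_moment N.+1 k 0 - k * exp_moment N.+1 k 1 = X.
  have -> : k * exp_moment N.+1 k 1 = l * (n * exp_moment N.+1 k 1) by rewrite mulrA divfK.
  have -> : n * exp_moment N.+1 k 1 = rad N.+1 (fun s => s ^+ 2 * expR (l * s ^+ 2 / 2)).
    by rewrite exp_momentE expr1 mulVKf.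
  rewrite (radS_expR N l 2) !exp_momentE expr0 invr1 mul1r expr1.
  rewrite (rad_stein_expR N l 1) -/n mulKf// (radS_expR N l 0) -radZ -!radB /X; apply: eq_rad => s; ring.
apply: H => s; have := @stein_error1 R _ (s / Num.sqrt n) _ r1 k01.
by rewrite scaled scaled2 r2 -/l.
Qed.

Lemma exp_moment_stein2 :
  `|exp_moment N.+1 k 2 - 3 * exp_moment N.+1 k 1 - k * exp_moment N.+1 k 2| <=
  stein_const c / Num.sqrt n.
Proof.
have := @rad_stein_error N k c (fun s =>
  (((s + 1) ^+ 3 * expR (l * s) - (s - 1) ^+ 3 * expR (- (l * s))) / 2 -
  3 * (((s + 1) ^+ 2 * expR (l * s) + (s - 1) ^+ 2 * expR (- (l * s))) / 2)
    - l * (((s + 1) ^+ 4 * expR (l * s) + (s - 1) ^+ 4 * expR (- (l * s))) / 2)) / n) kc c1.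
rewrite -/n -/l => /(_ _)/=; set X := rad _ _ => H.
have -> : exp_moment N.+1 k 2 - 3 * exp_moment N.+1 k 1 - k * exp_moment N.+1 k 2 = X.
  have -> : k * exp_moment N.+1 k 2 = l * (n * exp_moment N.+1 k 2) by rewrite mulrA divfK.
  have -> : n * exp_moment N.+1 k 2 = n^-1 * rad N.+1 (fun s => s ^+ 4 * expR (l * s ^+ 2 / 2)).
    by rewrite exp_momentE; field.
  rewrite (radS_expR N l 4) !exp_momentE expr1.
  have -> : n ^- 2 * rad N.+1 (fun s => s ^+ 2.*2 * expR (l * s ^+ 2 / 2)) = n^-1 *
    rad N (fun s => expR (l * (s ^+ 2 + 1) / 2) *
    (((s + 1) ^+ 3 * expR (l * s) - (s - 1) ^+ 3 * expR (- (l * s))) / 2)).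
    by rewrite (rad_stein_expR N l 3) -/n; field.
  rewrite (radS_expR N l 2) -!radZ -!radB /X; apply: eq_rad => s; field.
  by rewrite addrC natr1.
apply: H => s; have := @stein_error2 R _ (s / Num.sqrt n) _ r1 k01.
by rewrite scaled scaled2 r2 -/l.
Qed.

Lemma exp_moment_le j : (j <= 3)%N -> 0 <= exp_moment N.+1 k j <= exp_moment_const c.
Proof.
move=> j3; rewrite /exp_moment; apply/andP; split.
  apply: rad_ge0 => s; rewrite mulr_ge0 ?expR_ge0// exprn_ge0// divr_ge0 ?sqr_ge0//.
case/andP: kc => k0 kc'.
have e0 : 0 < (1 - c) / 2 by rewrite divr_gt0// subr_gt0.
have ce : c + (1 - c) / 2 < 1 by rewrite -ltrBrDl gtr_pMr ?subr_gt0// invf_lt1// ltr1n.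
have nn0 : 0 < n by rewrite ltr0n.
have l0 : 0 <= l by rewrite divr_ge0// ltW.
have nl : N.+1%:R * l <= c by rewrite /l mulrC divfK.
apply: le_trans (@rad_poly_expR R N.+1 3 n l c _ (lexx _) nn0 l0 nl e0 ce).
apply: ler_rad => s.
have -> : k * (s ^+ 2 / n) / 2 = l * s ^+ 2 / 2 by rewrite /l; field.
have y0 : 0 <= s ^+ 2 / n by rewrite divr_ge0 ?sqr_ge0// ltW.
rewrite ler_wpM2r ?expR_ge0//.
apply: (@le_trans _ _ ((1 + s ^+ 2 / n) ^+ j)).
  by rewrite lerXn2r ?nnegrE// ?addr_ge0// lerDr.
by rewrite ler_weXn2l// lerDl.
Qed.

End stein_relations.

(** With [odd_sum_geometric] this identifies, for [v = 1 / (1 - s ^ 2)], the limits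
    [1 + diag_sum = v ^ 2] and [s + odd_sum = s v], with explicit tails. *)
Lemma geometric_weighted_sum n (t : R) : (1 < n)%N ->
  (1 + \sum_(k < n | (1 < k)%N) k%:R * t ^+ k.-1) * (1 - t) ^+ 2 =
  1 - n%:R * t ^+ n.-1 + n.-1%:R * t ^+ n.
Proof.
elim: n => // -[|[|n]] ih _ //.
  by rewrite big_mkcond /= !big_ord_recl big_ord0 /=; ring.
rewrite big_mkcond big_ord_recr -big_mkcond /= addrA mulrDl ih//= -!natr1 !exprS; ring.
Qed.

Lemma odd_sum_geometric n (s : R) : (1 < n)%N ->
  (s + odd_sum n s) * (1 - s ^+ 2) = s * (1 - (s ^+ 2) ^+ n.-1).
Proof.
elim: n => // -[|[|n]] ih _ //.
  by rewrite /odd_sum big_mkcond /= !big_ord_recl big_ord0 /=; ring.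
rewrite /odd_sum big_mkcond big_ord_recr -big_mkcond /= -/(odd_sum n.+2 s).
rewrite addrA mulrDl ih//= [(s ^+ 2) ^+ n.+2]exprS.
rewrite (_ : s ^+ n.+1.*2.+1 = s * (s ^+ 2) ^+ n.+1); first by ring.
by rewrite -exprM mul2n -exprS.
Qed.

(** The bracket bounds the two geometric tails, and the factor in front bounds the total exponential
    weight. *)
Definition limit_error n (c : R) :=
  (1 - c)^-1 * (n%:R * c ^+ n.-1 / (1 - c) ^+ 2 / 2 + (c ^+ n.-1) ^+ 2 / (1 - c) ^+ 2 / 4).

(* The left-hand side is the mean of [limit_form n s (z ^+ 2)] for a centered
   normal variable [z] of variance [v]. *)
Lemma limit_form_value_le n (s c v : R) : (1 < n)%N -> 0 <= s -> s ^+ 2 <= c -> c < 1 ->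
  v = (1 - s ^+ 2)^-1 ->
  3 * s ^+ 2 * v ^+ 2 / 4 + v / 2 - s * (s + odd_sum n s) * v / 2 +
    (s + odd_sum n s) ^+ 2 / 4 - 1 / 2 - diag_sum n s / 2 <=
  n%:R * c ^+ n.-1 / (1 - c) ^+ 2 / 2 + (c ^+ n.-1) ^+ 2 / (1 - c) ^+ 2 / 4.
Proof.
move=> n1 s0 sc c1 vE.
have t1 : 0 < 1 - s ^+ 2 by lra.
have cc : 0 < 1 - c by lra.
have vt : v * (1 - s ^+ 2) = 1 by rewrite vE mulVf ?lt0r_neq0.
have v0 : 0 <= v by rewrite vE invr_ge0 ltW.
have vc : v <= (1 - c)^-1 by rewrite vE lef_pV2 ?posrE//; lra.
have c0 : 0 <= c by apply: le_trans sc; exact: sqr_ge0.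
have pc : 0 <= (s ^+ 2) ^+ n.-1 <= c ^+ n.-1.
  by rewrite exprn_ge0 ?sqr_ge0//= lerXn2r ?nnegrE ?sqr_ge0.
have := odd_sum_geometric s n1; have := geometric_weighted_sum (s ^+ 2) n1.
have -> : \sum_(k < n | (1 < k)%N) k%:R * (s ^+ 2) ^+ k.-1 = diag_sum n s.
  by apply: eq_bigr => k _; rewrite -exprM mul2n.
set S := diag_sum n s; set w := s + _; set t := s ^+ 2 in sc t1 vt pc *.
set y := t ^+ n.-1 in pc *.
move=> hS hw; case/andP: pc => y0 yc.
have hS' : 1 + S = (1 - n%:R * y + n.-1%:R * t ^+ n) * v ^+ 2.
  by rewrite -hS -mulrA -exprMn [(1 - t) * v]mulrC vt expr1n mulr1.
have hw' : w = s * (1 - y) * v.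
  by rewrite -hw -mulrA [(1 - t) * v]mulrC vt mulr1.
have tn0 : 0 <= n.-1%:R * t ^+ n by rewrite mulr_ge0// exprn_ge0// /t sqr_ge0.
have v2 : v ^+ 2 <= ((1 - c) ^+ 2)^-1.
  by rewrite -exprVn lerXn2r ?nnegrE// invr_ge0 ltW.
(* The cancellation on which the expansion rests: apart from a term that is zero by definition of
   [v], only the differences of the truncated sums from their limits [v ^ 2] and [s v] remain. *)
have -> : 3 * t * v ^+ 2 / 4 + v / 2 - s * w * v / 2 + w ^+ 2 / 4 - 1 / 2 - S / 2 =
    (v ^+ 2 - (1 + S)) / 2 + (w - s * v) ^+ 2 / 4 + v / 2 * (1 - v * (1 - t)).
  by rewrite /t; field.
rewrite vt subrr mulr0 addr0; apply: lerD.
  rewrite ler_wpM2r// hS'; apply: (@le_trans _ _ (n%:R * y * v ^+ 2)).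
    have : 0 <= n.-1%:R * t ^+ n * v ^+ 2 by rewrite mulr_ge0// sqr_ge0.
    lra.
  by apply: ler_pM => //; rewrite ?mulr_ge0 ?sqr_ge0// ler_wpM2l.
rewrite ler_wpM2r// hw'.
have -> : (s * (1 - y) * v - s * v) ^+ 2 = t * y ^+ 2 * v ^+ 2 by rewrite /t; ring.
apply: ler_pM => //; rewrite ?mulr_ge0 ?sqr_ge0//.
rewrite -[leRHS]mul1r; apply: ler_pM; rewrite ?sqr_ge0//; first by lra.
by rewrite lerXn2r ?nnegrE// (le_trans y0).
Qed.

(** The constant is uniform in [s] as well as in [N], because the second moment is later integrated
    over [s]. *)
Lemma rad_limit_form n (c E : R) : (1 < n)%N -> 0 <= c < 1 -> 0 <= E -> exists K : R, 0 <= K /\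
  forall N (s : R), (0 < N)%N -> 0 <= s -> s ^+ 2 <= c ->
  rad N (fun o => expR (s ^+ 2 * (o ^+ 2 / N%:R - 1) / 2) *
    (limit_form n s (o ^+ 2 / N%:R) + E * ((1 + o ^+ 2 / N%:R) ^+ 2 / Num.sqrt N%:R))) <=
  limit_error n c + K / Num.sqrt N%:R.
Proof.
move=> n1 /andP[c0 c1] E0.
pose M := exp_moment_const c; pose V := (1 - c)^-1; pose D := stein_const c.
have M0 : 0 <= M by exact: exp_moment_const_ge0.
have V0 : 0 <= V by rewrite invr_ge0; lra.
have D0 : 0 <= D by rewrite /D /stein_const mulr_ge0// mulr_ge0// expR_ge0.
exists ((1 + n%:R) * (4 * V * D + 4 * V * V * D) + E * (4 * M)); split.
  apply: addr_ge0; last by do 2 apply: mulr_ge0 => //.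
  by apply: mulr_ge0; [exact: addr_ge0|apply: addr_ge0; repeat (first [done|apply: mulr_ge0])].
move=> [//|N] s _ s0 sc.
set k := s ^+ 2 in sc *.
have kc : 0 <= k <= c by rewrite sqr_ge0.
set r : R := Num.sqrt _; pose i : R := r^-1.
have r0 : 0 < r by rewrite sqrtr_gt0.
have i0 : 0 <= i by rewrite invr_ge0 ltW.
pose psi := exp_moment N.+1 k.
pose w := s + odd_sum n s; pose S := diag_sum n s.
(* Everything is quadratic in [q], so the average is a combination of [psi 0], [psi 1] and
   [psi 2]. *)
have -> : rad N.+1 (fun o => expR (k * (o ^+ 2 / N.+1%:R - 1) / 2) *
    (limit_form n s (o ^+ 2 / N.+1%:R) + E * ((1 + o ^+ 2 / N.+1%:R) ^+ 2 / r))) =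
  expR (- k / 2) * ((k / 4 * psi 2 + (1 / 2 - s * w / 2) * psi 1 + (w ^+ 2 / 4 - 1 / 2 - S / 2) * psi 0)
     + E * i * (psi 0 + 2 * psi 1 + psi 2)).
  rewrite -!radZ -!radD -radZ -radD -radZ; apply: eq_rad => o; set q := o ^+ 2 / _.
  rewrite (_ : k * (q - 1) / 2 = - k / 2 + k * q / 2); last by field.
  by rewrite expRD /limit_form -/S /w /i /k; field; exact: lt0r_neq0.
have st1 := exp_moment_stein1 N kc c1; have st2 := exp_moment_stein2 N kc c1.
have m0 := exp_moment_le N kc c1 (isT : (0 <= 3)%N).
have m1 := exp_moment_le N kc c1 (isT : (1 <= 3)%N).
have m2 := exp_moment_le N kc c1 (isT : (2 <= 3)%N).
have psi0V : psi 0%N <= V.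
  have k1 : k < 1 by apply: le_lt_trans sc c1.
  have l0 : 0 <= k / N.+1%:R by rewrite divr_ge0// /k sqr_ge0.
  have nl : N.+1%:R * (k / N.+1%:R) = k by rewrite mulrC divfK.
  have := @rad_expR_sqr R N.+1 _ l0; rewrite nl => /(_ k1).
  have -> : rad N.+1 (fun o => expR (k / N.+1%:R * o ^+ 2 / 2)) = psi 0%N.
    by apply: eq_rad => o; rewrite expr0 mul1r; congr expR; field.
  rewrite -ler_pdivlMr ?subr_gt0// mul1r => h; apply: (le_trans h).
  by rewrite /V lef_pV2 ?posrE ?subr_gt0//; lra.
have vE : (1 - k)^-1 = (1 - s ^+ 2)^-1 by [].
have hF := limit_form_value_le n1 s0 sc c1 vE.
rewrite -/k -/w -/S in hF.
have w0 : 0 <= s * w <= 1 + n%:R.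
  have s1 : s <= 1 by rewrite -(@ler_pXn2r _ 2)// ?nnegrE// expr1n; exact: ltW (le_lt_trans sc c1).
  have os : 0 <= odd_sum n s <= n%:R.
    rewrite sumr_ge0/=; last by move=> j _; rewrite exprn_ge0.
    apply: (@le_trans _ _ (\sum_(j < n) 1)); last by rewrite sumr_const card_ord.
    rewrite /odd_sum big_mkcond; apply: ler_sum => j _; case: ifP => _ //.
    exact: exprn_ile1.
  case/andP: os => o0 on; rewrite mulr_ge0 ?addr_ge0//=.
  apply: (@le_trans _ _ w); first by rewrite ler_piMl// addr_ge0.
  exact: lerD.
move: kc; rewrite -/r -/psi -/D -/M in st1 st2 m0 m1 m2 *; move=> kc.
rewrite -/i in st1 st2.
have v0 : 0 < 1 - k by case/andP: kc => _ h; rewrite subr_gt0; apply: le_lt_trans h c1.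
pose v := (1 - k)^-1; have vk : v * (1 - k) = 1 by rewrite mulVf// lt0r_neq0.
have v0' : 0 <= v by rewrite invr_ge0 ltW.
have vV : v <= V by rewrite lef_pV2 ?posrE// ?subr_gt0//; case/andP: kc => _; lra.
rewrite -/v in hF.
pose B := n%:R * c ^+ n.-1 / (1 - c) ^+ 2 / 2 + (c ^+ n.-1) ^+ 2 / (1 - c) ^+ 2 / 4.
have B0 : 0 <= B.
  have cn : 0 <= c ^+ n.-1 by exact: exprn_ge0.
  by apply: addr_ge0; rewrite divr_ge0// divr_ge0 ?sqr_ge0// mulr_ge0.
rewrite (_ : limit_error n c = V * B)// -/i -/B in hF *.
clear vE sc s0; clearbody B v psi M D S w V i r k.
have e1 : 0 <= expR (- k / 2) <= 1.
  by rewrite expR_ge0 /= -[leRHS]expR0 ler_expR; case/andP: kc; lra.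
move: w0 e1 psi0V m0 m1 m2 st1 st2 hF kc.
move: (expR _) (s * w) (w ^+ 2) S => e sw ww S' w0 e1 psi0V m0 m1 m2 st1 st2 hF kc.
pose d1 := psi 1 - psi 0 - k * psi 1.
pose d2 := psi 2 - 3 * psi 1 - k * psi 2.
(* The Stein relations solved for [psi 1] and [psi 2] in terms of [psi 0] and the defects; what
   multiplies [psi 0] in [Q] is then the normal mean bounded by [hF]. *)
have p1 : psi 1%N = v * psi 0%N + v * d1.
  by rewrite -[LHS]mul1r -vk /d1; ring.
have p2 : psi 2%N = 3 * v ^+ 2 * psi 0%N + 3 * v ^+ 2 * d1 + v * d2.
  rewrite -[LHS]mul1r -{1}vk; transitivity (3 * v * psi 1%N + v * d2); first by rewrite /d2; ring.
  by rewrite p1; ring.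
rewrite -/d1 -/d2 in st1 st2.
clearbody d1 d2.
set Q := (X in _ * (X + _)).
have QE : Q = (3 * k * v ^+ 2 / 4 + v / 2 - sw * v / 2 + ww / 4 - 1 / 2 - S' / 2) * psi 0%N
   + (k / 4 * (3 * v ^+ 2 * d1 + v * d2) + (1 / 2 - sw / 2) * v * d1).
  by rewrite /Q p1 p2; field.
have [k0 kc'] := andP kc; have [sw0 sw1] := andP w0; have [p00 p01] := andP m0.
have Di : 0 <= D * i by exact: mulr_ge0.
have vd1 : v * d1 <= V * (D * i).
  apply: (@le_trans _ _ (v * `|d1|)); first by rewrite ler_wpM2l// ler_norm.
  exact: ler_pM.
have vd1n : - (v * d1) <= V * (D * i).
  rewrite -mulrN; apply: (@le_trans _ _ (v * `|d1|)); last exact: ler_pM.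
  by rewrite ler_wpM2l// -normrN ler_norm.
have vd2 : v * d2 <= V * (D * i).
  apply: (@le_trans _ _ (v * `|d2|)); first by rewrite ler_wpM2l// ler_norm.
  exact: ler_pM.
have VDi : 0 <= V * (D * i) by exact: mulr_ge0.
have vvd1 : v ^+ 2 * d1 <= V * V * (D * i).
  rewrite expr2 -!mulrA; apply: (@le_trans _ _ (v * (V * (D * i)))); first exact: ler_wpM2l.
  exact: ler_wpM2r.
have VVDi : 0 <= V * V * (D * i) by rewrite mulr_ge0// mulr_ge0.
have t1 : k / 4 * (3 * v ^+ 2 * d1 + v * d2) <= 3 * (V * V * (D * i)) + V * (D * i).
  apply: (@le_trans _ _ (k / 4 * (3 * (V * V * (D * i)) + V * (D * i)))).
    rewrite ler_wpM2l//; [by rewrite divr_ge0|lra].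
  apply: ler_piMl; lra.
have t2 : (1 / 2 - sw / 2) * v * d1 <= (1 + n%:R) * (V * (D * i)).
  have : `|1 / 2 - sw / 2| <= 1 + n%:R.
    by rewrite ler_norml; have n0 := ler0n R n; apply/andP; split; lra.
  move=> h; rewrite -mulrA; apply: (le_trans (ler_norm _)); rewrite normrM.
  by apply: ler_pM => //; rewrite ler_norml; apply/andP; split; lra.
have QB : Q <= V * B + (3 * (V * V * (D * i)) + V * (D * i)) + (1 + n%:R) * (V * (D * i)).
  rewrite QE addrA; apply: lerD => //; apply: lerD => //.
  apply: (@le_trans _ _ (B * psi 0%N)); first by rewrite ler_wpM2r.
  by rewrite mulrC ler_wpM2r.
have EM : E * i * (psi 0 + 2 * psi 1 + psi 2) <= E * i * (4 * M).
  by rewrite ler_wpM2l ?mulr_ge0//; case/andP: m1 => _; case/andP: m2 => _; lra.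
have nV : 0 <= n%:R * (V * V * (D * i)) by rewrite mulr_ge0.
have nV' : 0 <= n%:R * (V * (D * i)) by rewrite mulr_ge0.
have VB : 0 <= V * B by exact: mulr_ge0.
have EiM : 0 <= E * i * (4 * M) by rewrite !mulr_ge0.
have [e0 e1'] := andP e1.
set U := V * B + _.
have U0 : Q + E * i * (psi 0 + 2 * psi 1 + psi 2) <= U by rewrite /U; nra.
have U1 : 0 <= U by rewrite /U; nra.
by apply: (le_trans (ler_wpM2l e0 U0)); exact: ler_piMl.
Qed.

End rademacher_limit.

(** * The quadratic partition function *)

Section spin_averages.
Variables (R : realType) (N : nat).

Definition spin (e : {ffun 'I_N -> bool}) (u : 'I_N) : R := (-1) ^+ e u.

Lemma spin_sqr e u : spin e u * spin e u = 1.
Proof. by rewrite /spin -signr_addb addbb. Qed.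

(** Multiplication by the signs of [e] permutes the configurations, so the overlap with a fixed one
    is distributed as a sum of independent signs. *)
Lemma average_overlap (F : R -> R) (e : {ffun 'I_N -> bool}) :
  (2 ^+ N)^-1 * \sum_(e' : {ffun 'I_N -> bool}) F (overlap_sum (spin e) (spin e')) = rad N F.
Proof.
pose h (e' : {ffun 'I_N -> bool}) : {ffun 'I_N -> bool} := [ffun u => e u (+) e' u].
have hK : cancel h h by move=> e'; apply/ffunP => u; rewrite !ffunE addbA addbb.
rewrite (reindex h) /=; last by exists h => ? _; exact: hK.
rewrite -sum_spins; congr (_ * _); apply: eq_bigr => e' _; congr F.
apply: eq_bigr => u _; rewrite /spin ffunE signr_addb mulrA -signr_addb addbb mul1r //.
Qed.

Lemma average_cst (c : R) : (2 ^+ N)^-1 * \sum_(e : {ffun 'I_N -> bool}) c = c.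
Proof.
rewrite sumr_const card_ffun card_bool card_ord -[c *+ _]mulr_natl natrX mulrA mulVf ?mul1r //.
Qed.

Lemma sum_pairs_sqr (f : 'I_N -> R) :
  2 * (\sum_(e in pairs N) f e.1 * f e.2) = (\sum_u f u) ^+ 2 - \sum_u f u ^+ 2.
Proof.
have := sum_pairs_sym (F := fun u v => f u * f v) (fun u v => mulrC _ _).
rewrite expr2 mulr_suml; under eq_bigr do rewrite -mulr_sumr.
by move=> ->; rewrite -addrA (eq_bigr (fun u => f u ^+ 2)) ?subrr ?addr0// => u _.
Qed.

Lemma sum_pairs_overlap (sigma tau : 'I_N -> R) :
  (forall u, sigma u * sigma u = 1) -> (forall u, tau u * tau u = 1) ->
  \sum_(e in pairs N) sigma e.1 * sigma e.2 * (tau e.1 * tau e.2) =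
  (overlap_sum sigma tau ^+ 2 - N%:R) / 2.
Proof.
move=> s2 t2; have := sum_pairs_sqr (fun u => sigma u * tau u).
rewrite -/(overlap_sum sigma tau).
rewrite [X in _ - X](eq_bigr (fun=> 1)); last first.
  by move=> u _; rewrite expr2 mulrACA s2 t2 mulr1.
rewrite sumr_const card_ord => <-.
rewrite mulrC mulKf//; apply: eq_bigr => e _; ring.
Qed.

Lemma card_pairs_half : \sum_(e in pairs N) (1 : R) = N%:R * (N%:R - 1) / 2.
Proof.
have := sum_pairs_sqr (fun=> 1); rewrite mulr1 expr1n.
set S := \sum_(e in _) _; rewrite sumr_const card_ord => h.
by apply: (@mulfI _ 2) => //; rewrite h; field.
Qed.

End spin_averages.

Section second_moment.
Variables (R : realType) (d : measure_display) (T : measurableType d) (P : probability T R).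
Variables (N : nat) (g : 'I_N * 'I_N -> {RV P >-> R}).

Definition pair_energy (f : 'I_N -> R) w :=
  (Num.sqrt N%:R)^-1 * \sum_(e in pairs N) f e.1 * f e.2 * g e w.

(** The energy has variance [(N - 1) / 2], so this weight has mean one. *)
Definition pair_weight s f w := expR (s * pair_energy f w - s ^+ 2 * (N%:R - 1) / 4).

Definition pair_average s w :=
  (2 ^+ N)^-1 * \sum_(e : {ffun 'I_N -> bool}) pair_weight s (spin R e) w.

(** Derivative of [pair_average] in [s]. *)
Definition pair_average' s w :=
  (2 ^+ N)^-1 * \sum_(e : {ffun 'I_N -> bool})
    (pair_energy (spin R e) w - s * (N%:R - 1) / 2) * pair_weight s (spin R e) w.

Definition cycle_slope n s w :=
  \sum_(k < n | (1 < k)%N) (s ^+ k.-1 * cycle_sum g k w - s ^+ (k.*2).-1) / 2.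

(** This is [Y' - Y Gamma'] in the notation of the overview. *)
Definition slope_error n s w := pair_average' s w - pair_average s w * cycle_slope n s w.

Hypothesis N4 : (4 <= N)%N.

Let Nr : N%:R != 0 :> R.
Proof. by rewrite pnatr_eq0; lia. Qed.

Let x2 : Num.sqrt N%:R ^+ 2 = N%:R :> R.
Proof. by rewrite sqr_sqrtr. Qed.

Let x0 : Num.sqrt N%:R != 0 :> R.
Proof. by apply: contraNneq Nr => h; rewrite -x2 h expr0n. Qed.

Section pair_of_spins.
Variables (sigma tau : 'I_N -> R) (s : R).
Hypothesis sigma2 : forall u, sigma u * sigma u = 1.
Hypothesis tau2 : forall u, tau u * tau u = 1.

Let q := overlap_sum sigma tau ^+ 2 / N%:R.
Let a := pair_tilt sigma tau s.

(** Completing the square; the prefactor is the part of half the squared shift that the two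
    normalizations do not cancel. *)
Lemma pair_weightM w :
  pair_weight s sigma w * pair_weight s tau w = expR (s ^+ 2 * (q - 1) / 2) * tilt g a w.
Proof.
rewrite /tilt -expR_sum -!expRD; congr expR; rewrite sumrB.
have -> : \sum_(e in pairs N) a e * g e w = s * (pair_energy sigma w + pair_energy tau w).
  rewrite /pair_energy -mulrDr -big_split/= mulrA mulr_sumr; apply: eq_bigr => e _.
  by rewrite /a /pair_tilt; ring.
have -> : \sum_(e in pairs N) a e ^+ 2 / 2 = s ^+ 2 * (N%:R - 1) / 2 + s ^+ 2 * (q - 1) / 2.
  rewrite (eq_bigr (fun e => s ^+ 2 / N%:R * (1 + sigma e.1 * sigma e.2 * (tau e.1 * tau e.2)))).
    rewrite -mulr_sumr big_split/= card_pairs_half sum_pairs_overlap// /q; field.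
    exact: Nr.
  move=> e _; rewrite /a /pair_tilt exprMn exprMn exprVn x2.
  have sq (f : 'I_N -> R) : (forall u, f u * f u = 1) -> (f e.1 * f e.2) ^+ 2 = 1.
    by move=> f2; rewrite expr2 mulrACA !f2 mulr1.
  by rewrite sqrrD !sq//; field.
by field.
Qed.

Let drift (f : 'I_N -> R) : (f = sigma \/ f = tau) ->
  (Num.sqrt N%:R)^-1 * (\sum_(e in pairs N) f e.1 * f e.2 * a e) =
  s * (N%:R - 1) / 2 + s * (q - 1) / 2.
Proof.
move=> hf; rewrite (eq_bigr (fun e => s / Num.sqrt N%:R *
    (1 + sigma e.1 * sigma e.2 * (tau e.1 * tau e.2)))); last first.
  move=> e _; rewrite /a /pair_tilt mulrCA; congr (_ * _).
  case: hf => ->; rewrite mulrDr.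
    by rewrite mulrACA sigma2 sigma2 mulr1; congr (_ + _); ring.
  by rewrite addrC mulrACA tau2 tau2 mulr1; congr (_ + _); ring.
rewrite -mulr_sumr big_split/= card_pairs_half sum_pairs_overlap// /q.
rewrite mulrA [_^-1 * _]mulrCA -invfM -expr2 x2; field; exact: Nr.
Qed.

Lemma centered_derivativeE n (f : 'I_N -> R) w : (f = sigma \/ f = tau) ->
  pair_energy f w - s * (N%:R - 1) / 2 - cycle_slope n s w =
  centered_derivative n g sigma tau s f w.
Proof.
move=> hf; rewrite /centered_derivative /noise_sum.
under eq_bigr do rewrite /noise mulrBr.
rewrite sumrB [X in _ = X + _ - _]mulrBr (drift hf) -/(pair_energy f w) -/q.
rewrite /cycle_slope /cycle_drift /odd_sum.
under eq_bigr do rewrite mulrBl.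
by rewrite sumrB -[X in _ - (_ - X)]mulr_suml; ring.
Qed.

End pair_of_spins.

Hypothesis g_indep : mutually_independent (pairs N) g.
Hypothesis g_normal : forall e, e \in pairs N -> normal_mgf P (g e).

(** The square is a double average over configurations. Each pair is handled by [tilted_pair_bound],
    whose bound depends on the pair only through its overlap. *)
Lemma slope_error_second_moment n s : 0 <= s <= 1 -> exists v,
  has_mean P (fun w => slope_error n s w ^+ 2) v /\
  v <= rad N (fun o => expR (s ^+ 2 * (o ^+ 2 / N%:R - 1) / 2) *
    (limit_form n s (o ^+ 2 / N%:R) +
     error_const R n * ((1 + o ^+ 2 / N%:R) ^+ 2 / Num.sqrt N%:R))).
Proof.
move=> /andP[s0 s1].
pose B e e' := tilted_pair_bound n g_indep g_normal N4 (@spin_sqr R N e) (@spin_sqr R N e') s0 s1.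
pose q (e e' : {ffun 'I_N -> bool}) : R := overlap_sum (spin R e) (spin R e') ^+ 2 / N%:R.
pose m e e' := expR (s ^+ 2 * (q e e' - 1) / 2) * sval (cid (B e e')).
exists ((2 ^+ N)^-1 * \sum_e (2 ^+ N)^-1 * \sum_e' m e e'); split.
  apply: (@eq_has_mean _ _ _ _ (fun w => (2 ^+ N)^-1 * \sum_(e : {ffun 'I_N -> bool})
    (2 ^+ N)^-1 * \sum_(e' : {ffun 'I_N -> bool})
      expR (s ^+ 2 * (q e e' - 1) / 2) *
      (centered_derivative n g (spin R e) (spin R e') s (spin R e) w *
       centered_derivative n g (spin R e) (spin R e') s (spin R e') w *
       tilt g (pair_tilt (spin R e) (spin R e') s) w))).
    move=> w.
    have sE : slope_error n s w = (2 ^+ N)^-1 * \sum_(e : {ffun 'I_N -> bool})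
        (pair_energy (spin R e) w - s * (N%:R - 1) / 2 - cycle_slope n s w) * pair_weight s (spin R e) w.
      rewrite /slope_error /pair_average' /pair_average -[_ * _ * cycle_slope n s w]mulrA -mulrBr; congr (_ * _).
      by rewrite mulr_suml -sumrB; apply: eq_bigr => e _; ring.
    rewrite [RHS]expr2 sE -[RHS]mulrA; congr (_ * _); rewrite mulr_suml; apply: eq_bigr => e _.
    rewrite [RHS]mulrCA; congr (_ * _); rewrite mulr_sumr; apply: eq_bigr => e' _.
    have sq := spin_sqr R e; have sq' := spin_sqr R e'.
    rewrite [RHS]mulrACA (pair_weightM s sq sq' w).
    rewrite (centered_derivativeE s sq sq' n w (or_introl erefl)).
    rewrite (centered_derivativeE s sq sq' n w (or_intror erefl)).
    by rewrite [LHS]mulrCA.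
  apply: has_meanZ; apply: has_mean_sum => e _; apply: has_meanZ.
  apply: has_mean_sum => e' _; apply: has_meanZ.
  by case: (svalP (cid (B e e'))).
rewrite -[leRHS](average_cst N); apply: ler_wpM2l; first by rewrite invr_ge0 exprn_ge0.
apply: ler_sum => e _; rewrite -(average_overlap _ e).
apply: ler_wpM2l; first by rewrite invr_ge0 exprn_ge0.
apply: ler_sum => e' _; rewrite /m -/(q e e') ler_wpM2l ?expR_ge0//.
by case: (svalP (cid (B e e'))).
Qed.

Lemma has_mean_cycle_sum2 k : (1 < k)%N -> exists v,
  has_mean P (fun w => cycle_sum g k w ^+ 2) v /\ v <= 2 * k%:R.
Proof.
move=> k1; exists (cycle_sum_pair_mean (N := N) (fun=> 0) k k); split.
  have := has_tilted_mean_cycle_sum2 g_indep g_normal (fun=> 0) k k.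
  apply: eq_has_mean => w; rewrite /tilt big1 ?mulr1 ?expr2// => e _.
  by rewrite ?expr2 !mul0r subr0 expR0.
exact: cycle_sum_second_moment.
Qed.

End second_moment.

(** * Integration along the parameter *)

Section exp_poly.
Variable R : realType.
Implicit Types (x b : R).

(** For fixed disorder [Y exp (- Gamma)] is, as a function of [s], a finite sum of exponentials of
    polynomials. Formal derivatives then give both the slope and its continuity. *)
Lemma is_derive_sum_expR (I : Type) (r : seq I) (p : I -> {poly R}) x :
  is_derive x (1 : R) (fun s => \sum_(i <- r) expR (p i).[s])
    (\sum_(i <- r) (p i)^`().[x] * expR (p i).[x]).
Proof.
elim: r => [|i r ih].
  rewrite big_nil (_ : (fun _ => _) = cst 0); first exact: is_derive_cst.
  by apply/funext => s; rewrite big_nil.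
rewrite big_cons (_ : (fun _ => _) =
    (expR \o horner (p i)) + (fun s => \sum_(j <- r) expR (p j).[s])).
  apply: is_deriveD => //; rewrite mulrC.
  exact: (is_derive1_comp (is_derive_expR _) (is_derive_poly _ _)).
by apply/funext => s; rewrite big_cons.
Qed.

Lemma continuous_sum_expR (I : Type) (r : seq I) (p q : I -> {poly R}) :
  continuous (fun s : R => \sum_(i <- r) (q i).[s] * expR (p i).[s]).
Proof.
move=> s; elim: r => [|i r ih].
  rewrite (_ : (fun _ => _) = cst 0); first exact: cst_continuous.
  by apply/funext => t; rewrite big_nil.
rewrite (_ : (fun _ => _) =
    (fun t => (q i).[t] * expR (p i).[t] + \sum_(j <- r) (q j).[t] * expR (p j).[t])).
  apply: cvgD => //; apply: cvgM; first exact: continuous_horner.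
  apply: (@continuous_comp _ _ _ (horner (p i)) expR); first exact: continuous_horner.
  exact: continuous_expR.
by apply/funext => t; rewrite big_cons.
Qed.

Lemma integral_sum_expR (I : Type) (r : seq I) (p : I -> {poly R}) b : 0 < b ->
  (\int[lebesgue_measure]_(s in `[0%R, b])
     (\sum_(i <- r) (p i)^`().[s] * expR (p i).[s])%R%:E =
   (\sum_(i <- r) expR (p i).[b])%R%:E - (\sum_(i <- r) expR (p i).[0])%R%:E)%E.
Proof.
move=> b0.
have cF : continuous (fun s : R => \sum_(i <- r) expR (p i).[s]).
  move=> s; apply: differentiable_continuous; apply/derivable1_diffP.
  by have [] := is_derive_sum_expR r p s.
apply: (@continuous_FTC2 _ _ (fun s => \sum_(i <- r) expR (p i).[s])) => //.
- exact/continuous_subspaceT/continuous_sum_expR.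
- split.
  + by move=> s _; have [] := is_derive_sum_expR r p s.
  + exact/cvg_at_right_filter/cF.
  + exact/cvg_at_left_filter/cF.
- by move=> s _; rewrite derive1E; have [_ ->] := is_derive_sum_expR r p s.
Qed.

End exp_poly.

Lemma measurable_fun_sum_cond d (T : measurableType d) (R : realType) (I : Type)
    (r : seq I) (Q : pred I) (F : I -> T -> R) :
  (forall i, Q i -> measurable_fun setT (F i)) ->
  measurable_fun setT (fun w => \sum_(i <- r | Q i) F i w).
Proof.
move=> mF; elim: r => [|i r ih].
  rewrite (_ : (fun _ => _) = cst 0); first exact: measurable_cst.
  by apply/funext => w; rewrite big_nil.
have [Qi|nQi] := boolP (Q i).
  rewrite (_ : (fun _ => _) = (fun w => F i w + \sum_(j <- r | Q j) F j w)).
    by apply: measurable_funD => //; exact: mF.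
  by apply/funext => w; rewrite big_cons Qi.
rewrite (_ : (fun _ => _) = (fun w => \sum_(j <- r | Q j) F j w))//.
by apply/funext => w; rewrite big_cons (negbTE nQi).
Qed.

Section pair_expansion.
Variables (R : realType) (d : measure_display) (T : measurableType d) (P : probability T R).
Variables (N : nat) (g : 'I_N * 'I_N -> {RV P >-> R}).
Hypothesis N4 : (4 <= N)%N.
Hypothesis g_indep : mutually_independent (pairs N) g.
Hypothesis g_normal : forall e, e \in pairs N -> normal_mgf P (g e).

Lemma measurable_cycle_sum k : (1 < k)%N -> measurable_fun setT (cycle_sum g k).
Proof.
move=> k1; have := has_tilted_mean_cycle_sum g_indep g_normal (fun=> 0) k1.
move=> /has_mean_measurable; apply: eq_measurable_fun => w _.
by rewrite /tilt big1 ?mulr1// => e _; rewrite mul0r ?expr2 mul0r mul0r subr0 expR0.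
Qed.

Section joint_measurability.
Context d' (T' : measurableType d') (f : T' -> R) (h : T' -> T).
Hypotheses (mf : measurable_fun setT f) (mh : measurable_fun setT h).

(** Parameter and disorder are arbitrary measurable functions of a third variable, which covers
    joint measurability, for Fubini, and both kinds of sections. *)
Lemma measurable_pair_energy sigma :
  measurable_fun setT (fun z => pair_energy g sigma (h z)).
Proof.
apply: measurable_funM => //; apply: measurable_fun_sum_cond => e _.
apply: measurable_funM => //; exact: measurableT_comp.
Qed.

Lemma measurable_pair_weight sigma :
  measurable_fun setT (fun z => pair_weight g (f z) sigma (h z)).
Proof.
apply: measurableT_comp => //; apply: measurable_funB.
  by apply: measurable_funM => //; exact: measurable_pair_energy.
by do 2 apply: measurable_funM => //; exact: measurable_funX.
Qed.

Lemma measurable_pair_average :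
  measurable_fun setT (fun z => pair_average g (f z) (h z)).
Proof.
apply: measurable_funM => //; apply: measurable_fun_sum_cond => e _.
exact: measurable_pair_weight.
Qed.

Lemma measurable_slope_error n :
  measurable_fun setT (fun z => slope_error g n (f z) (h z)).
Proof.
apply: measurable_funB.
  apply: measurable_funM => //; apply: measurable_fun_sum_cond => e _.
  apply: measurable_funM; last exact: measurable_pair_weight.
  apply: measurable_funB; first exact: measurable_pair_energy.
  by do 2 apply: measurable_funM => //.
apply: measurable_funM; first exact: measurable_pair_average.
apply: measurable_fun_sum_cond => k k1; apply: measurable_funM => //.
apply: measurable_funB; last exact: measurable_funX.
apply: measurable_funM; first exact: measurable_funX.
by apply: measurableT_comp => //; exact: measurable_cycle_sum.
Qed.

End joint_measurability.

Variables (n : nat) (b : R).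
Hypotheses (n1 : (1 < n)%N) (b0 : 0 < b) (b1 : b < 1).

(* A primitive of [cycle_slope]. *)
Definition cycle_exponent s w :=
  \sum_(k < n | (1 < k)%N) (2 * s ^+ k * cycle_sum g k w - s ^+ (k.*2)) / (4 * k%:R).

(** Bounds the exponent at once for all [s] up to [b], by [2 |C| <= C ^ 2 + 1]. Its mean is at most
    [1 / (1 - b)] whatever [n] and [N], since [E C_k ^ 2 <= 2 k] cancels the denominators [4 k]. *)
Definition cycle_tightness w :=
  \sum_(k < n | (1 < k)%N) b ^+ k * (cycle_sum g k w ^+ 2 + 2) / (4 * k%:R).

Lemma cycle_exponent_le s w : 0 <= s <= b -> `|cycle_exponent s w| <= cycle_tightness w.
Proof.
move=> /andP[s0 sb]; apply: (le_trans (ler_norm_sum _ _ _)).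
apply: ler_sum => k k1; move: (cycle_sum g k w) => C.
rewrite normrM (ger0_norm (_ : 0 <= (4 * k%:R)^-1)) ?invr_ge0 ?mulr_ge0//.
rewrite ler_wpM2r ?invr_ge0 ?mulr_ge0//.
apply: (le_trans (ler_normB _ _)).
have sk0 : 0 <= s ^+ k by exact: exprn_ge0.
have skb : s ^+ k <= b ^+ k by rewrite lerXn2r ?nnegrE// ltW.
have bk1 : b ^+ k <= 1 by rewrite exprn_ile1 ?ltW.
rewrite !normrM (ger0_norm sk0) (ger0_norm (_ : 0 <= 2 :> R))// -addnn exprD (ger0_norm (mulr_ge0 sk0 sk0)).
rewrite -(real_normK (num_real C)); set c : R := `|C|.
have c0 : 0 <= c by exact: normr_ge0.
have h1 : s ^+ k * s ^+ k <= b ^+ k by rewrite -[leRHS]mulr1 ler_pM// (le_trans skb).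
have h2 : 2 * c <= c ^+ 2 + 1 by have := sqr_ge0 (c - 1); nra.
have h3 : s ^+ k * (2 * c) <= b ^+ k * (c ^+ 2 + 1).
  by apply: ler_pM => //; exact: mulr_ge0.
nra.
Qed.

Lemma has_mean_cycle_tightness : exists v,
  has_mean P cycle_tightness v /\ v <= (1 - b)^-1.
Proof.
pose B k (k1 : (1 < k)%N) := has_mean_cycle_sum2 N4 g_indep g_normal k1.
have B' k : exists v, (1 < k)%N -> has_mean P (fun w => cycle_sum g k w ^+ 2) v /\ v <= 2 * k%:R.
  by have [/B[v hv]|_] := boolP (1 < k)%N; [exists v|exists 0].
pose m k := sval (cid (B' k)).
exists (\sum_(k < n | (1 < k)%N) b ^+ k / (4 * k%:R) * (m k + 2)); split.
  apply: (@eq_has_mean _ _ _ _ (fun w => \sum_(k < n | (1 < k)%N)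
     b ^+ k / (4 * k%:R) * (cycle_sum g k w ^+ 2 + 2))).
    by move=> w; apply: eq_bigr => k _; rewrite mulrAC.
  apply: has_mean_sum => k k1; apply: has_meanZ; apply: has_meanD; last exact: has_mean_cst.
  by have [] := svalP (cid (B' k)) k1.
apply: (@le_trans _ _ (\sum_(k < n) b ^+ k)).
  rewrite big_mkcond; apply: ler_sum => k _; case: ifP => k1; last by rewrite exprn_ge0 ?ltW.
  have [_ mk] := svalP (cid (B' k)) k1; rewrite -/(m k) in mk.
  have k0 : 1 <= k%:R :> R by rewrite ler1n ltnW.
  rewrite -mulrA; apply: ler_piMr; first by rewrite exprn_ge0 ?ltW.
  by rewrite [_^-1 * _]mulrC ler_pdivrMr; move: mk k0; lra.
rewrite -[leRHS]mul1r ler_pdivlMr ?subr_gt0//.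
have -> : (\sum_(k < n) b ^+ k) * (1 - b) = 1 - b ^+ n.
  by rewrite mulrC -opprB mulNr -subrX1 opprB.
by rewrite lerBlDr lerDl exprn_ge0// ltW.
Qed.

Let Q w : {poly R} := \sum_(k < n | (1 < k)%N)
  ((2 * cycle_sum g k w / (4 * k%:R)) *: 'X^k - (4 * k%:R)^-1 *: 'X^(k.*2)).

Let p w (e : {ffun 'I_N -> bool}) : {poly R} :=
  pair_energy g (spin R e) w *: 'X - ((N%:R - 1) / 4) *: 'X^2 - Q w.

Let horner_p w e s : (p w e).[s] =
  s * pair_energy g (spin R e) w - s ^+ 2 * (N%:R - 1) / 4 - cycle_exponent s w.
Proof.
rewrite /p !(hornerD, hornerN, hornerZ, hornerX, hornerXn) horner_sum; congr (_ - _ - _); [ring|ring|].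
by apply: eq_bigr => k _; rewrite !(hornerD, hornerN, hornerZ, hornerXn); ring.
Qed.

Let deriv_p w e s : (p w e)^`().[s] =
  pair_energy g (spin R e) w - s * (N%:R - 1) / 2 - cycle_slope g n s w.
Proof.
rewrite /p !derivB !derivZ derivX derivXn raddf_sum.
rewrite !(hornerD, hornerN, hornerZ, hornerC, hornerMn, hornerXn) horner_sum.
congr (_ - _ - _); [ring|by field|].
apply: eq_bigr => k k1; rewrite /= derivB !derivZ !derivXn !(hornerD, hornerN, hornerZ, hornerMn, hornerXn).
have k0 : k%:R != 0 :> R by rewrite pnatr_eq0; lia.
have k2 : (k.*2)%:R = k%:R * 2 :> R by rewrite -muln2 natrM.
rewrite -[s ^+ k.-1 *+ k]mulr_natr -[s ^+ _.-1 *+ k.*2]mulr_natr k2.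
by move: (s ^+ k.-1) (s ^+ _.-1) => x y; field.
Qed.

Let pair_averageE (s : R) w : pair_average g s w * expR (- cycle_exponent s w) =
  (2 ^+ N)^-1 * \sum_e expR (p w e).[s].
Proof.
rewrite -mulrA; congr (_ * _); rewrite mulr_suml; apply: eq_bigr => e _.
by rewrite horner_p /pair_weight -expRD.
Qed.

Let slope_errorE (s : R) w : slope_error g n s w * expR (- cycle_exponent s w) =
  (2 ^+ N)^-1 * \sum_e (p w e)^`().[s] * expR (p w e).[s].
Proof.
rewrite /slope_error /pair_average' /pair_average.
rewrite -[_ * _ * cycle_slope g n s w]mulrA -mulrBr -[LHS]mulrA; congr (_ * _).
rewrite mulr_suml -sumrB mulr_suml; apply: eq_bigr => e _.
have -> : expR (p w e).[s] = pair_weight g s (spin R e) w * expR (- cycle_exponent s w).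
  by rewrite horner_p /pair_weight -expRD.
by rewrite deriv_p; ring.
Qed.

Let pair_average0 w : pair_average g 0 w * expR (- cycle_exponent 0 w) = 1.
Proof.
rewrite pair_averageE -[RHS](average_cst N); congr (_ * _); apply: eq_bigr => e _.
rewrite horner_p mul0r expr0n/= mul0r mul0r /cycle_exponent big1 ?subr0 ?expR0// => k k1.
rewrite !expr0n; case: (k : nat) k1 => // k' _ /=.
by rewrite mulr0 mul0r subr0 mul0r.
Qed.

(** The last factor compensates [exp (- Gamma_s)] for all [s] simultaneously, so that a mean can be
    taken; it is undone on the event where [cycle_tightness] is bounded. *)
Definition expansion_error w :=
  `|pair_average g b w * expR (- cycle_exponent b w) - 1| * expR (- cycle_tightness w).

(** Fundamental theorem of calculus from the value [1] at [s = 0], after which the two exponentials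
    combine to at most one. *)
Let expansion_error_le w : ((expansion_error w)%:E <=
  \int[lebesgue_measure]_(s in `[0%R, b]) `|slope_error g n s w|%:E)%E.
Proof.
have := integral_sum_expR (index_enum _) (p w) b0.
set f := fun s : R => \sum_e (p w e)^`().[s] * expR (p w e).[s] => hf.
pose c : R := (2 ^+ N)^-1 * expR (- cycle_tightness w).
have c0 : 0 <= c by rewrite mulr_ge0 ?expR_ge0// invr_ge0 exprn_ge0.
have mf : measurable_fun `[0, b] f.
  by apply: measurable_funTS; apply: continuous_measurable_fun; exact: continuous_sum_expR.
have -> : (expansion_error w)%:E =
    (c%:E * `|\int[lebesgue_measure]_(s in `[0%R, b]) (f s)%:E|)%E.
  rewrite hf -EFinB abse_EFin -EFinM; congr EFin.
  rewrite /expansion_error -(pair_average0 w) !pair_averageE -mulrBr normrM.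
  by rewrite (ger0_norm (_ : 0 <= (2 ^+ N)^-1)) ?invr_ge0 ?exprn_ge0// /c; ring.
apply: (@le_trans _ _ (c%:E * \int[lebesgue_measure]_(s in `[0%R, b]) `|f s|%:E)%E).
  apply: lee_wpmul2l; first by rewrite lee_fin.
  by apply: le_abse_integral => //; exact/measurable_EFinP.
rewrite -ge0_integralZl_EFin//; last 1 first.
- by apply/measurable_EFinP; exact: measurableT_comp.
apply: ge0_le_integral => //.
- by move=> s _; rewrite lee_fin mulr_ge0.
- by apply/measurable_EFinP; apply: measurable_funM => //; exact: measurableT_comp.
- apply/measurable_EFinP; apply: measurable_funTS.
  apply: measurableT_comp => //.
  exact: (@measurable_slope_error _ _ id (fun=> w)).
- move=> s /=; rewrite in_itv /= => sb; rewrite -EFinM lee_fin.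
  have -> : c * `|f s| = `|slope_error g n s w| * (expR (- cycle_exponent s w) * expR (- cycle_tightness w)).
    rewrite mulrA -[X in _ * X * _](ger0_norm (expR_ge0 _)) -normrM slope_errorE normrM.
    by rewrite (ger0_norm (_ : 0 <= (2 ^+ N)^-1)) ?invr_ge0 ?exprn_ge0// /c; ring.
  apply: ler_piMr => //; rewrite -expRD -[leRHS]expR0 ler_expR.
  by have := cycle_exponent_le w sb; rewrite ler_norml => /andP[]; lra.
Qed.

Let measurable_expansion_error : measurable_fun setT expansion_error.
Proof.
have mC (k : 'I_n) : (1 < k)%N -> measurable_fun setT (cycle_sum g k) by exact: measurable_cycle_sum.
apply: measurable_funM.
  apply: measurableT_comp => //; apply: measurable_funB => //; apply: measurable_funM.
    exact: (@measurable_pair_average _ _ (fun=> b) id).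
  apply: measurableT_comp => //; apply: measurableT_comp => //.
  apply: measurable_fun_sum_cond => k k1; apply: measurable_funM => //.
  by apply: measurable_funB => //; apply: measurable_funM => //; exact: mC.
apply: measurableT_comp => //; apply: measurableT_comp => //.
apply: measurable_fun_sum_cond => k k1; apply: measurable_funM => //.
apply: measurable_funM => //; apply: measurable_funD => //.
by apply: measurable_funX; exact: mC.
Qed.

(** Fubini, and [|z| <= eta / 2 + z ^ 2 / (2 eta)] in place of the Cauchy-Schwarz inequality; [eta]
    is left free for the final choice of constants. *)
Lemma expansion_error_mean (eta M : R) : 0 < eta -> 0 <= M ->
  (forall s, 0 <= s <= b -> exists v,
     has_mean P (fun w => slope_error g n s w ^+ 2) v /\ v <= M) ->
  exists v, has_mean P expansion_error v /\ v <= eta / 2 + M / (2 * eta).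
Proof.
move=> eta0 M0 hM; pose C := eta / 2 + M / (2 * eta).
have C0 : 0 <= C by apply: addr_ge0; apply: divr_ge0 => //; lra.
have D0 w : 0 <= expansion_error w by rewrite mulr_ge0 ?expR_ge0.
pose F (z : T * measurableTypeR R) : \bar R :=
  (`|slope_error g n z.2 z.1| * \1_(`[0, b] : set R) z.2)%:E.
have mF : measurable_fun setT F.
  apply/measurable_EFinP; apply: measurable_funM.
    apply: measurableT_comp => //.
    by apply: measurable_slope_error; [exact: measurable_snd|exact: measurable_fst].
  apply: (measurableT_comp (f := (\1_(`[0, b] : set R) : R -> R))); last exact: measurable_snd.
  exact: measurable_indic.
have F0 z : (0 <= F z)%E by rewrite lee_fin mulr_ge0.
have hD : (\int[P]_w (expansion_error w)%:E <= C%:E)%E.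
  apply: (@le_trans _ _ (\int[P]_w \int[lebesgue_measure]_s F (w, s))%E).
    apply: ge0_le_integral => //.
    - by move=> w _; rewrite lee_fin.
    - exact/measurable_EFinP.
    - exact: (measurable_fun_fubini_tonelli_F F).
    - move=> w _; apply: (le_trans (expansion_error_le w)).
      rewrite integral_mkcond le_eqVlt; apply/orP; left; apply/eqP.
      apply: eq_integral => s _; rewrite patchE /F /= indicE.
      by case: ifPn => _; rewrite ?mulr1 ?mulr0.
  rewrite (fubini_tonelli F)//.
  apply: (@le_trans _ _ (\int[lebesgue_measure]_(s in `[0%R, b]) C%:E)%E).
    rewrite [leRHS]integral_mkcond; apply: ge0_le_integral => //.
    - by move=> s _; apply: integral_ge0.
    - exact: (measurable_fun_fubini_tonelli_G F).
    - apply/(measurable_restrictT _ _).1 => //; exact: measurable_cst.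
    - move=> s _; rewrite patchE; case: ifPn => [|sb]; last first.
        under eq_integral do rewrite /F /= indicE (negbTE sb) mulr0.
        by rewrite integral0.
      rewrite inE /= in_itv /= => sb; have [v [[iv ev] vM]] := hM s sb.
      apply: (@le_trans _ _ (\int[P]_w (eta / 2 + (2 * eta)^-1 * slope_error g n s w ^+ 2)%:E)%E).
        apply: ge0_le_integral => //.
        + apply/measurable_EFinP; apply: measurable_funM; last by rewrite /=; exact: measurable_cst.
          apply: measurableT_comp => //.
          exact: (@measurable_slope_error _ _ (fun=> s) id).
        + apply/measurable_EFinP; apply: measurable_funD => //; apply: measurable_funM => //.
          apply: measurable_funX; exact: (@measurable_slope_error _ _ (fun=> s) id).
        + move=> w _; rewrite lee_fin indicE; set z := slope_error _ _ _ _.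
          apply: (@le_trans _ _ `|z|); first by rewrite ler_piMr//; case: (_ \in _).
          rewrite -(real_normK (num_real z)); set y : R := `|z|.
          have := sqr_ge0 (y - eta); rewrite -[_ <= eta / 2 + _]subr_ge0.
          have -> : eta / 2 + (2 * eta)^-1 * y ^+ 2 - y = (y - eta) ^+ 2 / (2 * eta).
            by field; exact: lt0r_neq0.
          by move=> h; apply: divr_ge0 => //; lra.
      have hv : has_mean P (fun w => slope_error g n s w ^+ 2) v by split.
      have [_ ->] := has_meanD (has_mean_cst P (eta / 2)) (has_meanZ (2 * eta)^-1 hv).
      rewrite lee_fin /C lerD2l mulrC ler_wpM2r// invr_ge0; lra.
  rewrite integral_cst//= lebesgue_measure_itv/= lte_fin b0 sube0 -EFinM lee_fin.
  by rewrite ler_piMr// ltW.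
have fin : (\int[P]_w (expansion_error w)%:E)%E \is a fin_num.
  rewrite ge0_fin_numE; last by apply: integral_ge0 => w _; rewrite lee_fin.
  by apply: le_lt_trans hD _; rewrite ltry.
exists (fine (\int[P]_w (expansion_error w)%:E)%E); split.
  by apply: has_mean_ge0 => //; rewrite fineK.
by rewrite -lee_fin fineK.
Qed.

End pair_expansion.

(** * The terms of higher degree *)

Section gaussian_laws.
Context d (T : measurableType d) (R : realType) (P : probability T R).

Definition mfun_of (F : T -> R) (mF : measurable_fun setT F) : {RV P >-> R} :=
  HB.pack_for {mfun T >-> R} F (@isMeasurableFun.Build _ _ _ _ F mF).

(** Linear combinations of the process are Gaussian with unspecified parameters; these two moments
    identify them from the given means and covariances. *)
Lemma gaussian_law_mean (X : T -> R) (m v : R) : measurable_fun setT X -> 0 <= v ->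
  has_gaussian_law P X m v ->
  has_mean P X m /\ has_mean P (fun w => X w ^+ 2) (m ^+ 2 + v).
Proof.
move=> mX v0 lawX; pose X' := mfun_of mX.
have [v_eq0|v_neq0] := eqVneq v 0.
  (* The transfer to the law is applied to nonnegative functions only, so the mean of [X] is
     recovered as half of [(X + 1) ^ 2 - X ^ 2 - 1]. *)
  have sq t : has_mean P (fun w => (X w + t) ^+ 2) ((m + t) ^+ 2).
    have mt : measurable_fun setT (fun x : R => (x + t) ^+ 2).
      by apply: measurable_funX; exact: measurable_funD.
    apply: has_mean_ge0.
    - exact: (measurableT_comp mt).
    - by move=> w; exact: sqr_ge0.
    transitivity (\int[distribution P X']_x ((x + t) ^+ 2)%:E)%E.
      rewrite ge0_integral_distribution//; first exact/measurable_EFinP.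
      by move=> x; rewrite lee_fin sqr_ge0.
    rewrite (@eq_measure_integral _ _ _ _ (\d_m)); last first.
      by move=> A mA _; have := lawX A mA; rewrite /gaussian_law v_eq0 eqxx.
    rewrite integral_dirac//=; last exact/measurable_EFinP.
    by rewrite diracT mul1e.
  have sq0 : has_mean P (fun w => X w ^+ 2) (m ^+ 2).
    by have := sq 0; rewrite addr0; apply: eq_has_mean => w; rewrite addr0.
  split; last by rewrite v_eq0 addr0.
  have := has_meanZ (2^-1) (has_meanB (has_meanB (sq 1) sq0) (has_mean_cst P 1)).
  rewrite (_ : 2^-1 * _ = m); last by field.
  by apply: eq_has_mean => w; field.
have s0 : Num.sqrt v != 0 by rewrite sqrtr_eq0 -ltNge lt_neqAle eq_sym v_neq0.
have sv : 0 < v by rewrite lt_neqAle eq_sym v_neq0.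
have s2 : Num.sqrt v ^+ 2 = v by rewrite sqr_sqrtr.
pose Y w := (X w - m) / Num.sqrt v.
have nY : normal_mgf P Y.
  have mY : measurable_fun setT Y by apply: measurable_funM => //; exact: measurable_funB.
  split => // a.
  have my : measurable_fun setT (fun x : R => expR (a * ((x - m) / Num.sqrt v))).
    by apply: measurableT_comp => //; do 2 apply: measurable_funM => //; exact: measurable_funB.
  apply: has_mean_ge0.
  - exact: (measurableT_comp my).
  - by move=> w; exact: expR_ge0.
  transitivity (\int[distribution P X']_x (expR (a * ((x - m) / Num.sqrt v)))%:E)%E.
    rewrite ge0_integral_distribution//; exact/measurable_EFinP.
  rewrite (@integral_distribution_normal _ _ _ _ X' m (Num.sqrt v))//; last first.
    by move=> A mA; have := lawX A mA; rewrite /gaussian_law (negbTE v_neq0).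
  have E x : expR (a * ((x - m) / Num.sqrt v)) * normal_pdf m (Num.sqrt v) x =
      expR (a ^+ 2 / 2) * normal_pdf (m + a * Num.sqrt v) (Num.sqrt v) x.
    rewrite /normal_pdf (negbTE s0) mulrCA [RHS]mulrCA; congr (_ * _).
    rewrite /normal_fun -!expRD; congr expR.
    by field.
  under eq_integral do rewrite E EFinM.
  rewrite ge0_integralZl//=; last 2 first.
  - by apply: measurableT_comp => //; exact: measurable_normal_pdf.
  - by move=> x _; rewrite lee_fin normal_pdf_ge0.
  by rewrite integral_normal_pdf mule1.
have Y1 : has_mean P Y 0.
  have := has_mean_tilted_moment 1 0 nY.
  rewrite /= mulr1 -polyC1 derivC add0r hornerX mul0r; apply: eq_has_mean => w.
  by rewrite mul0r expR0 mulr1 expr1.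
have Y2 : has_mean P (fun w => Y w ^+ 2) 1.
  have := has_mean_tilted_moment 2 0 nY.
  rewrite /= mulr1 -polyC1 derivC add0r derivX hornerD hornerM hornerX hornerC.
  rewrite mulr0 addr0 mul1r expr0n mul0r expR0.
  by apply: eq_has_mean => w; rewrite mul0r expR0 mulr1.
have XE w : X w = Num.sqrt v * Y w + m by rewrite /Y; field.
clearbody Y.
split.
  have := has_meanD (has_meanZ (Num.sqrt v) Y1) (has_mean_cst P m).
  by rewrite mulr0 add0r; apply: eq_has_mean => w; rewrite -XE.
have := has_meanD (has_meanD (has_meanZ v Y2) (has_meanZ (2 * m * Num.sqrt v) Y1)) (has_mean_cst P (m ^+ 2)).
rewrite mulr1 mulr0 addr0 [v + _]addrC; apply: eq_has_mean => w.
by rewrite XE sqrrD exprMn s2; ring.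
Qed.

Lemma has_mean_expectation (X : {RV P >-> R}) (m c : R) :
  has_mean P X m -> ('E_P[X] = c%:E)%E -> m = c.
Proof. by move=> [_ h]; rewrite unlock h => -[]. Qed.

Section process.
Variables (I : Type) (X : I -> {RV P >-> R}) (K : I -> I -> R).
Hypothesis X_gauss : centered_gaussian_process X K.

Let lin n (t : 'I_n -> I) (a : 'I_n -> R) : exists m v : R,
  [/\ 0 <= v, has_gaussian_law P (fun w => \sum_(i < n) a i * X (t i) w) m v,
   has_mean P (fun w => \sum_(i < n) a i * X (t i) w) m &
   has_mean P (fun w => (\sum_(i < n) a i * X (t i) w) ^+ 2) (m ^+ 2 + v)].
Proof.
have [g _ _] := X_gauss; have [m [v [v0 h]]] := g n t a.
exists m, v; split => //; have [] // := gaussian_law_mean _ v0 h;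
  by apply: measurable_fun_sum_cond => i _; exact: measurable_funM.
Qed.

Let mean0 s : has_mean P (X s) 0.
Proof.
have [_ E0 _] := X_gauss.
have [m [v [_ _ h _]]] := lin (fun _ : 'I_1 => s) (fun=> 1).
have h1 : has_mean P (X s) m.
  by apply: eq_has_mean h => w; rewrite big_ord1 mul1r.
by rewrite -(has_mean_expectation h1 (E0 s)).
Qed.

Let sum2 (a b : R) s t : exists v : R,
  [/\ 0 <= v, has_gaussian_law P (fun w => a * X s w + b * X t w) 0 v &
   has_mean P (fun w => (a * X s w + b * X t w) ^+ 2) v].
Proof.
have [m [v [v0 law h1 h2]]] := lin (fun i : 'I_2 => if i == ord0 then s else t)
  (fun i => if i == ord0 then a else b).
have E w : \sum_(i < 2) (if i == ord0 then a else b) * X (if i == ord0 then s else t) w =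
    a * X s w + b * X t w by rewrite !big_ord_recl big_ord0 /= addr0.
have m0 : m = 0.
  apply: (has_mean_unique h1); have := has_meanD (has_meanZ a (mean0 s)) (has_meanZ b (mean0 t)).
  by rewrite !mulr0 addr0; apply: eq_has_mean => w; rewrite E.
rewrite m0 expr0n add0r in law h2.
exists v; split => //; last by apply: eq_has_mean h2 => w; rewrite E.
by move: law; congr (has_gaussian_law P _ 0 v); apply/funext => w; rewrite E.
Qed.

(** Polarization provides the integrability of the product; its value is then the given
    covariance. *)
Let cov s t : has_mean P (fun w => X s w * X t w) (K s t).
Proof.
have [_ _ EK] := X_gauss.
have [v1 [_ _ h1]] := sum2 1 1 s t; have [v2 [_ _ h2]] := sum2 1 0 s t.
have [v3 [_ _ h3]] := sum2 0 1 s t.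
have h : has_mean P (fun w => X s w * X t w) (2^-1 * (v1 - v2 - v3)).
  apply: eq_has_mean (has_meanZ 2^-1 (has_meanB (has_meanB h1 h2) h3)) => w.
  by field.
suff : 2^-1 * (v1 - v2 - v3) = K s t by move=> <-.
by have := EK s t; rewrite unlock => E; move: h => [_]; rewrite E => -[].
Qed.

Lemma gaussian_process_mgf (a b : R) s t :
  has_mean P (fun w => expR (a * X s w + b * X t w))
    (expR ((a ^+ 2 * K s s + 2 * a * b * K s t + b ^+ 2 * K t t) / 2)).
Proof.
have [v [v0 law h]] := sum2 a b s t.
have vE : v = a ^+ 2 * K s s + 2 * a * b * K s t + b ^+ 2 * K t t.
  apply: (has_mean_unique h).
  have := has_meanD (has_meanD (has_meanZ (a ^+ 2) (cov s s)) (has_meanZ (2 * a * b) (cov s t)))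
    (has_meanZ (b ^+ 2) (cov t t)).
  by apply: eq_has_mean => w; ring.
have mZ : measurable_fun setT (fun w => a * X s w + b * X t w).
  by apply: measurable_funD; exact: measurable_funM.
have := @gaussian_mgf _ _ _ P (mfun_of mZ) v 1 v0 law.
by rewrite expr1n mul1r vE; apply: eq_has_mean => w; rewrite mul1r.
Qed.

End process.

(** The product formula for a family indexed by the booleans. *)
Lemma has_meanM_independent (F G : T -> R) (u v : R) :
  (forall A B, measurable A -> measurable B ->
     P (F @^-1` A `&` G @^-1` B) = (P (F @^-1` A) * P (G @^-1` B))%E) ->
  has_mean P F u -> has_mean P G v -> has_mean P (fun w => F w * G w) (u * v).
Proof.
move=> FG hF hG.
pose X (c : bool) : {RV P >-> R} := if c then mfun_of (has_mean_measurable hF)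
  else mfun_of (has_mean_measurable hG).
have X_indep : mutually_independent [set: bool]%SET X.
  move=> D B _ mB.
  pose B' c := if c \in D then B c else setT.
  have mB' c : measurable (B' c) by rewrite /B'; case: ifP.
  have := FG _ _ (mB' true) (mB' false).
  rewrite (_ : _ `&` _ = \bigcap_(i in [set` D]) X i @^-1` B i); last first.
    apply/seteqP; split => w /=.
      by move=> [h1 h2] [] /= cD; [move: h1|move: h2]; rewrite /B' cD.
    by move=> h; split; rewrite /B'; case: ifP => // cD; exact: (h _ cD).
  move=> ->; rewrite (big_mkcond (fun i => i \in D)) big_bool /= /B'.
  by congr (_ * _)%E; case: ifP => _; rewrite ?preimage_setT ?probability_setT.
have E (h : bool -> R) : \prod_(i in [set: bool]%SET) h i = h true * h false.
  rewrite (eq_bigl predT); first exact: big_bool.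
  by move=> c; rewrite /= finset.in_setT.
have := @has_mean_prod _ _ _ _ _ _ _ X_indep (fun _ x => x) (fun c => if c then u else v).
rewrite E => H; apply: eq_has_mean (H _ _) => [w|c _|[] _]; first exact: E.
- exact: measurable_id.
- exact: hF.
- exact: hG.
Qed.

Lemma sigma_generated_preimage (I : Type) (X : I -> {RV P >-> R}) (F : T -> R) :
  measurable_fun (T := g_sigma_algebraType
    (\bigcup_i preimage_set_system setT (X i) measurable)) setT F ->
  forall A, measurable A -> sigma_generated X (F @^-1` A).
Proof. by move=> mF A mA; have := mF measurableT A mA; rewrite setTI. Qed.

Lemma sigma_generated_measurable (I : Type) (X : I -> {RV P >-> R}) i :
  measurable_fun (T := g_sigma_algebraType
    (\bigcup_i preimage_set_system setT (X i) measurable)) setT (X i).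
Proof.
move=> _ A mA; apply: sub_sigma_algebra; exists i => //.
by exists A.
Qed.

End gaussian_laws.

Section cycle_counts.
Variables (R : realType) (d : measure_display) (T : measurableType d) (P : probability T R).
Variables (N : nat) (J : 'I_N -> 'I_N -> {RV P >-> R}).
Hypothesis J_GOE : GOE J.
Hypothesis N_gt0 : (0 < N)%N.

Definition upper (e : 'I_N * 'I_N) : {RV P >-> R} := J e.1 e.2.

Lemma upper_indep : mutually_independent (pairs N) upper.
Proof.
move=> F B FN mB; apply: (GOE_indep J_GOE) => //.
by apply: (fintype.subset_trans FN); apply/fintype.subsetP => e; rewrite !inE => /ltnW.
Qed.

Lemma upper_normal e : e \in pairs N -> normal_mgf P (upper e).
Proof.
rewrite inE => ee; split=> [|a]; first exact: measurable_funP.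
have ne : e.1 != e.2 by apply: contraTneq ee => ->; rewrite ltnn.
by have := gaussian_mgf a (@ler01 R) (GOE_offdiag J_GOE ne); rewrite mulr1.
Qed.

Lemma upper_edge u v w : upper (edge u v) w = J u v w.
Proof. by rewrite /upper /edge; case: ifP => //= _; exact: GOE_sym. Qed.

Lemma cycle_weightE k (i : {ffun 'I_k -> 'I_N}) w : (1 < k)%N -> injective i ->
  \prod_(l < k) J (i l) (i (ordS l)) w = cycle_weight upper i w + (k == 2%N)%:R.
Proof.
move=> k1 inji; rewrite (eq_bigr (fun p => upper (cedge i p) w)); last first.
  by move=> p _; rewrite upper_edge.
rewrite -(prod_mult k1 inji (fun e => upper e w)) /cycle_weight.
have [k2|k2] : (2 < k)%N \/ k = 2%N by lia.
  rewrite gtn_eqF// addr0; apply: eq_bigr => e _.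
  by have := mult_le1 inji e k2; case: (mult i e) => [|[|//]] _; rewrite /hermite ?expr0 ?expr1.
pose p0 : 'I_k := Ordinal (ltnW k1); pose e0 := cedge i p0.
have e0P : e0 \in pairs N by exact: cedge_pairs.
have me0 : mult i e0 = 2%N by apply: mult_2 => //; exact: mult_cedge_gt0.
have m0 e : e \in pairs N -> e != e0 -> mult i e = 0%N.
  move=> eP ee0; have := etrans (sum_mult k1 inji) k2.
  rewrite (bigD1 e0)//= me0 (bigD1 e)/= ?eP//.
  by move/eqP; rewrite -[X in _ == X]addn0 eqn_add2l addn_eq0 => /andP[/eqP].
have -> : (k == 2%N) = true by apply/eqP.
rewrite (bigD1 e0)//= [in RHS](bigD1 e0)//= me0.
rewrite big1 ?mulr1; last by move=> e /andP[eP ee0]; rewrite m0.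
rewrite big1 ?mulr1; last by move=> e /andP[eP ee0]; rewrite m0.
by rewrite /hermite subrK.
Qed.

(** For [k = 2] each of the [N (N - 1)] walks has a squared variable, that is, its Hermite
    polynomial plus one; after division by [N] the ones add up to the centering [N - 1]. *)
Lemma cycle_countE k w : (1 < k)%N -> cycle_count J k w = cycle_sum upper k w.
Proof.
move=> k1; rewrite /cycle_count /cycle_sum.
rewrite (eq_bigr (fun i : {ffun 'I_k -> 'I_N} => cycle_weight upper i w + (k == 2%N)%:R)); last first.
  by move=> i /injectiveP inji; exact: cycle_weightE.
rewrite big_split/= mulrDr; have [->|k2] := eqVneq k 2%N; last by rewrite sumr_const mulr0n mul0rn mulr0 addr0 subr0.
rewrite sumr_const; have := card_inj_ffuns 'I_2 'I_N; rewrite !card_ord => h.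
have -> : #|[pred f : {ffun 'I_2 -> 'I_N} | injectiveb f]| = (N * N.-1)%N.
  by rewrite -cardsE h ffactnS ffactn1.
rewrite mulr1n sqr_sqrtr// natrM mulKf ?pnatr_eq0 -?lt0n//.
by rewrite -subn1 natrB// addrK.
Qed.

Lemma cycle_count1 w : cycle_count J 1 w = (Num.sqrt N%:R)^-1 * \sum_u J u u w.
Proof.
rewrite /cycle_count expr1 subr0; congr (_ * _).
pose h (u : 'I_N) : {ffun 'I_1 -> 'I_N} := [ffun=> u].
rewrite (reindex h)/=; last first.
  exists (fun i : {ffun 'I_1 -> 'I_N} => i ord0) => [u _|i _]; first by rewrite ffunE.
  by apply/ffunP => p; rewrite ffunE (ord1 p).
apply: eq_big => [u|u _]; last by rewrite big_ord1 !ffunE.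
by apply/injectiveP => p q _; rewrite (ord1 p) (ord1 q).
Qed.

Lemma cycle_count_gt k w : (N < k)%N -> (2 < k)%N -> cycle_count J k w = 0.
Proof.
move=> Nk k2; rewrite /cycle_count gtn_eqF// subr0 big1 ?mulr0// => i /injectiveP inji.
by have := leq_card _ inji; rewrite !card_ord leqNgt Nk.
Qed.

End cycle_counts.

Section partition_function.
Variables (R : realType) (alpha : nat -> R) (d : measure_display) (T : measurableType d).
Variables (P : probability T R) (N : nat) (J : 'I_N -> 'I_N -> {RV P >-> R}).
Variable Ht : set_type (@sphere R N) -> {RV P >-> R}.
Hypotheses (mod : spin_model alpha J Ht) (N_gt0 : (0 < N)%N) (alpha2 : 0 < alpha 2%N).
Variable beta : R.

Let b : R := Num.sqrt (2 * alpha 2%N) * beta.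

Definition residual_weight (e : {ffun 'I_N -> bool}) w :=
  expR (beta * Ht (cube_point R e) w - N%:R * beta ^+ 2 * xi_tilde alpha 1 / 2).

(** The partition function without its mean and without the factor due to the diagonal of [J]. *)
Definition normalized_average w := (2 ^+ N)^-1 *
  \sum_(e : {ffun 'I_N -> bool}) pair_weight (upper J) b (spin R e) w * residual_weight e w.

(** Squares of spins are one, so the diagonal contributes the same random constant to every
    configuration, a multiple of the first cycle count. *)
Lemma hamiltonian_cube e w : beta * hamiltonian alpha J Ht (cube_point R e) w =
  b * pair_energy (upper J) (spin R e) w + b * cycle_count J 1 w / 2 +
  beta * Ht (cube_point R e) w.
Proof.
have N0 : N%:R != 0 :> R by rewrite pnatr_eq0 -lt0n.
rewrite /hamiltonian mulrDr; congr (_ + _).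
rewrite /hamiltonian2 cycle_count1 /pair_energy.
rewrite (eq_bigr (fun u => \sum_v J u v w * spin R e u * spin R e v)); last first.
  by move=> u _; apply: eq_bigr => v _; rewrite !mxE.
rewrite (@sum_pairs_sym _ _ (fun u v => J u v w * spin R e u * spin R e v)); last first.
  by move=> u v; rewrite (GOE_sym (model_GOE mod)) mulrAC.
rewrite [X in _ + X](eq_bigr (fun u => J u u w)); last first.
  by move=> u _; rewrite -mulrA spin_sqr mulr1.
rewrite (eq_bigr (fun e' : 'I_N * 'I_N => spin R e e'.1 * spin R e e'.2 * upper J e' w)); last first.
  by move=> e' _; rewrite /upper; ring.
move: (\sum_(e' in pairs N) _) (\sum_u _) => A B.
rewrite /b !sqrtrM//; set r2 : R := Num.sqrt 2; set rN : R := Num.sqrt N%:R; set ra : R := Num.sqrt (alpha _).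
have r22 : r2 ^+ 2 = 2 by rewrite sqr_sqrtr.
have r20 : r2 != 0 by apply: contraTneq (@ltr0n R 2) => h; rewrite -r22 h expr0n ltxx.
have rN0 : rN != 0 by rewrite sqrtr_eq0 -ltNge ltr0n.
rewrite (_ : beta * _ = ra * beta * (2 / r2 * (rN^-1 * A)) + ra * beta / r2 * (rN^-1 * B)); last first.
  by field; rewrite ?r20 ?rN0.
have e1 : 2 / r2 = r2 by rewrite -{1}r22 expr2 mulfK.
have e2 : r2^-1 = r2 / 2 by apply: (@mulfI _ 2) => //; rewrite e1; field.
by rewrite e1 e2; field.
Qed.

(** The normalization of [pair_weight] has [N - 1] where the full mean has [N]; the difference is
    the constant [- b ^ 2 / 4] of the term [k = 1]. *)
Lemma partition_functionE w : partition_function alpha J Ht beta w =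
  expR (N%:R * (beta ^+ 2 / 2) * xi alpha 1 + (b * cycle_count J 1 w / 2 - b ^+ 2 / 4))
  * normalized_average w.
Proof.
rewrite /partition_function /normalized_average mulrCA; congr (_ * _).
rewrite mulr_sumr; apply: eq_bigr => e _.
rewrite hamiltonian_cube /pair_weight /residual_weight -!expRD; congr expR.
have b2 : b ^+ 2 = 2 * alpha 2%N * beta ^+ 2.
  by rewrite /b exprMn sqr_sqrtr// mulr_ge0// ltW.
rewrite /xi_tilde expr1n mulr1 b2.
by field.
Qed.

Lemma normalized_average_gt0 w : 0 < normalized_average w.
Proof.
rewrite mulr_gt0 ?invr_gt0 ?exprn_gt0//.
rewrite (bigD1 [ffun=> true])//= ltr_pwDl ?mulr_gt0 ?expR_gt0//.
by rewrite sumr_ge0// => e _; rewrite mulr_ge0 ?expR_ge0.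
Qed.

Lemma free_energyE w : free_energy alpha J Ht beta w - N%:R * (beta ^+ 2 / 2) * xi alpha 1 =
  (2 * b * cycle_count J 1 w - b ^+ 2) / 4 + ln (normalized_average w).
Proof.
rewrite /free_energy partition_functionE lnM ?posrE ?expR_gt0 ?normalized_average_gt0//.
by rewrite expRK; field.
Qed.

End partition_function.

Section mixtures.
Variables (R : realType) (alpha : nat -> R).
Hypothesis alpha_mix : mixture alpha.

Let cvg_pseries (r : R) : `|r| <= 1 -> cvgn (pseries alpha r).
Proof.
move=> r1; have := mixture_radius alpha_mix; rewrite /convergence_radius.
move=> /ereal_sup_gt[_ /= [x cx <-]]; rewrite lte_fin => x1.
exact: is_cvg_pseries_inside cx (le_lt_trans r1 x1).
Qed.

Let tail (r : R) n : R := pseries alpha r n - alpha 2%N * r ^+ 2.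

Let tail_cvg (r : R) : `|r| <= 1 -> tail r n @[n --> \oo] --> xi_tilde alpha r.
Proof. by move=> r1; apply: cvgB; [exact: cvg_pseries|exact: cvg_cst]. Qed.

Let tailE (r : R) n : tail r n.+3 = \sum_(3 <= k < n.+3) alpha k * r ^+ k.
Proof.
rewrite /tail /pseries /series /= [X in X - _]big_ltn// [X in _ + X - _]big_ltn//.
rewrite [X in _ + (_ + X) - _]big_ltn//.
rewrite (mixture_coef0 alpha_mix) (mixture_coef1 alpha_mix); ring.
Qed.

Lemma xi_tilde_le (r : R) : `|r| <= 1 ->
  `|xi_tilde alpha r| <= `|r| ^+ 3 * xi_tilde alpha 1.
Proof.
move=> r1.
have c1 : `|tail r n| @[n --> \oo] --> `|xi_tilde alpha r| by apply: cvg_norm; exact: tail_cvg.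
have c2 : `|r| ^+ 3 * tail 1 n @[n --> \oo] --> `|r| ^+ 3 * xi_tilde alpha 1.
  by apply: cvgM; [exact: cvg_cst|apply: tail_cvg; rewrite normr1].
apply: (ler_cvg_to c1 c2); exists 3%N => // -[|[|[|n]]]//= _.
rewrite !tailE mulr_sumr; apply: (le_trans (ler_norm_sum _ _ _)).
rewrite big_nat_cond [leRHS]big_nat_cond; apply: ler_sum => k /andP[/andP[k3 _] _].
rewrite expr1n mulr1 normrM normrX (ger0_norm (mixture_ge0 alpha_mix k)) mulrC.
apply: ler_wpM2r; first exact: mixture_ge0.
by rewrite ler_wiXn2l.
Qed.

Lemma xi_tilde1_ge0 : 0 <= xi_tilde alpha 1.
Proof. by have := xi_tilde_le (r := 1); rewrite normr1 expr1n mul1r => /(_ (lexx _)) /(le_trans (normr_ge0 _)). Qed.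

Lemma xi_tilde1_eq0 : (forall p, p <> 2%N -> alpha p = 0) -> xi_tilde alpha 1 = 0.
Proof.
move=> a0; apply: (cvg_unique _ (tail_cvg (r := 1) _)); rewrite ?normr1//.
apply: cvg_near_cst; exists 3%N => // -[|[|[|n]]]//= _.
rewrite tailE big_nat_cond big1// => k /andP[/andP[k3 _] _].
by rewrite a0 ?mul0r// => k2; rewrite k2 in k3.
Qed.

Lemma xi1E : xi alpha 1 = alpha 2%N + xi_tilde alpha 1.
Proof. by rewrite /xi_tilde expr1n mulr1 addrC subrK. Qed.

End mixtures.

Lemma expR_sub1_le (R : realType) (a m : R) : `|a| <= m -> expR a - 1 <= m * expR m.
Proof.
move=> am; have m0 : 0 <= m by apply: le_trans am.
have [a0|/ltW a0] := leP a 0.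
  apply: (@le_trans _ _ 0); last by rewrite mulr_ge0 ?expR_ge0.
  by rewrite subr_le0 -[leRHS]expR0 ler_expR.
have am' : a <= m by apply: le_trans am; exact: ler_norm.
apply: (@le_trans _ _ (a * expR a)); last by rewrite ler_pM ?expR_ge0// ler_expR.
have := ler_wpM2l (expR_ge0 a) (expR_ge1Dx (- a)).
rewrite -expRD subrr expR0; have := expR_ge0 a; nra.
Qed.

(** * Second moment of the residual process *)

Section residual.
Variables (R : realType) (alpha : nat -> R).
Hypotheses (alpha_mix : mixture alpha) (alpha2 : 0 < alpha 2%N).
Variable beta : R.

Let b : R := Num.sqrt (2 * alpha 2%N) * beta.
Let x1 : R := xi_tilde alpha 1.
(** Equal to [b ^ 2 + 2 * beta ^ 2 * x1]: the exponential rate in the squared overlap once the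
    residual covariance has been bounded by a quadratic one. *)
Let t : R := 2 * beta ^+ 2 * xi alpha 1.

Let b2 : b ^+ 2 = 2 * alpha 2%N * beta ^+ 2.
Proof. by rewrite /b exprMn sqr_sqrtr// mulr_ge0// ltW. Qed.

Section model.
Variables (d : measure_display) (T : measurableType d) (P : probability T R) (N : nat).
Variables (J : 'I_N -> 'I_N -> {RV P >-> R}) (Ht : set_type (@sphere R N) -> {RV P >-> R}).
Hypotheses (mod : spin_model alpha J Ht) (N4 : (4 <= N)%N).

Let N0 : 0 < N%:R :> R. Proof. by rewrite ltr0n; lia. Qed.

Let K (s s' : set_type (@sphere R N)) : R := N%:R * xi_tilde alpha (dotp (val s) (val s') / N%:R).

Let KE e e' : K (cube_point R e) (cube_point R e') =
  N%:R * xi_tilde alpha (overlap_sum (spin R e) (spin R e') / N%:R).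
Proof.
rewrite /K.
have -> // : dotp (val (cube_point R e)) (val (cube_point R e')) = overlap_sum (spin R e) (spin R e').
by apply: eq_bigr => u _; rewrite !mxE.
Qed.

Let Kdiag e : K (cube_point R e) (cube_point R e) = N%:R * x1.
Proof.
rewrite KE /overlap_sum (eq_bigr (fun=> 1)); last by move=> u _; rewrite spin_sqr.
by rewrite sumr_const card_ord divff// lt0r_neq0.
Qed.

Let residual_mean e e' : has_mean P
  (fun w => (residual_weight alpha Ht beta e w - 1) * (residual_weight alpha Ht beta e' w - 1))
  (expR (N%:R * beta ^+ 2 * xi_tilde alpha (overlap_sum (spin R e) (spin R e') / N%:R)) - 1).
Proof.
have h1 f : has_mean P (residual_weight alpha Ht beta f) 1.
  have := has_meanZ (expR (- (N%:R * beta ^+ 2 * x1 / 2)))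
    (gaussian_process_mgf (model_process mod) beta 0 (cube_point R f) (cube_point R f)).
  rewrite -/(K _ _) Kdiag -expRD (_ : - _ + _ = 0); last by field.
  rewrite expR0; apply: eq_has_mean => w; rewrite mul0r addr0 -expRD addrC; congr expR.
have h2 : has_mean P (fun w => residual_weight alpha Ht beta e w * residual_weight alpha Ht beta e' w)
   (expR (N%:R * beta ^+ 2 * xi_tilde alpha (overlap_sum (spin R e) (spin R e') / N%:R))).
  have := has_meanZ (expR (- (N%:R * beta ^+ 2 * x1)))
    (gaussian_process_mgf (model_process mod) beta beta (cube_point R e) (cube_point R e')).
  rewrite -!/(K _ _) !Kdiag KE -expRD.
  rewrite (_ : - _ + _ = N%:R * beta ^+ 2 * xi_tilde alpha (overlap_sum (spin R e) (spin R e') / N%:R)); last by field.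
  apply: eq_has_mean => w; rewrite /residual_weight -!expRD; congr expR.
  by rewrite -/x1; field.
have := has_meanD (has_meanB (has_meanB h2 (h1 e)) (h1 e')) (has_mean_cst P 1).
rewrite (_ : _ - 1 - 1 + 1 = expR (N%:R * beta ^+ 2 * xi_tilde alpha (overlap_sum (spin R e) (spin R e') / N%:R)) - 1); last by ring.
by apply: eq_has_mean => w; ring.
Qed.

Let weight_mean e e' : has_mean P
  (fun w => pair_weight (upper J) b (spin R e) w * pair_weight (upper J) b (spin R e') w)
  (expR (b ^+ 2 * (overlap_sum (spin R e) (spin R e') ^+ 2 / N%:R - 1) / 2)).
Proof.
have := has_tilted_mean_cst (upper_indep (model_GOE mod)) (upper_normal (model_GOE mod))
  (pair_tilt (spin R e) (spin R e') b) 1.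
move=> /(has_meanZ (expR (b ^+ 2 * (overlap_sum (spin R e) (spin R e') ^+ 2 / N%:R - 1) / 2))).
rewrite mulr1; apply: eq_has_mean => w.
by rewrite mul1r pair_weightM//; move=> u; exact: spin_sqr.
Qed.

(** Independence is given between generated sigma-algebras, so each factor has to be measurable for
    its own. *)
Let measurable_weight e : measurable_fun (T := g_sigma_algebraType
    (\bigcup_ij preimage_set_system setT ((fun ij : 'I_N * 'I_N => J ij.1 ij.2) ij) measurable))
  setT (pair_weight (upper J) b (spin R e)).
Proof.
apply: measurableT_comp => //; apply: measurable_funB => //.
apply: measurable_funM => //; apply: measurable_funM => //.
apply: measurable_fun_sum_cond => ij _; apply: measurable_funM => //.
exact: (@sigma_generated_measurable _ _ _ P _ (fun ij : 'I_N * 'I_N => J ij.1 ij.2) ij).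
Qed.

Let measurable_residual e : measurable_fun (T := g_sigma_algebraType
    (\bigcup_s preimage_set_system setT (Ht s) measurable))
  setT (residual_weight alpha Ht beta e).
Proof.
apply: measurableT_comp => //; apply: measurable_funB => //.
apply: measurable_funM => //; exact: sigma_generated_measurable.
Qed.

Let term_mean e e' : has_mean P
  (fun w => (pair_weight (upper J) b (spin R e) w * pair_weight (upper J) b (spin R e') w) *
    ((residual_weight alpha Ht beta e w - 1) * (residual_weight alpha Ht beta e' w - 1)))
  (expR (b ^+ 2 * (overlap_sum (spin R e) (spin R e') ^+ 2 / N%:R - 1) / 2) *
   (expR (N%:R * beta ^+ 2 * xi_tilde alpha (overlap_sum (spin R e) (spin R e') / N%:R)) - 1)).
Proof.
apply: has_meanM_independent; [|exact: weight_mean|exact: residual_mean].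
move=> A B mA mB; apply: (model_indep mod).
  by apply: sigma_generated_preimage => //; apply: measurable_funM; exact: measurable_weight.
apply: sigma_generated_preimage => //.
by apply: measurable_funM; apply: measurable_funB => //; exact: measurable_residual.
Qed.

Let q (O : R) := O ^+ 2 / N%:R.

(** The third power of the overlap is used twice: in the exponent its excess over a square is
    bounded by one, in the prefactor by [(1 + q) / sqrt N], which gives the rate. *)
Let term_le (O : R) : `|O| <= N%:R ->
  expR (b ^+ 2 * (q O - 1) / 2) * (expR (N%:R * beta ^+ 2 * xi_tilde alpha (O / N%:R)) - 1) <=
  beta ^+ 2 * x1 / Num.sqrt N%:R * ((1 + O ^+ 2 / N%:R) ^+ 2 * expR (t / N%:R * O ^+ 2 / 2)).
Proof.
move=> ON; have r1 : `|O / N%:R| <= 1.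
  by rewrite normrM normfV (gtr0_norm N0) ler_pdivrMr// mul1r.
have x10 : 0 <= x1 by exact: xi_tilde1_ge0.
have q0 : 0 <= q O by rewrite divr_ge0 ?sqr_ge0 ?(ltW N0).
have sN : 0 < Num.sqrt N%:R :> R by rewrite sqrtr_gt0.
have sN2 : Num.sqrt N%:R ^+ 2 = N%:R :> R by rewrite sqr_sqrtr.
have h3 : N%:R * `|O / N%:R| ^+ 3 = q O * `|O / N%:R|.
  rewrite exprS mulrCA mulrC; congr (_ * _).
  rewrite real_normK ?num_real// /q; field; exact: lt0r_neq0.
have rq : `|O / N%:R| <= (1 + q O) / Num.sqrt N%:R.
  have -> : `|O / N%:R| = (`|O| / Num.sqrt N%:R) / Num.sqrt N%:R.
    rewrite normrM normfV (gtr0_norm N0) -[in LHS]sN2 expr2 invfM.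
    by rewrite mulrA.
  rewrite ler_wpM2r ?invr_ge0 ?(ltW sN)//.
  have -> : q O = (`|O| / Num.sqrt N%:R) ^+ 2 by rewrite exprMn exprVn sN2 real_normK ?num_real.
  set z := `|O| / _; have := sqr_ge0 (z - 1); have := sqr_ge0 z; rewrite !expr2; nra.
have a1 : `|N%:R * beta ^+ 2 * xi_tilde alpha (O / N%:R)| <= beta ^+ 2 * x1 * (q O * `|O / N%:R|).
  rewrite normrM ger0_norm; last by rewrite mulr_ge0 ?sqr_ge0 ?(ltW N0).
  apply: (le_trans (ler_wpM2l _ (xi_tilde_le alpha_mix r1))).
    by rewrite mulr_ge0 ?sqr_ge0 ?(ltW N0).
  by rewrite -h3 -/x1 le_eqVlt; apply/orP; left; apply/eqP; ring.
have bx0 : 0 <= beta ^+ 2 * x1 by rewrite mulr_ge0 ?sqr_ge0.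
have a2 : beta ^+ 2 * x1 * (q O * `|O / N%:R|) <= beta ^+ 2 * x1 * q O.
  by rewrite ler_wpM2l// ler_piMr.
have a3 : beta ^+ 2 * x1 * (q O * `|O / N%:R|) <= beta ^+ 2 * x1 / Num.sqrt N%:R * (1 + q O) ^+ 2.
  rewrite -[leRHS]mulrA ler_wpM2l//; apply: (@le_trans _ _ ((1 + q O) * ((1 + q O) / Num.sqrt N%:R))).
    by apply: ler_pM => //; rewrite lerDr.
  by rewrite le_eqVlt; apply/orP; left; apply/eqP; ring.
have := expR_sub1_le a1; set m := beta ^+ 2 * x1 * (_ * _) in a1 a2 a3 *.
have m0 : 0 <= m by apply: le_trans a1.
clearbody m.
move=> h.
apply: (@le_trans _ _ (expR (b ^+ 2 * q O / 2) * (m * expR (beta ^+ 2 * x1 * q O)))).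
  apply: (@le_trans _ _ (expR (b ^+ 2 * (q O - 1) / 2) * (m * expR m))).
    by rewrite ler_wpM2l ?expR_ge0.
  apply: ler_pM; rewrite ?mulr_ge0 ?expR_ge0//.
    by rewrite ler_expR; have := sqr_ge0 b; lra.
  by rewrite ler_wpM2l// ler_expR.
rewrite mulrCA -expRD.
have -> : b ^+ 2 * q O / 2 + beta ^+ 2 * x1 * q O = t / N%:R * O ^+ 2 / 2.
  rewrite b2 /t xi1E -/x1 /q; field; exact: lt0r_neq0.
by rewrite mulrA ler_wpM2r ?expR_ge0.
Qed.

Lemma residual_second_moment : exists v,
  has_mean P (fun w => (normalized_average alpha J Ht beta w - pair_average (upper J) b w) ^+ 2) v /\
  v <= beta ^+ 2 * x1 / Num.sqrt N%:R *
    rad N (fun o => (1 + o ^+ 2 / N%:R) ^+ 2 * expR (t / N%:R * o ^+ 2 / 2)).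
Proof.
pose m (e e' : {ffun 'I_N -> bool}) :=
  expR (b ^+ 2 * (overlap_sum (spin R e) (spin R e') ^+ 2 / N%:R - 1) / 2) *
   (expR (N%:R * beta ^+ 2 * xi_tilde alpha (overlap_sum (spin R e) (spin R e') / N%:R)) - 1).
exists ((2 ^+ N)^-1 * \sum_e (2 ^+ N)^-1 * \sum_e' m e e'); split.
  have := has_meanZ (2 ^+ N)^-1 (has_mean_sum (index_enum _) (fun e (_ : true) =>
    has_meanZ (2 ^+ N)^-1 (has_mean_sum (index_enum _) (fun e' (_ : true) => term_mean e e')))).
  apply: eq_has_mean => w.
  have -> : normalized_average alpha J Ht beta w - pair_average (upper J) b w =
     (2 ^+ N)^-1 * \sum_(e : {ffun 'I_N -> bool}) pair_weight (upper J) b (spin R e) w *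
       (residual_weight alpha Ht beta e w - 1).
    rewrite /normalized_average /pair_average -mulrBr -sumrB; congr (_ * _).
    by apply: eq_bigr => e _; rewrite mulrBr mulr1.
  rewrite [RHS]expr2 -[RHS]mulrA; congr (_ * _); rewrite mulr_suml; apply: eq_bigr => e _.
  rewrite [RHS]mulrCA; congr (_ * _); rewrite mulr_sumr; apply: eq_bigr => e' _.
  by rewrite mulrACA.
rewrite -radZ -[leRHS](average_cst N); apply: ler_wpM2l; first by rewrite invr_ge0 exprn_ge0.
apply: ler_sum => e _; rewrite -(average_overlap _ e).
apply: ler_wpM2l; first by rewrite invr_ge0 exprn_ge0.
apply: ler_sum => e' _; apply: term_le; apply: overlap_sum_le => u; exact: spin_sqr.
Qed.

End model.

Lemma residual_bound : x1 = 0 \/ t < 1 -> exists K : R, 0 <= K /\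
  forall (d : measure_display) (T : measurableType d) (P : probability T R) (N : nat)
    (J : 'I_N -> 'I_N -> {RV P >-> R}) (Ht : set_type (@sphere R N) -> {RV P >-> R}),
  spin_model alpha J Ht -> (4 <= N)%N -> exists v,
  has_mean P (fun w => (normalized_average alpha J Ht beta w - pair_average (upper J) b w) ^+ 2) v /\
  v <= K / Num.sqrt N%:R.
Proof.
have x10 : 0 <= x1 by exact: xi_tilde1_ge0.
case=> [x0|t1].
  exists 0; split=> // d T P N J Ht mod N4.
  have [v [hv hle]] := residual_second_moment mod N4.
  by exists v; split=> //; move: hle; rewrite x0 mulr0 !mul0r.
have t0 : 0 <= t.
  rewrite /t xi1E; apply: mulr_ge0; first by apply: mulr_ge0 => //; exact: sqr_ge0.
  by apply: addr_ge0 => //; exact: ltW.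
pose e := (1 - t) / 2.
have e0 : 0 < e by rewrite divr_gt0// subr_gt0.
have te : t + e < 1 by rewrite /e; lra.
pose M := 2`!%:R * (2 / e) ^+ 2 * expR (e / 2) / (1 - t - e).
have M0 : 0 <= M.
  rewrite divr_ge0//; last by rewrite /e; lra.
  apply: mulr_ge0; last exact: expR_ge0.
  by apply: mulr_ge0 => //; apply: exprn_ge0; apply: divr_ge0 => //; exact: ltW.
exists (beta ^+ 2 * x1 * M); split.
  by apply: mulr_ge0 => //; apply: mulr_ge0 => //; exact: sqr_ge0.
move=> d T P N J Ht mod N4; have [v [hv hle]] := residual_second_moment mod N4.
exists v; split=> //; apply: (le_trans hle); rewrite [leRHS]mulrAC.
have N0 : 0 < N%:R :> R by rewrite ltr0n; lia.
apply: ler_wpM2l.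
  by apply: divr_ge0 => //; apply: mulr_ge0 => //; exact: sqr_ge0.
apply: rad_poly_expR => //; first by rewrite divr_ge0 ?(ltW N0).
by rewrite mulrC divfK ?lt0r_neq0.
Qed.

End residual.

(** * Convergence in probability *)

Lemma sum_geometric_le (R : realType) (b : R) n m : 0 <= b -> b < 1 ->
  \sum_(n <= k < m) b ^+ k <= b ^+ n / (1 - b).
Proof.
move=> b0 b1; have b1' : 0 < 1 - b by rewrite subr_gt0.
have [nm|mn] := leqP n m; last first.
  by rewrite big_geq ?(ltnW mn)// divr_ge0 ?exprn_ge0// ltW.
rewrite ler_pdivlMr//.
have -> : (\sum_(n <= k < m) b ^+ k) * (1 - b) = b ^+ n - b ^+ m.
  rewrite -[RHS]opprB -telescope_sumr// mulr_suml -sumrN; apply: eq_bigr => k _.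
  by rewrite exprS; ring.
by rewrite gerBl exprn_ge0.
Qed.

Lemma ln_near1 (R : realType) (z e : R) : `|z - 1| <= e -> e <= 2^-1 -> `|ln z| <= 2 * e.
Proof.
move=> ze e2; have e0 : 0 <= e by apply: le_trans ze.
have [z1 z2] : 1 - e <= z /\ z <= 1 + e by move: ze; rewrite ler_norml => /andP[]; lra.
have z0 : 0 < z by lra.
have up (y : R) : 0 < y -> ln y <= y - 1.
  by move=> y0; rewrite -ler_expR lnK ?posrE//; have := expR_ge1Dx (y - 1); lra.
have h1 := up z z0.
have h2 : - ln z <= z^-1 - 1 by rewrite -lnV ?posrE// up// invr_gt0.
have h3 : z^-1 <= 1 + 2 * e.
  by rewrite -[z^-1]mul1r ler_pdivrMr//; nra.
by rewrite ler_norml; apply/andP; split; lra.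
Qed.

Section expansion.
Variables (R : realType) (alpha : nat -> R).
Hypotheses (alpha_mix : mixture alpha) (alpha2 : 0 < alpha 2%N).
Variable beta : R.
Hypothesis beta_gt0 : 0 < beta.

Let b : R := Num.sqrt (2 * alpha 2%N) * beta.
Hypothesis b1 : b < 1.

Let b0 : 0 < b. Proof. by rewrite mulr_gt0// sqrtr_gt0 mulr_gt0. Qed.

Let square_sum m : R := \sum_(1 <= k < m) b ^+ k ^+ 2 / (4 * k%:R).

Let square_term k : 0 <= b ^+ k ^+ 2 / (4 * k%:R) <= b ^+ k.
Proof.
rewrite divr_ge0 ?sqr_ge0 ?mulr_ge0//=; case: k => [|k].
  by rewrite mulr0 invr0 mulr0 exprn_ge0// ltW.
have k1 : 1 <= k.+1%:R :> R by rewrite ler1n.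
rewrite ler_pdivrMr; last by lra.
rewrite expr2 ler_wpM2l ?exprn_ge0 ?(ltW b0)//.
by apply: (@le_trans _ _ 1); [rewrite exprn_ile1 ?ltW|lra].
Qed.

Let square_sum_cvg : cvgn square_sum.
Proof.
have -> : square_sum = series (fun k => b ^+ k ^+ 2 / (4 * k%:R)).
  apply/funext => -[|m]; rewrite /square_sum /series/=; first by rewrite !big_geq.
  by rewrite [RHS]big_ltn// mulr0 invr0 mulr0 add0r.
apply: (@series_le_cvg _ _ (geometric 1 b)) => [k|k|k|].
- by case/andP: (square_term k).
- by rewrite /geometric /= mul1r exprn_ge0// ltW.
- by rewrite /geometric /= mul1r; case/andP: (square_term k).
- by apply: is_cvg_geometric_series; rewrite ger0_norm// ltW.
Qed.

Let square_limit : R := limn square_sum.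

Let square_limit_le n : (0 < n)%N -> `|square_limit - square_sum n| <= b ^+ n / (1 - b).
Proof.
move=> n0.
have step m : (n <= m)%N -> 0 <= square_sum m - square_sum n <= b ^+ n / (1 - b).
  move=> nm; rewrite /square_sum (@big_cat_nat _ _ _ n 1 m)//= addrAC subrr add0r.
  apply/andP; split; first by apply: sumr_ge0 => k _; case/andP: (square_term k).
  apply: le_trans (sum_geometric_le n m (ltW b0) b1).
  by apply: ler_sum => k _; case/andP: (square_term k).
rewrite ler_norml; apply/andP; split.
  apply: (@le_trans _ _ 0).
    by rewrite oppr_le0 divr_ge0 ?exprn_ge0 ?(ltW b0)// subr_ge0 ltW.
  rewrite subr_ge0; apply: limr_ge => //; exists n => // m /= nm.
  by have /andP[] := step m nm; rewrite subr_ge0.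
rewrite lerBlDr; apply: limr_le => //; exists n => // m /= nm.
by have /andP[_] := step m nm; rewrite lerBlDr.
Qed.

Section model.
Variables (d : measure_display) (T : measurableType d) (P : probability T R) (N : nat).
Variables (J : 'I_N -> 'I_N -> {RV P >-> R}) (Ht : set_type (@sphere R N) -> {RV P >-> R}).
Hypotheses (mod : spin_model alpha J Ht) (N4 : (4 <= N)%N).

Let N_gt0 : (0 < N)%N. Proof. by lia. Qed.

Let g := upper J.
Let g_indep := upper_indep (model_GOE mod).
Let g_normal := upper_normal (model_GOE mod).
Let Yh w := normalized_average alpha J Ht beta w.

Definition expansion_gap w := free_energy alpha J Ht beta w
    - N%:R * (beta ^+ 2 / 2) * xi alpha 1
    - limn (fun n => \sum_(1 <= k < n)
        (2 * mu alpha beta k * cycle_count J k w - mu alpha beta k ^+ 2)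
        / (4 * k%:R)).

Definition cycle_tail n w :=
  \sum_(n <= k < N.+3) b ^+ k * (cycle_sum g k w ^+ 2 + 1) / (4 * k%:R).

(** The random part stops at [N], and only the deterministic series is infinite. The bound [N.+3]
    ensures [2 < k] beyond it, so that the centering of the second count cannot interfere. *)
Lemma cycle_series_limit w : limn (fun n => \sum_(1 <= k < n)
        (2 * mu alpha beta k * cycle_count J k w - mu alpha beta k ^+ 2)
        / (4 * k%:R)) =
  \sum_(1 <= k < N.+3) 2 * b ^+ k * cycle_count J k w / (4 * k%:R) - square_limit.
Proof.
apply/cvg_lim => //.
have h : (\sum_(1 <= k < N.+3) 2 * b ^+ k * cycle_count J k w / (4 * k%:R) - square_sum n)
    @[n --> \oo] -->
  \sum_(1 <= k < N.+3) 2 * b ^+ k * cycle_count J k w / (4 * k%:R) - square_limit.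
  by apply: cvgB; [exact: cvg_cst|exact: square_sum_cvg].
apply: cvg_trans h; apply: near_eq_cvg; exists N.+3 => // n /= Nn.
rewrite /mu -/b; under [RHS]eq_bigr do rewrite mulrBl.
rewrite [RHS]sumrB /square_sum; congr (_ - _).
rewrite [RHS](@big_cat_nat _ _ _ N.+3)//= [X in _ = _ + X]big_nat_cond.
rewrite [X in _ = _ + X]big1 ?addr0// => k /andP[/andP[k3 _] _].
by rewrite (cycle_count_gt J) ?mulr0 ?mul0r//; lia.
Qed.

(** The diagonal cancels the term [k = 1] of the series; [- b ^ 2 / 4] removes that term from
    [square_limit]. *)
Lemma expansion_gapE w : expansion_gap w = ln (Yh w)
  - \sum_(2 <= k < N.+3) 2 * b ^+ k * cycle_sum g k w / (4 * k%:R)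
  + square_limit - b ^+ 2 / 4.
Proof.
rewrite /expansion_gap cycle_series_limit (free_energyE mod)// -/b -/(Yh w).
rewrite big_ltn// expr1 (_ : \sum_(2 <= k < N.+3) 2 * b ^+ k * cycle_count J k w / _ =
   \sum_(2 <= k < N.+3) 2 * b ^+ k * cycle_sum g k w / (4 * k%:R)); first by field.
rewrite big_nat_cond [RHS]big_nat_cond; apply: eq_bigr => k /andP[/andP[k1 _] _].
by rewrite (cycle_countE (model_GOE mod)).
Qed.

Lemma expansion_gap_le n w : (2 <= n)%N -> (n <= N)%N ->
  `|expansion_gap w| <= `|ln (Yh w * expR (- cycle_exponent g n b w))| +
     (cycle_tail n w + b ^+ n / (1 - b)).
Proof.
move=> n2 nN; rewrite lnM ?posrE ?expR_gt0 ?normalized_average_gt0// expRK expansion_gapE.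
have -> : cycle_exponent g n b w = \sum_(2 <= k < n) 2 * b ^+ k * cycle_sum g k w / (4 * k%:R)
    - (square_sum n - b ^+ 2 / 4).
  rewrite /cycle_exponent -(big_mkord (fun k => 1 < k)%N
    (fun k => (2 * b ^+ k * cycle_sum g k w - b ^+ k.*2) / (4 * k%:R))).
  rewrite (@big_cat_nat _ _ _ 2)//= [X in X + _]big_nat_cond big1 ?add0r; last first.
    by move=> k /andP[/andP[_ k2] k1]; lia.
  rewrite /square_sum [in RHS](big_ltn (_ : 1 < n)%N)// expr1 mulr1 addrAC subrr add0r.
  rewrite -sumrB big_nat_cond [RHS]big_nat_cond; apply: eq_big => [k|k _].
    by rewrite andbT; apply: andb_idr => /andP[].
  by rewrite -exprM muln2 mulrBl.
set A := \sum_(2 <= k < n) _.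
rewrite (@big_cat_nat _ _ _ n 2 N.+3)//=; last by lia.
rewrite -/A; set B := \sum_(n <= k < N.+3) _.
rewrite (_ : _ - _ = (ln (Yh w) - (A - (square_sum n - b ^+ 2 / 4))) +
   (- B + (square_limit - square_sum n))); last by ring.
apply: (le_trans (ler_normD _ _)); rewrite lerD2l.
apply: (le_trans (ler_normD _ _)); apply: lerD; last by apply: square_limit_le; lia.
rewrite normrN; apply: (le_trans (ler_norm_sum _ _ _)).
apply: ler_sum => k _; rewrite normrM (ger0_norm (_ : 0 <= (4 * k%:R)^-1)) ?invr_ge0 ?mulr_ge0//.
rewrite ler_wpM2r ?invr_ge0 ?mulr_ge0//.
move: (cycle_sum g k w) => c.
rewrite (_ : 2 * b ^+ k * c = b ^+ k * (2 * c)); last by ring.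
rewrite normrM (ger0_norm (exprn_ge0 k (ltW b0))) ler_wpM2l ?exprn_ge0 ?(ltW b0)//.
by rewrite ler_norml; have := sqr_ge0 (c - 1); have := sqr_ge0 (c + 1); rewrite !expr2; nra.
Qed.

Lemma has_mean_cycle_tail n : (2 <= n)%N -> exists v,
  has_mean P (cycle_tail n) v /\ v <= b ^+ n / (1 - b).
Proof.
move=> n2.
have B' k : exists v, (1 < k)%N -> has_mean P (fun w => cycle_sum g k w ^+ 2) v /\ v <= 2 * k%:R.
  have [/(has_mean_cycle_sum2 N4 g_indep g_normal)[v hv]|_] := boolP (1 < k)%N;
    by [exists v|exists 0].
pose m k := sval (cid (B' k)).
(* The redundant filter keeps [n <= k] available under the sum. *)
exists (\sum_(n <= k < N.+3 | (n <= k < N.+3)%N && true) b ^+ k / (4 * k%:R) * (m k + 1)); split.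
  apply: (@eq_has_mean _ _ _ _ (fun w => \sum_(n <= k < N.+3 | (n <= k < N.+3)%N && true)
     b ^+ k / (4 * k%:R) * (cycle_sum g k w ^+ 2 + 1))).
    by move=> w; rewrite /cycle_tail [RHS]big_nat_cond; apply: eq_bigr => k _; rewrite mulrAC.
  apply: has_mean_sum => k /andP[/andP[nk _] _]; apply: has_meanZ; apply: has_meanD; last exact: has_mean_cst.
  by have [] := svalP (cid (B' k)) (leq_trans n2 nk).
apply: le_trans (sum_geometric_le n N.+3 (ltW b0) b1).
rewrite [leRHS]big_nat_cond; apply: ler_sum => k /andP[/andP[nk _] _].
have k2 := leq_trans n2 nk.
have [_ mk] := svalP (cid (B' k)) k2; rewrite -/(m k) in mk.
have k0 : 1 <= k%:R :> R by rewrite ler1n; lia.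
rewrite -mulrA; apply: ler_piMr; first by rewrite exprn_ge0 ?ltW.
by rewrite [_^-1 * _]mulrC ler_pdivrMr; move: mk k0; lra.
Qed.

Let measurable_gt (F : T -> R) (e : R) : measurable_fun setT F -> measurable [set w | e < F w].
Proof.
move=> mF; have -> : [set w | e < F w] = F @^-1` `]e, +oo[.
  by apply/seteqP; split => w /=; rewrite in_itv/= andbT.
by rewrite -[X in measurable X]setTI; apply: mF.
Qed.

Let measurable_Yh : measurable_fun setT Yh.
Proof.
apply: measurable_funM => //; apply: measurable_fun_sum_cond => e _; apply: measurable_funM.
  by apply: (measurable_pair_weight (upper J) (f := fun=> b) (h := id)).
by apply: measurableT_comp => //; apply: measurable_funB => //; exact: measurable_funM.
Qed.

Let measurable_gap : measurable_fun setT (fun w => `|expansion_gap w|).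
Proof.
apply: measurableT_comp => //.
have -> : expansion_gap = (fun w => ln (Yh w)
  - \sum_(2 <= k < N.+3) 2 * b ^+ k * cycle_sum g k w / (4 * k%:R)
  + square_limit - b ^+ 2 / 4) by apply/funext => w; exact: expansion_gapE.
apply: measurable_funB => //; apply: measurable_funD => //.
apply: measurable_funB; first exact: measurableT_comp (@measurable_ln R) measurable_Yh.
under eq_fun do rewrite big_nat_cond.
apply: measurable_fun_sum_cond => k /andP[/andP[k1 _] _].
by do 2 apply: measurable_funM => //; exact: measurable_cycle_sum.
Qed.

(** Markov's inequality for four events: the exponent exceeds [L], the expansion error exceeds [dl],
    the residual difference exceeds [dl], the cycle tail exceeds [e / 4]. Outside them the logarithm
    is at most [e / 2] and the two tails at most [e / 4] each. *)
Lemma expansion_probability n (e L eta M K dl : R) : (2 <= n)%N -> (n <= N)%N ->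
  0 < e -> 0 < L -> 0 < eta -> 0 <= M ->
  b ^+ n / (1 - b) <= e / 4 ->
  (forall s, 0 <= s <= b -> exists v,
     has_mean P (fun w => slope_error g n s w ^+ 2) v /\ v <= M) ->
  (exists v, has_mean P (fun w => (Yh w - pair_average g b w) ^+ 2) v /\ v <= K) ->
  dl = Num.min 2^-1 (e / 4) * expR (- L) / 2 ->
  (P [set w | (e < `|expansion_gap w|)%R] <=
    ((1 - b)^-1 / L + (eta / 2 + M / (2 * eta)) / dl + K / dl ^+ 2 +
     (b ^+ n / (1 - b)) / (e / 4))%:E)%E.
Proof.
move=> n2 nN e0 L0 eta0 M0 bn hM [vK [hK vK_le]] dlE.
have [vA [hA vA_le]] := has_mean_cycle_tightness N4 g_indep g_normal n b0 b1.
have [vD [hD vD_le]] := expansion_error_mean N4 g_indep g_normal n2 b0 b1 eta0 M0 hM.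
have [vT [hT vT_le]] := has_mean_cycle_tail n2.
have m0 : 0 < Num.min 2^-1 (e / 4) by rewrite lt_min invr_gt0 ltr0n divr_gt0.
have dl0 : 0 < dl by rewrite dlE divr_gt0// mulr_gt0// expR_gt0.
have A0 w : 0 <= cycle_tightness g n b w.
  by apply: sumr_ge0 => k _; rewrite divr_ge0 ?mulr_ge0// ?exprn_ge0 ?(ltW b0)// addr_ge0// sqr_ge0.
have D0 w : 0 <= expansion_error g n b w by rewrite mulr_ge0 ?expR_ge0.
have T0 w : 0 <= cycle_tail n w.
  by apply: sumr_ge0 => k _; rewrite divr_ge0 ?mulr_ge0// ?exprn_ge0 ?(ltW b0)// addr_ge0// sqr_ge0.
have e40 : 0 < e / 4 by rewrite divr_gt0.
have pA := has_mean_markov hA A0 L0.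
have pD := has_mean_markov hD D0 dl0.
have pK := has_mean_markov hK (fun w => sqr_ge0 _) (exprn_gt0 2 dl0).
have pT := has_mean_markov hT T0 e40.
set EA := [set w | _] in pA; set ED := [set w | _] in pD.
set EK := [set w | _] in pK; set ET := [set w | _] in pT.
have mEA : measurable EA by apply: measurable_gt; exact: has_mean_measurable hA.
have mED : measurable ED by apply: measurable_gt; exact: has_mean_measurable hD.
have mEK : measurable EK by apply: measurable_gt; exact: has_mean_measurable hK.
have mET : measurable ET by apply: measurable_gt; exact: has_mean_measurable hT.
apply: (@le_trans _ _ (P (EA `|` ED `|` EK `|` ET))).
  apply: le_measure; rewrite ?inE.
  - exact: measurable_gt measurable_gap.
  - by do 3 apply: measurableU => //.
  move=> w /= gap; apply: contrapT => /not_orP[/not_orP[/not_orP[]]].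
  move=> /negP; rewrite -leNgt => hA'; move=> /negP; rewrite -leNgt => hD'.
  move=> /negP; rewrite -leNgt => hK'; move=> /negP; rewrite -leNgt => hT'.
  have := expansion_gap_le w n2 nN.
  set G := cycle_exponent g n b w; set Yo := pair_average g b w in hK' *.
  have GA : `|G| <= cycle_tightness g n b w.
    by apply: cycle_exponent_le => //; rewrite ltW//=.
  have eG : expR (- G) <= expR L.
    by rewrite ler_expR; move: GA; rewrite ler_norml => /andP[]; lra.
  have YY : `|Yh w - Yo| <= dl.
    by rewrite -(@ler_pXn2r _ 2)// ?nnegrE ?(ltW dl0)// real_normK ?num_real.
  have Yoe : `|Yo * expR (- G) - 1| <= dl * expR L.
    have -> : `|Yo * expR (- G) - 1| = expansion_error g n b w * expR (cycle_tightness g n b w).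
      by rewrite /expansion_error -mulrA -expRD addNr expR0 mulr1.
    by apply: ler_pM => //; rewrite ?expR_ge0// ler_expR.
  (* Two errors of size [dl], each enlarged by at most [exp L]; [dl] was chosen so that they add up
     to this minimum. The [1 / 2] is the range of [ln_near1]. *)
  have z1 : `|Yh w * expR (- G) - 1| <= Num.min 2^-1 (e / 4).
    have -> : Yh w * expR (- G) - 1 = (Yh w - Yo) * expR (- G) + (Yo * expR (- G) - 1) by ring.
    apply: (le_trans (ler_normD _ _)); rewrite normrM (ger0_norm (expR_ge0 _)).
    have -> : Num.min 2^-1 (e / 4) = dl * expR L + dl * expR L.
      have eL : expR (- L) * expR L = 1 by rewrite -expRD addNr expR0.
      rewrite dlE; move: (Num.min _ _) => m.
      by transitivity (m * (expR (- L) * expR L)); [rewrite eL mulr1|field].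
    by apply: lerD => //; apply: ler_pM; rewrite ?expR_ge0.
  have := ln_near1 z1 _; rewrite ge_min lexx => /(_ isT) => hl.
  have : Num.min 2^-1 (e / 4) <= e / 4 by rewrite ge_min lexx orbT.
  move=> hm hg; have : `|expansion_gap w| <= e by lra.
  by rewrite leNgt gap.
apply: (le_trans (measureU2 _ _ _)) => //; first by do 2 apply: measurableU => //.
rewrite !EFinD; apply: leeD.
  apply: (le_trans (measureU2 _ _ _)) => //; first by apply: measurableU.
  apply: leeD.
    apply: (le_trans (measureU2 _ _ _)) => //; apply: leeD.
      by apply: (le_trans pA); rewrite lee_fin ler_wpM2r// invr_ge0 ltW.
    by apply: (le_trans pD); rewrite lee_fin ler_wpM2r// invr_ge0 ltW.
  by apply: (le_trans pK); rewrite lee_fin ler_wpM2r// invr_ge0 exprn_ge0// ltW.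
by apply: (le_trans pT); rewrite lee_fin ler_wpM2r// invr_ge0 ltW.
Qed.

End model.
End expansion.

Lemma error_const_ge0 (R : realType) n : 0 <= error_const R n.
Proof.
rewrite /error_const; apply: addr_ge0; last exact: sqr_ge0.
have K1 : 0 <= \sum_(k < n | (1 < k)%N) k%:R * 2 ^+ k * (1 + (k ^ 2)%:R) :> R.
  by apply: sumr_ge0 => k _; rewrite !mulr_ge0// exprn_ge0.
apply: addr_ge0; first by apply: mulr_ge0 => //; exact: addr_ge0.
apply: addr_ge0; apply: sumr_ge0 => k _; first by rewrite !mulr_ge0// exprn_ge0.
by apply: sumr_ge0 => l _; rewrite /overlap_const !mulr_ge0// ?addr_ge0 ?exprn_ge0.
Qed.

(** The growing factor [n] is paid for by half of the decay: [n b ^ (n - 1)] is at most the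
    geometric sum, and [b ^ (n - 1)] is left over. *)
Lemma limit_error_le (R : realType) n (b : R) : (0 < n)%N -> 0 <= b -> b < 1 ->
  limit_error n (b ^+ 2) <=
  b ^+ n.-1 * ((1 - b ^+ 2)^-1 * ((1 - b)^-1 / (1 - b ^+ 2) ^+ 2 / 2 + ((1 - b ^+ 2) ^+ 2)^-1 / 4)).
Proof.
move=> n0 b0 b1; rewrite /limit_error.
have c1 : b ^+ 2 < 1 by rewrite expr_lt1.
have v0 : 0 <= (1 - b ^+ 2)^-1 by rewrite invr_ge0 subr_ge0 ltW.
have w0 : 0 <= ((1 - b ^+ 2) ^+ 2)^-1 by rewrite invr_ge0 sqr_ge0.
have p0 : 0 <= b ^+ n.-1 by rewrite exprn_ge0.
have p1 : b ^+ n.-1 <= 1 by rewrite exprn_ile1// ltW.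
rewrite mulrCA; apply: ler_wpM2l => //; rewrite mulrDr !mulrA.
have cb : b ^+ 2 ^+ n.-1 = b ^+ n.-1 * b ^+ n.-1 by rewrite -exprM mulnC exprM expr2.
apply: lerD; rewrite ler_wpM2r// ler_wpM2r//.
  rewrite cb mulrA mulrC; apply: ler_wpM2l => //.
  rewrite -[leRHS]mul1r ler_pdivlMr ?subr_gt0//.
  have h : n%:R * b ^+ n.-1 <= \sum_(k < n) b ^+ k.
    rewrite mulr_natl -[n in _ *+ n]card_ord -sumr_const; apply: ler_sum => k _.
    by apply: ler_wiXn2l => //; [exact: ltW|rewrite -ltnS prednK].
  apply: (le_trans (ler_wpM2r _ h)); first by rewrite subr_ge0 ltW.
  by rewrite mulrC -opprB mulNr -subrX1 opprB gerBl exprn_ge0.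
by rewrite cb expr2 -mulrA; apply: ler_piMr => //; rewrite !mulr_ile1// mulr_ge0.
Qed.

Section convergence.
Variables (R : realType) (alpha : nat -> R).
Hypotheses (alpha_mix : mixture alpha) (alpha2 : 0 < alpha 2%N).
Variable beta : R.
Hypothesis beta_gt0 : 0 < beta.

Let b : R := Num.sqrt (2 * alpha 2%N) * beta.
Hypothesis b1 : b < 1.
Hypothesis residual_small : xi_tilde alpha 1 = 0 \/ 2 * beta ^+ 2 * xi alpha 1 < 1.

Variables (d : nat -> measure_display) (T : forall N, measurableType (d N)).
Variables (P : forall N, probability (T N) R).
Variables (J : forall N, 'I_N -> 'I_N -> {RV (P N) >-> R}).
Variables (Ht : forall N, set_type (@sphere R N) -> {RV (P N) >-> R}).
Hypothesis models : forall N, (0 < N)%N -> spin_model alpha (@J N) (@Ht N).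

Lemma expansion_gap_cvg :
  cvg_in_probability0 P (fun N => expansion_gap alpha beta (@J N) (@Ht N)).
Proof.
move=> e e0.
suff H (z : R) : 0 < z -> \forall N \near \oo,
    (P N [set w | (e < `|expansion_gap alpha beta (@J N) (@Ht N) w|)%R] <= z%:E)%E.
  have fin N (z : R) : (P N [set w | (e < `|expansion_gap alpha beta (@J N) (@Ht N) w|)%R] <= z%:E)%E ->
      P N [set w | (e < `|expansion_gap alpha beta (@J N) (@Ht N) w|)%R] \is a fin_num.
    by move=> h; rewrite ge0_fin_numE ?measure_ge0// (le_lt_trans h)// ltry.
  apply/fine_cvgP; split.
    by apply: filterS (H 1 ltr01) => N; exact: fin.
  apply/cvgrPdist_le => z z0; apply: filterS (H z z0) => N h /=.
  rewrite sub0r normrN ger0_norm ?fine_ge0 ?measure_ge0//.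
  by rewrite -lee_fin fineK// (fin _ _ h).
move=> z0.
have b0 : 0 < b by rewrite mulr_gt0// sqrtr_gt0 mulr_gt0.
have d1 : 0 < 1 - b by rewrite subr_gt0.
pose c := b ^+ 2.
have c1 : c < 1 by rewrite /c expr_lt1// ltW.
have c0 : 0 <= c by exact: sqr_ge0.
have [K [K0 hK]] := residual_bound alpha_mix alpha2 residual_small.
(* The constants are chosen in the order [L], [dl], [eta], [n], [N], so that each of the six terms
   of the final bound is at most [z / 8]. *)
pose L := 8 / ((1 - b) * z).
have L0 : 0 < L by rewrite divr_gt0// mulr_gt0.
have [dl dlE] : exists dl : R, dl = Num.min 2^-1 (e / 4) * expR (- L) / 2 by eexists.
have dl0 : 0 < dl.
  by rewrite dlE divr_gt0// mulr_gt0 ?expR_gt0// lt_min invr_gt0 ltr0n divr_gt0.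
pose eta : R := z * dl / 4.
have eta0 : 0 < eta by rewrite divr_gt0// mulr_gt0.
pose Q := (1 - b ^+ 2)^-1 * ((1 - b)^-1 / (1 - b ^+ 2) ^+ 2 / 2 + ((1 - b ^+ 2) ^+ 2)^-1 / 4).
have Q0 : 0 <= Q.
  have v0 : 0 <= (1 - b ^+ 2)^-1 by rewrite invr_ge0 subr_ge0 ltW.
  have w0 : 0 <= ((1 - b ^+ 2) ^+ 2)^-1 by rewrite invr_ge0 sqr_ge0.
  apply: mulr_ge0 => //; apply: addr_ge0; last exact: divr_ge0.
  by apply: divr_ge0 => //; apply: mulr_ge0 => //; rewrite invr_ge0 ltW.
have Q1 : 0 < Q + 1 by exact: ltr_wpDl.
(* One requirement for the limiting second moment, one for the deterministic tail and one for the
   probability of a large cycle tail. The added [1] avoids a division by zero. *)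
pose r := Num.min (z * (2 * eta) * dl / 8 / (Q + 1)) (Num.min ((1 - b) * (e / 4)) ((1 - b) * (e / 4) * (z / 8))).
have r0 : 0 < r.
  rewrite /r !lt_min; apply/and3P; split.
  - by do 2 apply: divr_gt0 => //; do 2 apply: mulr_gt0 => //; exact: mulr_gt0.
  - by apply: mulr_gt0 => //; exact: divr_gt0.
  - by apply: mulr_gt0; [apply: mulr_gt0 => //; exact: divr_gt0|exact: divr_gt0].
(* The exponent is [n.-1] for [n = m.+2], the power left over in [limit_error_le]. *)
have [m hm] : exists m, b ^+ m.+1 <= r.
  have bn : `|b| < 1 by rewrite ger0_norm// ltW.
  have /cvgrPdist_le/(_ r r0)[m _ H] := cvg_expr bn.
  by exists m; have := H m.+1 (leqnSn m); rewrite /= sub0r normrN ger0_norm// exprn_ge0// ltW.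
pose n := m.+2.
have n2 : (2 <= n)%N by [].
have hmn : b ^+ n <= r.
  by apply: le_trans hm; rewrite /n [leLHS]exprS ler_piMl ?exprn_ge0 ?ltW.
move: hm hmn; rewrite /r !le_min => /andP[rQ _] /and3P[_ re rez].
have tail1 : b ^+ n / (1 - b) <= e / 4 by rewrite ler_pdivrMr// mulrC.
have tail2 : b ^+ n / (1 - b) / (e / 4) <= z / 8.
  rewrite ler_pdivrMr ?divr_gt0// ler_pdivrMr//; apply: (le_trans rez).
  by rewrite le_eqVlt; apply/orP; left; apply/eqP; ring.
have lim1 : limit_error n c / (2 * eta) / dl <= z / 8.
  rewrite ler_pdivrMr// ler_pdivrMr ?mulr_gt0//.
  apply: (le_trans (limit_error_le (ltnW n2) (ltW b0) b1)); rewrite -/Q.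
  apply: (@le_trans _ _ (b ^+ n.-1 * (Q + 1))).
    by apply: ler_wpM2l; [rewrite exprn_ge0 ?ltW|rewrite lerDl].
  rewrite -ler_pdivlMr//.
  apply: (le_trans rQ); rewrite le_eqVlt; apply/orP; left; apply/eqP.
  by field; exact: lt0r_neq0.
have lim0 : 0 <= limit_error n c.
  have cc : 0 <= (1 - c)^-1 by rewrite invr_ge0 subr_ge0 ltW.
  have cn : 0 <= c ^+ n.-1 by rewrite exprn_ge0.
  apply: mulr_ge0 => //; apply: addr_ge0; do 2 apply: divr_ge0 => //; rewrite ?sqr_ge0//.
  exact: mulr_ge0.
have [K' [K'0 hK']] := rad_limit_form n2 (introT andP (conj c0 c1)) (error_const_ge0 R n).
have K1 : 0 < K + 1 by exact: ltr_wpDl.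
have K'1 : 0 < K' + 1 by exact: ltr_wpDl.
(* Target size for [1 / sqrt N]. Since [K'] depends on [n], [N] is taken large only once [n] is
   fixed. *)
pose y := Num.min (z * (2 * eta) * dl / 8 / (K' + 1)) (z * dl ^+ 2 / 8 / (K + 1)).
have y0 : 0 < y.
  rewrite lt_min; apply/andP; split; do 2 apply: divr_gt0 => //.
    by do 2 apply: mulr_gt0 => //; exact: mulr_gt0.
  by apply: mulr_gt0 => //; exact: exprn_gt0.
exists (maxn (maxn 4 n) (Num.bound (y ^- 2))) => // N /=.
rewrite !geq_max => /andP[/andP[N4 nN] Ny].
have sN : (Num.sqrt N%:R)^-1 <= y.
  have NN : y ^- 2 <= N%:R.
    apply: le_trans (_ : (Num.bound (y ^- 2))%:R <= _); last by rewrite ler_nat.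
    by rewrite ltW// archi_boundP// invr_ge0 exprn_ge0// ltW.
  have y2 : y^-1 <= Num.sqrt N%:R.
    rewrite -[y^-1]ger0_norm ?invr_ge0 ?(ltW y0)// -sqrtr_sqr exprVn.
    exact: ler_wsqrtr.
  rewrite -[leRHS]invrK lef_pV2 ?posrE ?invr_gt0// sqrtr_gt0 ltr0n.
  by apply: leq_trans N4.
move: sN; rewrite /y le_min => /andP[y1 y2].
have mod : spin_model alpha (@J N) (@Ht N) by apply: models; apply: leq_trans N4.
pose M := limit_error n c + K' / Num.sqrt N%:R.
have M0 : 0 <= M by apply: addr_ge0 => //; exact: divr_ge0.
have hM s : 0 <= s <= b -> exists v,
     has_mean (P N) (fun w => slope_error (upper (@J N)) n s w ^+ 2) v /\ v <= M.
  move=> /andP[s0 sb]; have s1 : 0 <= s <= 1 by rewrite s0 (le_trans sb)// ltW.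
  have [v [hv vle]] := slope_error_second_moment N4 (upper_indep (model_GOE mod))
    (upper_normal (model_GOE mod)) n s1.
  exists v; split => //; apply: (le_trans vle); apply: hK' => //.
    by apply: leq_trans N4.
  by rewrite /c lerXn2r ?nnegrE// ltW.
have := expansion_probability alpha2 beta_gt0 b1 mod N4 n2 nN e0 L0 eta0 M0 tail1 hM (hK _ _ _ _ _ _ mod N4) dlE.
move=> h; apply: (le_trans h); rewrite lee_fin -/b.
have t1 : (1 - b)^-1 / L = z / 8.
  by rewrite /L; field; rewrite !lt0r_neq0.
have t2 : eta / 2 / dl = z / 8 by rewrite /eta; field; exact: lt0r_neq0.
have t3 : K' / Num.sqrt N%:R / (2 * eta) / dl <= z / 8.
  rewrite ler_pdivrMr// ler_pdivrMr ?mulr_gt0//.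
  apply: (@le_trans _ _ ((K' + 1) / Num.sqrt N%:R)); first by rewrite ler_wpM2r ?invr_ge0// lerDl.
  rewrite mulrC -ler_pdivlMr//.
  apply: (le_trans y1); rewrite le_eqVlt; apply/orP; left; apply/eqP.
  by field; exact: lt0r_neq0.
have t4 : K / Num.sqrt N%:R / dl ^+ 2 <= z / 8.
  rewrite ler_pdivrMr ?exprn_gt0//.
  apply: (@le_trans _ _ ((K + 1) / Num.sqrt N%:R)); first by rewrite ler_wpM2r ?invr_ge0// lerDl.
  rewrite mulrC -ler_pdivlMr//.
  apply: (le_trans y2); rewrite le_eqVlt; apply/orP; left; apply/eqP.
  by field; exact: lt0r_neq0.
rewrite t1 (mulrDl (eta / 2)) t2 /M mulrDl mulrDl.
move: lim1 tail2 t3 t4; lra.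
Qed.

End convergence.

Theorem theorem1p2 (R : realType) (alpha : nat -> R)
    (mixture_alpha : mixture alpha) (alpha2_gt0 : 0 < alpha 2%N) :
  (exists beta_xi : R,
     [/\ 0 < beta_xi,
         beta_xi <= 1 / Num.sqrt (2 * alpha 2%N) &
         free_energy_expansion alpha beta_xi]) /\
  ((forall p : nat, p <> 2%N -> alpha p = 0) ->
     free_energy_expansion alpha (1 / Num.sqrt (2 * alpha 2%N))).
Proof.
have x10 : 0 <= xi_tilde alpha 1 by exact: xi_tilde1_ge0.
have a20 : 0 <= 2 * alpha 2%N by rewrite mulr_ge0// ltW.
have xi0 : 0 < xi alpha 1 by rewrite xi1E ltr_pwDl.
split.
  exists (1 / Num.sqrt (2 * xi alpha 1)).
  have s0 : 0 < Num.sqrt (2 * xi alpha 1) by rewrite sqrtr_gt0 mulr_gt0.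
  have s1 : 0 < Num.sqrt (2 * alpha 2%N) by rewrite sqrtr_gt0 mulr_gt0.
  have ss : Num.sqrt (2 * alpha 2%N) <= Num.sqrt (2 * xi alpha 1).
    by apply: ler_wsqrtr; rewrite ler_wpM2l// xi1E lerDl.
  split; first by rewrite divr_gt0.
    by rewrite !div1r lef_pV2.
  move=> d T P J Ht models beta beta0; rewrite ltr_pdivlMr// mulrC => hb.
  (* As [xi 1] is at least [alpha 2], the one condition on [beta] yields both [b < 1] and the
     smallness required of the residual part. *)
  apply: expansion_gap_cvg => //.
    by apply: le_lt_trans hb; rewrite ler_wpM2r// ltW.
  right; have := hb; rewrite -[_ < 1](@ltr_pXn2r _ 2)// ?nnegrE ?mulr_ge0 ?(ltW beta0)//.
  by rewrite expr1n exprMn sqr_sqrtr ?mulr_ge0 ?(ltW xi0)// mulrAC.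
move=> pure d T P J Ht models beta beta0; rewrite ltr_pdivlMr ?sqrtr_gt0 ?mulr_gt0// mulrC => hb.
by apply: expansion_gap_cvg => //; left; exact: xi_tilde1_eq0.
Qed.
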